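(* Let $(p,N)=(2,32)$ or $(p,N)=(3,27)$, and let $E$ be an elliptic curve defined over $\mathbb{Q}$ of conductor $N$. Then $$a_\ell(E)\equiv\tau(\ell)\pmod p$$ for all primes $\ell$ (including $\ell=p$).
   Context: Ramanujan's tau function $\tau:\{1,2,3,\dots\}\to\mathbb{Z}$ is defined by $\sum_{n\ge 1}\tau(n)q^n=q\prod_{n\ge 1}(1-q^n)^{24}$. For a prime $\ell$ of good reduction of $E$, $a_\ell(E)=1+\ell-|E(\mathbb{F}_\ell)|$; for a prime $\ell$ of additive reduction, $a_\ell(E)=0$. Equivalently, $a_\ell(E)$ is the $\ell$-th Fourier coefficient of the weight-two normalized eigenform of level $N$ attached to $E$. *)

(* Defs.v *)
From HB Require Import structures.
From mathcomp Require Import all_boot all_order all_algebra all_fingroup all_field.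
From mathcomp Require Import boolp.

Set Implicit Arguments.
Unset Strict Implicit.
Unset Printing Implicit Defensive.

Import Order.TTheory GRing.Theory Num.Theory.
Local Open Scope ring_scope.

(* The factors with m >= n do not affect the coefficient of q^n, so the
   infinite product may be cut off at m = n. *)
Definition tau (n : nat) : int :=
  ('X * \prod_(1 <= m < n.+1) (1 - 'X^m) ^+ 24 : {poly int})`_n.

(* The equation y^2 + a1 x y + a3 y = x^3 + a2 x^2 + a4 x + a6. *)
Record weierstrass (R : Type) := Weierstrass {
  wa1 : R; wa2 : R; wa3 : R; wa4 : R; wa6 : R }.

Definition map_weierstrass (R S : Type) (f : R -> S) (W : weierstrass R) :=
  Weierstrass (f (wa1 W)) (f (wa2 W)) (f (wa3 W)) (f (wa4 W)) (f (wa6 W)).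

Section Curve.
Variables (K : fieldType) (W : weierstrass K).
Let a1 := wa1 W. Let a2 := wa2 W. Let a3 := wa3 W.
Let a4 := wa4 W. Let a6 := wa6 W.

Definition discriminant : K :=
  let b2 := a1 ^+ 2 + 4 * a2 in
  let b4 := 2 * a4 + a1 * a3 in
  let b6 := a3 ^+ 2 + 4 * a6 in
  let b8 := a1 ^+ 2 * a6 + 4 * a2 * a6 - a1 * a3 * a4
            + a2 * a3 ^+ 2 - a4 ^+ 2 in
  - b2 ^+ 2 * b8 - 8 * b4 ^+ 3 - 27 * b6 ^+ 2 + 9 * b2 * b4 * b6.

Definition nonsingular : bool := discriminant != 0.

Definition on_affine (P : K * K) : bool :=
  let: (x, y) := P in
  y ^+ 2 + a1 * x * y + a3 * y == x ^+ 3 + a2 * x ^+ 2 + a4 * x + a6.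

(* None is the point at infinity. *)
Definition on_curve (P : option (K * K)) : bool :=
  if P is Some Q then on_affine Q else true.

Definition negy (P : K * K) : K := - P.2 - a1 * P.1 - a3.

Definition add_point (P Q : option (K * K)) : option (K * K) :=
  match P, Q with
  | None, _ => Q
  | _, None => P
  | Some (x1, y1), Some (x2, y2) =>
    if (x1 == x2) && (y2 == negy (x1, y1)) then None else
    let lam :=
      if x1 == x2
      then (3 * x1 ^+ 2 + 2 * a2 * x1 + a4 - a1 * y1) / (2 * y1 + a1 * x1 + a3)
      else (y2 - y1) / (x2 - x1) in
    let x3 := lam ^+ 2 + a1 * lam - a2 - x1 - x2 in
    Some (x3, negy (x3, lam * (x3 - x1) + y1))
  end.

Definition mul_point (n : nat) (P : option (K * K)) : option (K * K) :=
  iter n (add_point P) None.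

Definition singular_point (P : K * K) : bool :=
  let: (x, y) := P in
  [&& on_affine P,
      2 * y + a1 * x + a3 == 0 &
      a1 * y == 3 * x ^+ 2 + 2 * a2 * x + a4].

(* Its roots are the slopes of the tangent lines at a singular point of
   abscissa x: the quadratic part of the equation at that point (u, v being
   the displacements in x, y) is v^2 + a1 u v - (3 x + a2) u^2. *)
Definition tangent_poly (x : K) : {poly K} :=
  'X^2 + a1 *: 'X - (3 * x + a2)%:P.

Definition node (P : K * K) : bool :=
  singular_point P && separable_poly (tangent_poly P.1).

(* The model obtained by x = u^2 x' + r, y = u^3 y' + u^2 s x' + t. *)
Definition change_model (u r s t : K) : weierstrass K :=
  Weierstrass
    ((a1 + 2 * s) / u)
    ((a2 - s * a1 + 3 * r - s ^+ 2) / u ^+ 2)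
    ((a3 + r * a1 + 2 * t) / u ^+ 3)
    ((a4 - s * a3 + 2 * r * a2 - (t + r * s) * a1 + 3 * r ^+ 2 - 2 * s * t)
       / u ^+ 4)
    ((a6 + r * a4 + r ^+ 2 * a2 + r ^+ 3 - t * a3 - t ^+ 2 - r * t * a1)
       / u ^+ 6).

End Curve.

(* For p prime this says that p does not divide the denominator. *)
Definition pintegral (p : nat) (x : rat) : bool := coprime p `|denq x|%N.

Definition pintegral_model (p : nat) (E W : weierstrass rat) : Prop :=
  (exists u r s t : rat, u != 0 /\ W = change_model E u r s t) /\
  [&& pintegral p (wa1 W), pintegral p (wa2 W), pintegral p (wa3 W),
      pintegral p (wa4 W) & pintegral p (wa6 W)].

(* The discriminant of a p-integral model is p-integral, so its p-adic
   valuation is that of its numerator. *)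
Definition disc_val (p : nat) (W : weierstrass rat) : nat :=
  logn p `|numq (discriminant W)|%N.

Definition is_minimal_model (p : nat) (E W : weierstrass rat) : Prop :=
  pintegral_model p E W /\
  forall W', pintegral_model p E W' -> (disc_val p W <= disc_val p W')%N.

Lemma pintegral_int (p : nat) (x : rat) : x \is a Num.int -> pintegral p x.
Proof. by move=> /intrP[m ->]; rewrite /pintegral denq_int coprimen1. Qed.

Lemma pintegral_model_exists (p : nat) (E : weierstrass rat) :
  exists W, pintegral_model p E W.
Proof.
pose s := [:: wa1 E; wa2 E; wa3 E; wa4 E; wa6 E].
pose D : rat := \prod_(y <- s) (denq y)%:~R.
have D0 : D != 0 by rewrite prodf_seq_neq0; apply/allP => y _; rewrite intr_eq0 denq_neq0.
have DZ : D \is a Num.int by rewrite rpred_prod // => y _; rewrite intr_int.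
exists (change_model E D^-1 0 0 0); split.
  by exists D^-1, 0, 0, 0; rewrite invr_eq0.
have key (y : rat) n : y \in s -> pintegral p (y / D^-1 ^+ n.+1).
  move=> ys; apply: pintegral_int; rewrite exprVn invrK exprS mulrA.
  rewrite rpredM ?rpredX // {1}/D (big_rem y ys) /= mulrA -numqE rpredM //.
    by rewrite intr_int.
  by rewrite rpred_prod // => z _; rewrite intr_int.
rewrite /= !(mul0r, mulr0, expr0n, addr0, subr0) /=.
by rewrite -[X in _ / X]expr1 !key // !inE eqxx ?orbT.
Qed.

Lemma minimal_model_exists (p : nat) (E : weierstrass rat) :
  exists W, is_minimal_model p E W.
Proof.
have [W0 W0P] := pintegral_model_exists p E.
pose P n := `[< exists W, pintegral_model p E W /\ disc_val p W = n >].
have exP : exists n, P n by exists (disc_val p W0); apply/asboolP; exists W0.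
case: (ex_minnP exP) => m /asboolP[W [WP Wm]] min_m.
exists W; split=> // W' W'P; rewrite Wm; apply: min_m.
by apply/asboolP; exists W'.
Qed.

Definition minimal_model (p : nat) (E : weierstrass rat) : weierstrass rat :=
  projT1 (cid (minimal_model_exists p E)).

(* On p-integral rationals, ratr : rat -> 'F_p is reduction modulo p. *)
Definition reduction (p : nat) (E : weierstrass rat) : weierstrass 'F_p :=
  map_weierstrass (ratr : rat -> 'F_p) (minimal_model p E).

Definition good_reduction (p : nat) (E : weierstrass rat) : bool :=
  nonsingular (reduction p E).

Definition multiplicative_reduction (p : nat) (E : weierstrass rat) : bool :=
  [exists P : 'F_p * 'F_p, node (reduction p E) P].

Definition split_multiplicative_reduction (p : nat) (E : weierstrass rat) :=
  [exists P : 'F_p * 'F_p, node (reduction p E) P &&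
    [exists m : 'F_p, root (tangent_poly (reduction p E) P.1) m]].

(* The reduction is singular with a cusp in the last case. *)
Definition frob_trace (E : weierstrass rat) (l : nat) : int :=
  if good_reduction l E then
    1 + l%:Z - (#|[set P : option ('F_l * 'F_l)
                     | on_curve (reduction l E) P]|)%:Z
  else if split_multiplicative_reduction l E then 1
  else if multiplicative_reduction l E then -1
  else 0.

(* T lists the l-torsion points, all of them rational over L, and L is
   generated over rat by their coordinates. *)
Definition division_field (E : weierstrass rat) (l : nat)
    (L : splittingFieldType rat) (T : seq (option (L * L))) : Prop :=
  let EL := map_weierstrass (ratr : rat -> L) E in
  [/\ uniq T, size T = (l ^ 2)%N,
      forall P, (P \in T) = on_curve EL P && (mul_point EL l P == None) &
      <<1 & flatten [seq [:: P.1; P.2] | P <- pmap id T]>>%VS = {:L}%VS].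

(* A normalized discrete valuation of L above p, i.e. a prime of L above p;
   the value v 0 is irrelevant. *)
Definition valuation_above (p : nat) (L : splittingFieldType rat)
    (v : L -> int) : Prop :=
  [/\ forall x y, x != 0 -> y != 0 -> v (x * y) = v x + v y,
      forall x y, x != 0 -> y != 0 -> x + y != 0 ->
        Num.min (v x) (v y) <= v (x + y),
      exists2 x, x != 0 & v x = 1 &
      0 < v p%:R].

Definition in_power (L : splittingFieldType rat) (v : L -> int) (k : nat)
    (x : L) : Prop := x = 0 \/ k%:Z <= v x.

(* The i-th ramification group in the lower numbering. An automorphism in it
   fixes v, so for i >= 0 it is also the i-th ramification group of the
   completion of L at v over the p-adic field. *)
Definition ramification (L : splittingFieldType rat) (v : L -> int) (i : nat)
    : {set gal_of {:L}} :=
  [set s : gal_of {:L} |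
    `[< forall x : L, in_power v 0 x -> in_power v i.+1 (s x - x) >]].

Definition gal_point (L : splittingFieldType rat) (s : gal_of {:L})
    (P : option (L * L)) : option (L * L) :=
  omap (fun Q => (s Q.1, s Q.2)) P.

(* The dimension over the field with l elements of E[l] / E[l]^G, where T
   lists E[l]. *)
Definition moved_dim (l : nat) (L : splittingFieldType rat)
    (T : seq (option (L * L))) (G : {set gal_of {:L}}) : nat :=
  logn l (size T %/
    count (fun P => [forall (s | s \in G), gal_point s P == P]) T).

(* The wild part of the conductor exponent at p, in terms of the action of the
   higher ramification groups G_i on E[l] for an auxiliary prime l <> p:
     d = sum_(i >= 1) (#|G_i| / #|G_0|) dim (E[l] / E[l]^G_i);
   the terms with i >= n vanish as soon as G_n is trivial. *)
Definition wild_exponent (p : nat) (E : weierstrass rat) (d : rat) : Prop :=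
  exists (l : nat) (L : splittingFieldType rat) (T : seq (option (L * L)))
         (v : L -> int) (n : nat),
    [/\ prime l /\ l != p,
        division_field E l T,
        valuation_above p v,
        ramification v n = [set 1%g] &
        d = \sum_(1 <= i < n) #|ramification v i|%:R / #|ramification v 0|%:R
              * (moved_dim l T (ramification v i))%:R].

Definition conductor_exponent (p : nat) (E : weierstrass rat) (f : nat)
    : Prop :=
  if good_reduction p E then f = 0%N
  else if multiplicative_reduction p E then f = 1%N
  else exists2 d : rat, wild_exponent p E d & f%:R = 2 + d.

Definition has_conductor (E : weierstrass rat) (N : nat) : Prop :=
  (0 < N)%N /\ forall p, prime p -> conductor_exponent p E (logn p N).

(* Main.v *)
Require Import Defs.
From HB Require Import structures.
From mathcomp Require Import all_boot all_order all_fingroup all_algebra.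
From mathcomp Require Import all_solvable all_field realalg.
From mathcomp Require Import boolp.
From mathcomp Require Import ring lra zify.

(** The trace of Frobenius and tau are both computed modulo p, and for l <> p
    both are congruent to 1 + l.

    The conductor is a power of p with exponent at least 2, so E has good
    reduction outside p and additive reduction at p. Hence a_p = 0, and for
    l <> p it remains to show that p divides the number of points of E modulo l.
    This is what a rational point of order p would give; a rational abscissa of
    such a point turns out to be enough. Let F be the polynomial of degree 3 or 4
    whose roots are the abscissas of the points of order p = 2 or p = 3.

    - F has a rational root ([two_poly_rational_root],
      [three_poly_rational_root]). Good reduction outside p gives F, up to an
      affine change of variable, integral coefficients and an invariant (the
      discriminant of the cubic, J for the quartic, for which I = 0) equal to a
      power of p up to sign ([global_model]). An integral binary form with such
      an invariant has a nontrivial integral zero ([cubic_pow2_zero],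
      [quartic_pow3_zero]): when the power is large, the form has a multiple
      zero modulo p and can be shrunk; when it is small, Hermite's bound
      ([hermite]) on the minimum of a positive definite quadratic form
      attached to it provides a nonzero integral vector where the binary form
      has absolute value less than 1.

    - For p = 2 the root reduces modulo l to the abscissa of a point of order 2,
      and adding this point is a free involution ([card_even]).

    - For p = 3 the ordinate of the point of order 3 is, once the square in y
      is completed, the square root of a rational t, which is 1 or -3 up to
      squares: t is a square times a unit at every l <> 3, and this unit is
      congruent to 1 modulo 4 at l = 2 ([three_torsion_square_class]). Let l be odd. If t is a square
      modulo l, adding the point is a map of order 3 without fixed points
      ([card_mod3_square]). Otherwise l is 2 modulo 3; this argument applies to
      the quadratic twist by t, and both curves together have 2 (l + 1) points,
      a multiple of 3 ([card_mod3_nonsquare]). For l = 2, see [card_F2].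

    For tau, let P be Euler's product. Jacobi's series for P^3 ([jacobi_cube])
    shows that q P^24 = q (P^3)^8 is modulo 2 the sum of q^(m^2) over odd m, so
    that tau(l) is even for every prime l ([tau_mod2]). Modulo 3, q P^24 only
    has exponents congruent to 1 modulo 3, and there its coefficients are those
    of the sum of sigma(n) q^n ([tau_eq_sigma_mod3], whence [tau_mod3]), by the
    logarithmic derivative of P and Jacobi's series again. *)

Set Implicit Arguments.
Unset Strict Implicit.
Unset Printing Implicit Defensive.

Import Order.TTheory GRing.Theory Num.Theory.
Local Open Scope ring_scope.

(** * Minima of positive definite binary quadratic forms *)

Definition bqf (R : pzRingType) (A B C : R) (x y : int) : R :=
  A * x%:~R ^+ 2 + B * x%:~R * y%:~R + C * y%:~R ^+ 2.

(** Completing the square in either variable bounds the coordinates of every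
    vector at which the form is at most A, so the minimum is attained in a
    finite box. *)
Lemma posdef_min (R : archiRealFieldType) (A B C : R) :
  0 < A -> 0 < 4 * A * C - B ^+ 2 ->
  exists x y : int, [/\ (x != 0) || (y != 0) &
    forall z t : int, (z != 0) || (t != 0) -> bqf A B C x y <= bqf A B C z t].
Proof.
move=> A_gt0 disc_gt0; pose D := 4 * A * C - B ^+ 2; pose q := bqf A B C.
rewrite -/D in disc_gt0.
have C_gt0 : 0 < C by rewrite -(pmulr_rgt0 _ A_gt0); have := sqr_ge0 B; move: disc_gt0; rewrite /D => ? ?; lra.
pose bd := (4 * A * A + 4 * A * C) / D.
have bd_ge0 : 0 <= bd by rewrite divr_ge0 // ?ltW //; nra.
pose m := Num.Def.archi_bound bd.
have m_gt : bd < m%:R by apply: archi_boundP.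
have m_gt0 : (0 < m)%N by rewrite -(ltr0n R); apply: le_lt_trans m_gt.
have m_sq : m%:R <= m%:R ^+ 2 :> R by rewrite expr2 ler_peMl ?ler1n ?ler0n.
pose val (i : 'I_(2 * m).+1) : int := i%:Z - m%:Z.
have valP (x : int) : x%:~R ^+ 2 < m%:R ^+ 2 :> R -> exists i, val i = x.
  move=> hx; have {}hx : x ^+ 2 < m%:Z ^+ 2.
    by rewrite -(ltr_int R) !rmorphXn.
  have hx1 : - m%:Z <= x <= m%:Z by nia.
  have hlt : (absz (x + m%:Z)%R < (2 * m).+1)%N by lia.
  by exists (Ordinal hlt); rewrite /val /=; lia.
pose P (v : 'I_(2 * m).+1 * 'I_(2 * m).+1) := (val v.1 != 0) || (val v.2 != 0).
pose F (v : 'I_(2 * m).+1 * 'I_(2 * m).+1) := q (val v.1) (val v.2).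
have small (z t : int) : q z t <= A -> exists v, val v.1 = z /\ val v.2 = t.
  move=> hq.
  have hbD : bd * D = 4 * A * A + 4 * A * C by rewrite /bd divfK // gt_eqF.
  have dy : D * t%:~R ^+ 2 <= 4 * A * A.
    have -> : D * t%:~R ^+ 2 = 4 * A * q z t - (2 * A * z%:~R + B * t%:~R) ^+ 2.
      by rewrite /D /q /bqf; ring.
    by have := sqr_ge0 (2 * A * z%:~R + B * t%:~R); move=> ?; nra.
  have dx : D * z%:~R ^+ 2 <= 4 * A * C.
    have -> : D * z%:~R ^+ 2 = 4 * C * q z t - (2 * C * t%:~R + B * z%:~R) ^+ 2.
      by rewrite /D /q /bqf; ring.
    by have := sqr_ge0 (2 * C * t%:~R + B * z%:~R); move=> ?; nra.
  have Dpos : 0 < D by [].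
  have cut (w : R) : D * w <= bd * D -> w < m%:R ^+ 2.
    rewrite mulrC ler_pM2r // => hw.
    by apply: le_lt_trans hw (lt_le_trans m_gt m_sq).
  have [i iP] : exists i, val i = z by apply: valP; apply: cut; rewrite hbD; nra.
  have [j jP] : exists j, val j = t by apply: valP; apply: cut; rewrite hbD; nra.
  by exists (i, j).
have [v0 [v01 v02]] : exists v, val v.1 = 1 /\ val v.2 = 0.
  by apply: small; rewrite /q /bqf; lra.
have Pv0 : P v0 by rewrite /P v01.
case: (arg_minP F Pv0) => v Pv minv.
exists (val v.1), (val v.2); split=> // z t zt.
have qv0 : q (val v0.1) (val v0.2) = A by rewrite v01 v02 /q /bqf; ring.
case: (leP (q z t) A) => [/small [w [w1 w2]]|hlt].
  by rewrite -w1 -w2; apply: minv; rewrite /P w1 w2.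
by apply: le_trans (minv _ Pv0) _; rewrite /F qv0 ltW.
Qed.

(** A minimal vector is primitive, so it starts a basis; a second basis vector
    can be translated by multiples of the first until the middle coefficient b'
    is at most the minimum q in absolute value. As the value q' at the second
    vector is at least q, the discriminant 4 q q' - b'^2 is at least 3 q^2. *)
Theorem hermite (R : archiRealFieldType) (A B C : R) :
  0 < A -> 0 < 4 * A * C - B ^+ 2 ->
  exists x y : int, (x != 0) || (y != 0) /\
    3 * bqf A B C x y ^+ 2 <= 4 * A * C - B ^+ 2.
Proof.
move=> A_gt0 disc_gt0; have [x [y [xy0 minxy]]] := posdef_min A_gt0 disc_gt0.
set D := 4 * A * C - B ^+ 2 in disc_gt0 *.
set q := bqf A B C in minxy *; exists x, y; split=> //.
have q_gt0 : 0 < q x y.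
  have e : 4 * A * q x y = (2 * A * x%:~R + B * y%:~R) ^+ 2 + D * y%:~R ^+ 2.
    by rewrite /D /q /bqf; ring.
  have [y0|y0] := eqVneq y 0.
    move: xy0; rewrite y0 eqxx orbF => x0.
    rewrite /q /bqf mulr0 expr0n /= mulr0 !addr0 mulr_gt0 // exprn_even_gt0 //=.
    by rewrite intr_eq0.
  have : 0 < D * y%:~R ^+ 2 by rewrite mulr_gt0 // exprn_even_gt0 //= intr_eq0.
  by have := sqr_ge0 (2 * A * x%:~R + B * y%:~R); move=> ?; nra.
have [g gE] : exists g : nat, gcdz x y = g%:Z by eexists.
have g1 : gcdz x y = 1.
  have [x1 x1E] : exists x1, x = x1 * g%:Z.
    by have := dvdz_gcdl x y; rewrite gE => /dvdzP.
  have [y1 y1E] : exists y1, y = y1 * g%:Z.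
    by have := dvdz_gcdr x y; rewrite gE => /dvdzP.
  have xy1 : (x1 != 0) || (y1 != 0).
    by case/orP: xy0; rewrite ?x1E ?y1E mulf_eq0 negb_or => /andP[-> _]; rewrite ?orbT.
  have := minxy _ _ xy1.
  have -> : q x y = g%:R ^+ 2 * q x1 y1 by rewrite /q /bqf x1E y1E !rmorphM /=; ring.
  move=> le1; have g0 : g != 0%N.
    by apply/eqP => g0; move: q_gt0; rewrite /q /bqf x1E y1E g0 !mulr0 expr0n /= !mulr0 !addr0 ltxx.
  rewrite gE; congr Posz; apply/eqP; rewrite eqn_leq lt0n g0 andbT leqNgt; apply/negP => g2.
  have g2R : 2 <= g%:R :> R by rewrite ler_nat.
  have q1 : 0 < q x1 y1.
    move: q_gt0; rewrite {1}/q /bqf x1E y1E !rmorphM /=.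
    have -> : A * (x1%:~R * g%:R) ^+ 2 + B * (x1%:~R * g%:R) * (y1%:~R * g%:R) +
      C * (y1%:~R * g%:R) ^+ 2 = g%:R ^+ 2 * q x1 y1 by rewrite /q /bqf; ring.
    by rewrite pmulr_rgt0 // exprn_gt0 // ltr0n lt0n.
  have h4 : 4 * q x1 y1 <= g%:R ^+ 2 * q x1 y1 by rewrite ler_pM2r //; nra.
  by move: q1 le1 h4; rewrite -/(q x1 y1); move: (q x1 y1) (_ * _) => u w ? ? ?; lra.
have [u [v uv]] := Bezoutz x y; rewrite g1 in uv.
(* (x, y) and (- v, u) form a basis, b is the middle coefficient of the form in
   it, and k the translation that makes this coefficient small. *)
pose b : R := 2 * A * x%:~R * (- v)%:~R + B * (x%:~R * u%:~R + y%:~R * (- v)%:~R)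
              + 2 * C * y%:~R * u%:~R.
pose k : int := Num.floor ((q x y - b) / (2 * q x y)).
pose z := - v + k * x; pose t := u + k * y.
pose b' := b + 2 * k%:~R * q x y.
have b'le : - q x y <= b' <= q x y.
  have h1 := floor_le ((q x y - b) / (2 * q x y)).
  have h2 := floorD1_gt ((q x y - b) / (2 * q x y)).
  rewrite -/k in h1 h2; rewrite rmorphD /= in h2.
  rewrite ler_pdivlMr in h1; last lra.
  rewrite ltr_pdivrMr in h2; last lra.
  by rewrite /b'; apply/andP; split; nra.
have uvR : u%:~R * x%:~R + v%:~R * y%:~R = 1 :> R.
  by rewrite -!rmorphM -rmorphD /= uv.
have DE : D = 4 * q x y * q z t - b' ^+ 2.
  have -> : D = D * (u%:~R * x%:~R + v%:~R * y%:~R) ^+ 2 by rewrite uvR expr1n mulr1.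
  rewrite /b' /b /D /q /bqf /z /t !rmorphD !rmorphM !rmorphN /=; ring.
have zt0 : (z != 0) || (t != 0).
  rewrite -negb_and; apply/negP => /andP[/eqP z0 /eqP t0].
  have : x * t - y * z = 1 by rewrite /t /z -[RHS]uv; ring.
  by rewrite z0 t0 !mulr0 subr0.
have := minxy _ _ zt0; move: b'le => /andP[]; rewrite DE.
by move: (q x y) (q z t) b' q_gt0 {DE} => Q Q' c Q0 h1 h2 h3; nra.
Qed.

(** * Zeros of integral binary cubic forms *)

Definition cubic_form (R : comPzRingType) (a b c d x y : R) : R :=
  a * x ^+ 3 + b * x ^+ 2 * y + c * x * y ^+ 2 + d * y ^+ 3.

Definition cubic_disc (R : comPzRingType) (a b c d : R) : R :=
  b ^+ 2 * c ^+ 2 - 4 * a * c ^+ 3 - 4 * b ^+ 3 * d - 27 * a ^+ 2 * d ^+ 2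
  + 18 * a * b * c * d.

Lemma cube_root (R : rcfType) (k : R) : exists u, u ^+ 3 = k.
Proof.
have k0 := normr_ge0 k; have k1 := ler_norm k.
have k2 : - `|k| <= k by rewrite lerNl -normrN ler_norm.
have e (x : R) : ('X^3 - k%:P).[x] = x ^+ 3 - k by rewrite !hornerE.
have [||u _ /rootP] := @poly_ivt R ('X^3 - k%:P) (- (1 + `|k|)) (1 + `|k|).
- by lra.
- by rewrite !e; apply/andP; split; nra.
by rewrite e => /eqP; rewrite subr_eq0 => /eqP; exists u.
Qed.

Lemma cubeI (R : realDomainType) : injective (fun x : R => x ^+ 3).
Proof.
move=> x y /= h; apply/eqP; rewrite -subr_eq0.
have : (x - y) * (x ^+ 2 + x * y + y ^+ 2) == 0.
  by apply/eqP; rewrite (_ : _ * _ = x ^+ 3 - y ^+ 3); [rewrite h subrr|ring].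
rewrite mulf_eq0 => /orP[//|/eqP h2].
have h3 : (x - y) ^+ 2 = - (3 * (x + y) ^+ 2) + 4 * (x ^+ 2 + x * y + y ^+ 2) by ring.
by rewrite -sqrf_eq0 eq_le sqr_ge0 andbT h3 h2 mulr0 addr0 oppr_le0 mulr_ge0 ?sqr_ge0.
Qed.

Lemma sqr_int_ge1 (n : int) : n != 0 -> 1 <= n ^+ 2.
Proof. by move=> n0; nia. Qed.

(** The relation is the syzygy between a cubic form f, its Hessian h and its
    cubic covariant G. For f <> 0 it gives 27 D <= 4 h^3 with h <= sqrt D, hence
    729 <= 16 D, which fails for D <= 45. *)
Lemma syzygy_bound (D f G h : int) :
  0 < D -> D <= 45 -> f != 0 -> h ^+ 2 <= D ->
  G ^+ 2 + 27 * D * f ^+ 2 = 4 * h ^+ 3 -> False.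
Proof.
move=> D0 D45 /sqr_int_ge1 f1 hle; have := sqr_ge0 G.
rewrite -mulrA; move: (G ^+ 2) => G2 G0 syz.
have fD : D <= D * f ^+ 2 by rewrite ler_peMr // ltW.
have h3 : 27 * D <= 4 * h ^+ 3 by lia.
have h0 : 0 < h.
  rewrite ltNge; apply/negP => h0.
  have : h ^+ 3 <= 0 by rewrite exprS mulr_le0_ge0 ?sqr_ge0.
  by move: (h ^+ 3) h3 => h3' ? ?; lia.
have h7 : h <= 6.
  rewrite leNgt; apply/negP => h7; have : 7 * 7 <= h * h by rewrite ler_pM.
  by rewrite -(expr2 h); move: (h ^+ 2) hle => h2 ? ?; lia.
have : h ^+ 3 <= 6 * D by rewrite exprS ler_pM ?sqr_ge0 // ltW.
by move: (h ^+ 3) h3 => h3' ? ?; lia.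
Qed.

(** When D > 0, the Hessian P x^2 + Q x y + S y^2 is positive definite with
    4 P S - Q^2 = 3 D, so at some nonzero vector its value h satisfies h^2 <= D;
    the form vanishes there by the syzygy. *)
Lemma cubic_small_pos (a b c d : int) :
  0 < cubic_disc a b c d <= 45 ->
  exists x y : int, (x != 0) || (y != 0) /\ cubic_form a b c d x y = 0.
Proof.
move=> /andP[D0 D45].
pose R : archiRcfType := realalg.
set D := cubic_disc a b c d in D0 D45.
pose P : int := b ^+ 2 - 3 * a * c; pose Q : int := b * c - 9 * a * d.
pose S : int := c ^+ 2 - 3 * b * d.
have PS : 4 * P * S - Q ^+ 2 = 3 * D by rewrite /P /Q /S /D /cubic_disc; ring.
have P0 : 0 < P.
  have e : 4 * P * (P * S) = (2 * P * c - Q * b) ^+ 2 + 3 * D * b ^+ 2.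
    by rewrite -PS /P /Q /S; ring.
  have PS0 : 0 < P * S by have := sqr_ge0 Q; move=> ?; lia.
  have : 0 <= 4 * P * (P * S) by rewrite e addr_ge0 ?sqr_ge0 // mulr_ge0 ?sqr_ge0 //; lia.
  by rewrite pmulr_lge0 // => P0; have : P != 0 by [apply/eqP => P00; move: PS0; rewrite P00 mul0r ltxx]; lia.
have P0R : 0 < P%:~R :> R by rewrite ltr0z.
have hermR : 4 * P%:~R * S%:~R - Q%:~R ^+ 2 = (3 * D)%:~R :> R.
  by rewrite -PS !(rmorphB, rmorphM, rmorphXn) /=; ring.
have [|x [y [xy0]]] := hermite P0R (_ : 0 < 4 * P%:~R * S%:~R - Q%:~R ^+ 2).
  by rewrite hermR ltr0z; lia.
rewrite hermR => hle; exists x, y; split=> //.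
pose h : int := P * x ^+ 2 + Q * x * y + S * y ^+ 2.
have {hle} hle : h ^+ 2 <= D.
  have : 3 * h ^+ 2 <= 3 * D.
    rewrite -(ler_int R); apply: le_trans hle; rewrite /h /bqf.
    by rewrite !(rmorphD, rmorphM, rmorphXn) /= lexx.
  by rewrite ler_pM2l.
set f := cubic_form _ _ _ _ _ _; apply/eqP; apply/negP => /negP f0.
pose G := (2 * P * x + Q * y) * (b * x ^+ 2 + 2 * c * x * y + 3 * d * y ^+ 2)
  - (Q * x + 2 * S * y) * (3 * a * x ^+ 2 + 2 * b * x * y + c * y ^+ 2).
have syz : G ^+ 2 + 27 * D * f ^+ 2 = 4 * h ^+ 3.
  by rewrite /G /f /h /P /Q /S /D /cubic_disc /cubic_form; ring.
exact: (syzygy_bound D0 D45 f0 hle syz).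
Qed.

(** When D < 0, the form is over the reals a multiple of X^3 - Y^3 for two real
    linear forms X and Y, by Cardano's formulas; Hermite's bound is applied to
    X^2 + Y^2, and (X^3 - Y^3)^2 <= (X^2 + Y^2)^3. *)
Lemma cubic_neg_bound (R : archiRcfType) (a b c d : R) :
  a != 0 -> cubic_disc a b c d < 0 ->
  exists x y : int, (x != 0) || (y != 0) /\
    729 * cubic_form a b c d x%:~R y%:~R ^+ 4 <= - 64 * cubic_disc a b c d.
Proof.
move=> a0; set D := cubic_disc a b c d => D0.
pose P := b ^+ 2 - 3 * a * c.
pose U := 27 * a ^+ 2 * d - 9 * a * b * c + 2 * b ^+ 3.
have UP : U ^+ 2 - 4 * P ^+ 3 = - 27 * a ^+ 2 * D.
  by rewrite /U /P /D /cubic_disc; ring.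
have a2 : 0 < a ^+ 2 by rewrite exprn_even_gt0.
have w20 : 0 < - 27 * a ^+ 2 * D.
  have -> : - 27 * a ^+ 2 * D = 27 * a ^+ 2 * - D by ring.
  by rewrite mulr_gt0 ?oppr_gt0 // mulr_gt0.
pose w : R := Num.sqrt (- 27 * a ^+ 2 * D).
have w2 : w ^+ 2 = - 27 * a ^+ 2 * D by rewrite sqr_sqrtr // ltW.
have [u u3] := cube_root ((U + w) / 2); have [v v3] := cube_root ((U - w) / 2).
have uvU : u ^+ 3 + v ^+ 3 = U by rewrite u3 v3; field.
have uvw : u ^+ 3 - v ^+ 3 = w by rewrite u3 v3; field.
have uvP : u * v = P.
  apply: cubeI => /=; rewrite exprMn u3 v3.
  have -> : (U + w) / 2 * ((U - w) / 2) = (U ^+ 2 - w ^+ 2) / 4 by field.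
  by rewrite w2 -UP; field.
rewrite -w2 in w20.
(* With z = 3 a x + b y, the form is z^3 - 3 P z y^2 + U y^3 up to a factor, and
   X = u z - v^2 y, Y = v z - u^2 y. *)
pose X1 := 3 * a * u; pose X2 := b * u - v ^+ 2.
pose Y1 := 3 * a * v; pose Y2 := b * v - u ^+ 2.
pose A := X1 ^+ 2 + Y1 ^+ 2; pose B := 2 * (X1 * X2 + Y1 * Y2).
pose C := X2 ^+ 2 + Y2 ^+ 2.
have discE : 4 * A * C - B ^+ 2 = 36 * a ^+ 2 * w ^+ 2.
  by rewrite /A /B /C /X1 /X2 /Y1 /Y2 -uvw; ring.
have disc0 : 0 < 4 * A * C - B ^+ 2 by rewrite discE mulr_gt0 // mulr_gt0 // ltr0n.
have A0 : 0 < A.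
  rewrite lt_neqAle addr_ge0 ?sqr_ge0 // andbT eq_sym; apply/eqP => A0.
  by move: disc0; rewrite A0 mulr0 mul0r sub0r oppr_gt0 ltNge sqr_ge0.
have [x [y [xy0]]] := hermite A0 disc0; rewrite discE => hle.
exists x, y; split=> //.
set f := cubic_form _ _ _ _ _ _.
pose X := X1 * x%:~R + X2 * y%:~R; pose Y := Y1 * x%:~R + Y2 * y%:~R.
have QE : bqf A B C x y = X ^+ 2 + Y ^+ 2.
  by rewrite /bqf /A /B /C /X /Y; ring.
have key : w * (27 * a ^+ 2) * f = X ^+ 3 - Y ^+ 3.
  pose z := 3 * a * x%:~R + b * y%:~R : R.
  have -> : w * (27 * a ^+ 2) * f
     = w * (z ^+ 3 - 3 * P * z * y%:~R ^+ 2 + U * y%:~R ^+ 3).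
    by rewrite /U /P /f /cubic_form /z; ring.
  have -> : X = u * z - v ^+ 2 * y%:~R by rewrite /X /X1 /X2 /z; ring.
  have -> : Y = v * z - u ^+ 2 * y%:~R by rewrite /Y /Y1 /Y2 /z; ring.
  by rewrite -uvw -uvU -uvP; ring.
set q := bqf A B C x y in hle QE.
have q0 : 0 <= q by rewrite QE addr_ge0 ?sqr_ge0.
have qf : (w * (27 * a ^+ 2) * f) ^+ 2 <= q ^+ 3.
  rewrite key QE -subr_ge0.
  have -> : (X ^+ 2 + Y ^+ 2) ^+ 3 - (X ^+ 3 - Y ^+ 3) ^+ 2
    = X ^+ 2 * Y ^+ 2 * (2 * X ^+ 2 + 2 * Y ^+ 2 + (X + Y) ^+ 2) by ring.
  have := sqr_ge0 X; have := sqr_ge0 Y; have := sqr_ge0 (X + Y).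
  move: (X ^+ 2) (Y ^+ 2) ((X + Y) ^+ 2) => r s t t0 s0 r0.
  by apply: mulr_ge0; [apply: mulr_ge0 | clear -r0 s0 t0; lra].
have q2 : q ^+ 2 <= 12 * a ^+ 2 * w ^+ 2 by clear -hle; lra.
have aw : 0 <= 12 * a ^+ 2 * w ^+ 2 by rewrite -mulrA; apply: mulr_ge0 => //; apply: mulr_ge0; apply: sqr_ge0.
have q6 : ((w * (27 * a ^+ 2) * f) ^+ 2) ^+ 2 <= (12 * a ^+ 2 * w ^+ 2) ^+ 3.
  apply: (@le_trans _ _ ((q ^+ 3) ^+ 2)).
    by apply: lerXn2r qf; rewrite nnegrE ?sqr_ge0 // exprn_ge0.
  have -> : (q ^+ 3) ^+ 2 = (q ^+ 2) ^+ 3 by rewrite -!exprM.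
  by apply: lerXn2r q2; rewrite nnegrE // sqr_ge0.
have pos : 0 < 729 * (a ^+ 2) ^+ 4 * (w ^+ 2) ^+ 2.
  by apply: mulr_gt0; [apply: mulr_gt0 => //|]; apply: exprn_gt0.
rewrite -(ler_pM2l pos) -subr_ge0.
rewrite -subr_ge0 in q6; apply: le_trans q6 _; rewrite le_eqVlt; apply/orP; left.
apply/eqP.
have -> : (12 * a ^+ 2 * w ^+ 2) ^+ 3
  = (12 * a ^+ 2) ^+ 3 * (w ^+ 2) ^+ 2 * (- 27 * a ^+ 2 * D) by rewrite -w2; ring.
by ring.
Qed.

Lemma cubic_small_neg (a b c d : int) :
  -11 <= cubic_disc a b c d < 0 ->
  exists x y : int, (x != 0) || (y != 0) /\ cubic_form a b c d x y = 0.
Proof.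
move=> /andP[D11 D0].
have [->|a0] := eqVneq a 0.
  by exists 1, 0; split=> //; rewrite /cubic_form; ring.
have discR : (cubic_disc a b c d)%:~R
    = cubic_disc a%:~R b%:~R c%:~R d%:~R :> realalg.
  by rewrite /cubic_disc; ring.
have [||x [y [xy0]]] := @cubic_neg_bound realalg a%:~R b%:~R c%:~R d%:~R.
- by rewrite intr_eq0.
- by rewrite -discR ltrz0.
have -> : cubic_form (a%:~R : realalg) b%:~R c%:~R d%:~R x%:~R y%:~R
    = (cubic_form a b c d x y)%:~R.
  by rewrite /cubic_form; ring.
rewrite -discR -rmorphXn -[729]/(729%:~R) -[64]/(64%:~R) -rmorphN -!rmorphM ler_int.
move=> hle; exists x, y; split=> //; apply/eqP/negP => /negP /sqr_int_ge1.
move: hle D11; clear; move: (cubic_form _ _ _ _ _ _) (cubic_disc _ _ _ _) => f D.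
by rewrite (exprM f 2 2); move: (f ^+ 2) => f2 h1 h2 h3; nia.
Qed.

Lemma cubic_small (a b c d : int) :
  cubic_disc a b c d != 0 -> `|cubic_disc a b c d| <= 11 ->
  exists x y : int, (x != 0) || (y != 0) /\ cubic_form a b c d x y = 0.
Proof.
move=> D0 D11; have [D1|D1] := ltP 0 (cubic_disc a b c d).
  by apply: cubic_small_pos; lia.
by apply: cubic_small_neg; lia.
Qed.

(** * Equianharmonic binary quartic forms: real reduction *)

Definition quartic_form (R : comPzRingType) (a b c d e x y : R) : R :=
  a * x ^+ 4 + b * x ^+ 3 * y + 3 * c * x ^+ 2 * y ^+ 2 + d * x * y ^+ 3
  + e * y ^+ 4.

(** The vanishing of the invariant I, that is 12 a e - 3 b d + (3 c)^2 = 0: the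
    cross-ratio of the zeros is a primitive sixth root of unity. *)
Definition equianharmonic (R : comPzRingType) (a b c d e : R) : Prop :=
  4 * a * e = b * d - 3 * c ^+ 2.

(** When I = 0, this is the invariant J divided by 27. *)
Definition quartic_inv (R : comPzRingType) (a b c d e : R) : R :=
  3 * b * c * d - 8 * c ^+ 3 - a * d ^+ 2 - e * b ^+ 2.

(** The value at 0 is - 3 S^2 <= 0, and the polynomial is positive far away. *)
Lemma quartic_real_root (R : rcfType) (S T : R) :
  exists z, z ^+ 4 - 6 * S * z ^+ 2 + 8 * T * z - 3 * S ^+ 2 = 0.
Proof.
pose p : {poly R} := 'X^4 - (6 * S) *: 'X^2 + (8 * T) *: 'X - (3 * S ^+ 2)%:P.
have pE z : p.[z] = z ^+ 4 - 6 * S * z ^+ 2 + 8 * T * z - 3 * S ^+ 2.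
  by rewrite /p !hornerE.
pose K := 1 + 6 * `|S| + 8 * `|T| + 3 * S ^+ 2.
have S0 := normr_ge0 S; have T0 := normr_ge0 T; have S2 := sqr_ge0 S.
have K1 : 1 <= K by rewrite /K; lra.
have [||z _ /rootP hz] := @poly_ivt R p 0 K; [by lra| |by exists z; rewrite -pE].
rewrite !pE; apply/andP; split; first by nra.
have K2 : 1 <= K ^+ 2 by rewrite expr2; nra.
have K23 : K ^+ 2 <= K ^+ 3 by rewrite [leRHS]exprS; nra.
have K12 : K <= K ^+ 2 by rewrite expr2; nra.
have h1 : 6 * S * K ^+ 2 <= 6 * `|S| * K ^+ 3.
  apply: (@le_trans _ _ (6 * `|S| * K ^+ 2)).
    by apply: ler_wpM2r; have := ler_norm S; move=> ?; lra.
  by rewrite ler_wpM2l // mulr_ge0.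
have h2 : - (8 * T * K) <= 8 * `|T| * K ^+ 3.
  apply: (@le_trans _ _ (8 * `|T| * K)).
    have : - T <= `|T| by rewrite -normrN ler_norm.
    by move=> ?; nra.
  by rewrite ler_wpM2l ?mulr_ge0 //; lra.
have h3 : 3 * S ^+ 2 <= 3 * S ^+ 2 * K ^+ 3.
  by apply: ler_peMr; [apply: mulr_ge0 | lra].
have -> : K ^+ 4 = K ^+ 3 + 6 * `|S| * K ^+ 3 + 8 * `|T| * K ^+ 3 + 3 * S ^+ 2 * K ^+ 3.
  by rewrite exprS {1}/K; ring.
by lra.
Qed.

(** An equianharmonic quartic form has a real linear factor X, and the
    projective map of order 3 fixing its zero permutes the three others, so the
    form is a multiple of X (X^3 + Z^3) for real linear forms X and Z. Hermite's
    bound is applied to 2 X^2 + Z^2, and |X (X^3 + Z^3)| <= (2 X^2 + Z^2)^2 / 4. *)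
Lemma quartic_bound (R : archiRcfType) (a b c d e : R) :
  a != 0 -> equianharmonic a b c d e -> quartic_inv a b c d e != 0 ->
  exists x y : int, (x != 0) || (y != 0) /\
    27 * `|quartic_form a b c d e x%:~R y%:~R| ^+ 3
    <= 8 * `|quartic_inv a b c d e|.
Proof.
move=> a0 rel; set j := quartic_inv a b c d e => j0.
pose S := b ^+ 2 - 8 * a * c; pose T := b ^+ 3 - 12 * a * b * c + 8 * a ^+ 2 * d.
have aj0 : a ^+ 3 * j != 0 by rewrite mulf_neq0 // expf_neq0.
(* In terms of z = 4 a x + b y, the form 256 a^3 f is
   z^4 - 6 S z^2 y^2 + 8 T z y^3 - 3 S^2 y^4; c0 and k are the coefficients of
   X^2 y^2 and X y^3 of its expansion at the root z = X + r y. *)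
have [r] := quartic_real_root S T; set phi := (X in X = 0) => r0.
pose c0 := 6 * r ^+ 2 - 6 * S; pose k := 4 * r ^+ 3 - 12 * S * r + 8 * T.
have c0k : c0 ^+ 2 = 12 * r * k.
  have -> : c0 ^+ 2 = 12 * r * k - 12 * phi by rewrite /c0 /k /phi; ring.
  by rewrite r0 mulr0 subr0.
have STj : S ^+ 3 - T ^+ 2 = 64 * a ^+ 3 * j.
  have -> : 64 * a ^+ 3 * j = 64 * a ^+ 3 * (3 * b * c * d - 8 * c ^+ 3 - a * d ^+ 2)
    - 16 * a ^+ 2 * (4 * a * e) * b ^+ 2 by rewrite /j /quartic_inv; ring.
  by rewrite rel /S /T; ring.
have kj : 27 * k ^+ 2 - c0 ^+ 3 = - (27 * 4096) * a ^+ 3 * j.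
  have -> : 27 * k ^+ 2 - c0 ^+ 3
    = - 1728 * (S ^+ 3 - T ^+ 2) + 216 * (r ^+ 2 - 3 * S) * phi.
    by rewrite /c0 /k /phi; ring.
  by rewrite r0 STj; ring.
have k0 : k != 0.
  apply/eqP => k0; move/eqP: c0k; rewrite k0 mulr0 sqrf_eq0 => /eqP c00.
  move: kj; rewrite k0 c00 !expr0n /= mulr0 subr0 => kj.
  have : a ^+ 3 * j = 0 by move: kj; rewrite -mulrA; clear; move: (_ * j) => u h; lra.
  by move/eqP; apply/negP.
pose rho := 1 - c0 ^+ 3 / (27 * k ^+ 2).
have rhok : rho * k ^+ 2 = - 4096 * a ^+ 3 * j.
  have : 27 * (rho * k ^+ 2) = 27 * (- 4096 * a ^+ 3 * j).
    have -> : 27 * (rho * k ^+ 2) = 27 * k ^+ 2 - c0 ^+ 3 by rewrite /rho; field.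
    by rewrite kj; ring.
  by apply: mulfI; rewrite pnatr_eq0.
have rho0 : rho != 0.
  apply/eqP => rho0; move: rhok; rewrite rho0 mul0r -mulrA => rhok.
  have : a ^+ 3 * j = 0 by move: rhok; clear; move: (_ * j) => u h; lra.
  by move/eqP; apply/negP.
have [t t3] := cube_root (k / rho).
have t0 : t != 0.
  by apply/eqP => t0; move/eqP: t3; rewrite t0 expr0n /= eq_sym mulf_eq0 invr_eq0 (negPf k0) (negPf rho0).
pose m := c0 / (3 * k).
pose X1 := 4 * a; pose X2 := b - r.
pose Y1 := m * X1; pose Y2 := 1 + m * X2.
pose A := 2 * X1 ^+ 2 + t ^+ 2 * Y1 ^+ 2.
pose B := 2 * (2 * X1 * X2 + t ^+ 2 * Y1 * Y2).
pose C := 2 * X2 ^+ 2 + t ^+ 2 * Y2 ^+ 2.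
have discE : 4 * A * C - B ^+ 2 = 128 * (a ^+ 2 * t ^+ 2).
  by rewrite /A /B /C /Y1 /Y2 /X1; ring.
have a2 : 0 < a ^+ 2 by rewrite exprn_even_gt0.
have t2 : 0 < t ^+ 2 by rewrite exprn_even_gt0.
have disc0 : 0 < 4 * A * C - B ^+ 2 by rewrite discE mulr_gt0 // mulr_gt0.
have A0 : 0 < A.
  rewrite /A ltr_pwDl //; first by rewrite mulr_gt0 // exprn_even_gt0 // mulf_neq0 // pnatr_eq0.
  by apply: mulr_ge0; apply: sqr_ge0.
have [x [y [xy0]]] := hermite A0 disc0; rewrite discE => hle.
exists x, y; split=> //.
set f := quartic_form _ _ _ _ _ _ _.
pose X := X1 * x%:~R + X2 * y%:~R; pose Y := Y1 * x%:~R + Y2 * y%:~R.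
pose Z := t * Y.
have QE : bqf A B C x y = 2 * X ^+ 2 + Z ^+ 2.
  by rewrite /bqf /A /B /C /Z /X /Y; ring.
have key : 256 * a ^+ 3 * f = rho * (X * (X ^+ 3 + Z ^+ 3)).
  pose z := 4 * a * x%:~R + b * y%:~R : R.
  have -> : 256 * a ^+ 3 * f
    = z ^+ 4 - 6 * S * z ^+ 2 * y%:~R ^+ 2 + 8 * T * z * y%:~R ^+ 3
      - 3 * S ^+ 2 * y%:~R ^+ 4.
    rewrite /f /quartic_form.
    rewrite (_ : e = (b * d - 3 * c ^+ 2) / (4 * a)); last first.
      by rewrite -rel mulrC mulKf // mulf_neq0 // pnatr_eq0.
    by rewrite /z /S /T; field.
  have YE : Y = y%:~R + m * X by rewrite /Y /Y1 /Y2 /X; ring.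
  have -> : rho * (X * (X ^+ 3 + Z ^+ 3)) = rho * X ^+ 4 + k * X * Y ^+ 3.
    by rewrite /Z exprMn t3; field.
  have zE : z = X + r * y%:~R by rewrite /z /X /X1 /X2; ring.
  have -> : rho * X ^+ 4 + k * X * Y ^+ 3
     = X ^+ 4 + c0 ^+ 2 / (3 * k) * X ^+ 3 * y%:~R + c0 * X ^+ 2 * y%:~R ^+ 2
       + k * X * y%:~R ^+ 3.
    by rewrite YE /m /rho; field.
  rewrite c0k (_ : 12 * r * k / (3 * k) = 4 * r); last by field.
  rewrite zE; apply: (addIr (y%:~R ^+ 4 * phi)); rewrite {1}r0 mulr0 addr0.
  by rewrite /phi /c0 /k; ring.
set q := bqf A B C x y in hle QE.
have qf : `|256 * a ^+ 3 * f| <= `|rho| * (q ^+ 2 / 4).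
  rewrite key normrM ler_wpM2l //.
  have -> : q ^+ 2 / 4 = X ^+ 4 + X ^+ 2 * Z ^+ 2 + Z ^+ 4 / 4 by rewrite QE; field.
  rewrite ler_norml; apply/andP; split; rewrite -subr_ge0.
    have -> : X * (X ^+ 3 + Z ^+ 3) - - (X ^+ 4 + X ^+ 2 * Z ^+ 2 + Z ^+ 4 / 4)
       = 2 * (X ^+ 2) ^+ 2 + (Z * (2 * X + Z)) ^+ 2 / 4 by field.
    have := sqr_ge0 (X ^+ 2); have := sqr_ge0 (Z * (2 * X + Z)).
    by move: (_ ^+ 2) (_ ^+ 2); clear => u v ? ?; lra.
  have -> : X ^+ 4 + X ^+ 2 * Z ^+ 2 + Z ^+ 4 / 4 - X * (X ^+ 3 + Z ^+ 3)
     = (Z * (2 * X - Z)) ^+ 2 / 4 by field.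
  have := sqr_ge0 (Z * (2 * X - Z)).
  by move: (_ ^+ 2); clear => u ?; lra.
have q2 : q ^+ 2 / 4 <= 32 * (a ^+ 2 * t ^+ 2) / 3.
  by move: hle; clear; move: (q ^+ 2) (_ * t ^+ 2) => u v h; lra.
have {}qf : `|256 * a ^+ 3 * f| <= `|rho| * (32 * (a ^+ 2 * t ^+ 2) / 3).
  by apply: le_trans qf _; rewrite ler_wpM2l.
have {}qf : `|256 * a ^+ 3 * f| ^+ 3 <= (`|rho| * (32 * (a ^+ 2 * t ^+ 2) / 3)) ^+ 3.
  by apply: lerXn2r qf; rewrite nnegrE // mulr_ge0 // divr_ge0 // mulr_ge0 // mulr_ge0 // ltW.
pose a' := `|a|; have a'2 : a ^+ 2 = a' ^+ 2 by rewrite /a' real_normK // num_real.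
have a'0 : 0 < a' by rewrite normr_gt0.
have t6 : `|rho| ^+ 3 * t ^+ 6 = 4096 * a' ^+ 3 * `|j|.
  have -> : t ^+ 6 = (k / rho) ^+ 2 by rewrite -t3 -exprM.
  have -> : (k / rho) ^+ 2 = `|k / rho| ^+ 2 by rewrite real_normK // num_real.
  rewrite normf_div.
  have -> : `|rho| ^+ 3 * (`|k| / `|rho|) ^+ 2 = `|rho * k ^+ 2|.
    by rewrite (normrM rho) (normrX 2 k); field; rewrite normr_eq0.
  rewrite rhok (_ : - 4096 * a ^+ 3 * j = - (4096 * (a ^+ 3 * j))); last by ring.
  by rewrite normrN (normrM 4096) (normrM (a ^+ 3)) (normrX 3 a) normr_nat mulrA.
have lhsE : `|256 * a ^+ 3 * f| ^+ 3 = (256 * a' ^+ 3) ^+ 3 * `|f| ^+ 3.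
  by rewrite (normrM _ f) (normrM 256) (normrX 3 a) normr_nat [LHS]exprMn.
have rhsE : (`|rho| * (32 * (a ^+ 2 * t ^+ 2) / 3)) ^+ 3
    = 32 ^+ 3 / 27 * a' ^+ 6 * (4096 * a' ^+ 3 * `|j|).
  by rewrite -t6 a'2; field.
have a9 : 0 < a' ^+ 9 by rewrite exprn_gt0.
have : (256 ^+ 3 * a' ^+ 9) * (27 * `|f| ^+ 3) <= (256 ^+ 3 * a' ^+ 9) * (8 * `|j|).
  have -> : 256 ^+ 3 * a' ^+ 9 * (27 * `|f| ^+ 3) = 27 * `|256 * a ^+ 3 * f| ^+ 3.
    by rewrite lhsE; ring.
  have -> : 256 ^+ 3 * a' ^+ 9 * (8 * `|j|)
     = 27 * (`|rho| * (32 * (a ^+ 2 * t ^+ 2) / 3)) ^+ 3.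
    by rewrite rhsE; field.
  by rewrite ler_wpM2l.
by rewrite ler_pM2l // mulr_gt0 // exprn_gt0 // ltr0n.
Qed.

Lemma quartic_small (a b c d e : int) :
  equianharmonic a b c d e -> quartic_inv a b c d e != 0 ->
  `|quartic_inv a b c d e| <= 3 ->
  exists x y : int, (x != 0) || (y != 0) /\ quartic_form a b c d e x y = 0.
Proof.
move=> rel j0 j3.
have [->|a0] := eqVneq a 0.
  by exists 1, 0; split=> //; rewrite /quartic_form; ring.
have invR : (quartic_inv a b c d e)%:~R
    = quartic_inv a%:~R b%:~R c%:~R d%:~R e%:~R :> realalg.
  by rewrite /quartic_inv; ring.
have [|||x [y [xy0]]] := @quartic_bound realalg a%:~R b%:~R c%:~R d%:~R e%:~R.
- by rewrite intr_eq0.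
- have := congr1 (fun n : int => n%:~R : realalg) rel.
  by rewrite /equianharmonic !(rmorphB, rmorphM) /= => ->; ring.
- by rewrite -invR intr_eq0.
have -> : quartic_form (a%:~R : realalg) b%:~R c%:~R d%:~R e%:~R x%:~R y%:~R
    = (quartic_form a b c d e x y)%:~R.
  by rewrite /quartic_form; ring.
rewrite -invR -!intr_norm -rmorphXn -[27]/(27%:~R) -[8]/(8%:~R) -!rmorphM ler_int.
move=> hle; exists x, y; split=> //; apply/eqP/negP => /negP; rewrite -normr_gt0.
move: hle j3; clear; move: `|quartic_form _ _ _ _ _ _ _| `|quartic_inv _ _ _ _ _|.
move=> f j h1 h2 h3; have : 1 <= f ^+ 3 by rewrite exprn_ege1.
by move: (f ^+ 3) h1 => f3 h1; lia.
Qed.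

(** * Descent for forms with prime power invariants *)

Definition cubic_zero (a b c d : int) : Prop :=
  exists x y : int, (x != 0) || (y != 0) /\ cubic_form a b c d x y = 0.

Definition quartic_zero (a b c d e : int) : Prop :=
  exists x y : int, (x != 0) || (y != 0) /\ quartic_form a b c d e x y = 0.

Lemma int_mod2 (n : int) : exists m, n = 2 * m \/ n = 2 * m + 1.
Proof. exists (n %/ 2)%Z; lia. Qed.

Lemma int_mod3 (n : int) : exists m, [\/ n = 3 * m, n = 3 * m + 1 | n = 3 * m - 1].
Proof.
have [m [h|[h|h]]] : exists m, n = 3 * m \/ n = 3 * m + 1 \/ n = 3 * m - 1.
  by exists ((n + 1) %/ 3)%Z; lia.
- by exists m; constructor 1.
- by exists m; constructor 2.
- by exists m; constructor 3.
Qed.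

Lemma cubic_zero_swap (a b c d : int) : cubic_zero d c b a -> cubic_zero a b c d.
Proof.
case=> x [y [xy h]]; exists y, x; rewrite orbC; split=> //.
by rewrite -h /cubic_form; ring.
Qed.

Lemma cubic_disc_swap (a b c d : int) : cubic_disc d c b a = cubic_disc a b c d.
Proof. by rewrite /cubic_disc; ring. Qed.

Lemma cubic_zero_shift (a b c d : int) :
  cubic_zero a (3 * a + b) (3 * a + 2 * b + c) (a + b + c + d) ->
  cubic_zero a b c d.
Proof.
case=> x [y [xy h]]; exists (x + y), y; split.
  by move: xy; clear; lia.
by rewrite -h /cubic_form; ring.
Qed.

(** The form has the factor y^2 modulo 2. When 16 divides the discriminant,
    either substituting 2 y for y makes the form divisible by 4, or the form is
    divisible by 2. *)
Lemma cubic_double_root (a b c d q : int) :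
  cubic_disc (2 * a) (2 * b) c d = 16 * q ->
  (exists a', a = 2 * a') \/ (exists c' d', c = 2 * c' /\ d = 2 * d').
Proof.
have [a' [->|aE]] := int_mod2 a; first by left; exists a'.
rewrite /cubic_disc => h; right.
have [c' [cE|cE]] := int_mod2 c; have [d' [dE|dE]] := int_mod2 d;
  have [b' [bE|bE]] := int_mod2 b; subst a b c d.
all: try by exists c', d'.
all: exfalso; lia.
Qed.

(** For k <= 3 the discriminant is small. Otherwise the form has a double zero
    modulo 2, which a swap or a shift moves to a coordinate point, and the form
    can be shrunk so that k drops by 2 or 4. *)
Lemma cubic_pow2_zero (k : nat) (a b c d : int) :
  absz (cubic_disc a b c d) = (2 ^ k)%N -> cubic_zero a b c d.
Proof.
elim/ltn_ind: k a b c d => k IH a b c d.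
have [k3|k4] := leqP k 3.
  move=> h; apply: cubic_small; rewrite -?absz_eq0 ?h ?expn_eq0 //.
  by rewrite -abszE h; case: k {IH h} k3 => [|[|[|[|]]]].
have kE : k = (k - 4 + 4)%N by rewrite subnK.
have step a' b' c' d' : absz (cubic_disc (2 * a') (2 * b') c' d') = (2 ^ k)%N ->
    cubic_zero (2 * a') (2 * b') c' d'.
  move=> h; have [q qE] : exists q, cubic_disc (2 * a') (2 * b') c' d' = 16 * q.
    have := h; rewrite kE expnD => h'.
    have : (16 %| cubic_disc (2 * a') (2 * b') c' d')%Z.
      by rewrite dvdzE h'; apply: dvdn_mull.
    by move=> /dvdzP[q qE]; exists q; rewrite qE mulrC.
  have [[a'' aE]|[c'' [d'' [cE dE]]]] := cubic_double_root qE.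
    have [||x [y [xy0 xyE]]] := IH (k - 2)%N _ a'' b' c' (2 * d').
    - by clear -k4; lia.
    - apply/eqP; rewrite -(@eqn_pmul2l 4) // (_ : 4 = 2 ^ 2)%N // -expnD subnKC; last first.
        by apply: leq_trans k4.
      by rewrite -h -[(2 ^ 2)%N]/(absz 4) -abszM aE /cubic_disc; apply/eqP; congr absz; ring.
    exists x, (2 * y); split; first by rewrite mulf_eq0.
    by rewrite -[RHS](mulr0 4) -xyE aE /cubic_form; ring.
  have [||x [y [xy0 xyE]]] := IH (k - 4)%N _ a' b' c'' d''.
  - by clear -k4; lia.
  - apply/eqP; rewrite -(@eqn_pmul2l 16) // (_ : 16 = 2 ^ 4)%N // -expnD subnKC //.
    by rewrite -h -[(2 ^ 4)%N]/(absz 16) -abszM cE dE /cubic_disc; apply/eqP; congr absz; ring.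
  exists x, y; split => //.
  by rewrite -[RHS](mulr0 2) -xyE cE dE /cubic_form; ring.
have step' a' b' c' d' : absz (cubic_disc a' b' (2 * c') (2 * d')) = (2 ^ k)%N ->
    cubic_zero a' b' (2 * c') (2 * d').
  by rewrite -cubic_disc_swap => /step /cubic_zero_swap.
move=> h; have {h} [h [q hq]] : absz (cubic_disc a b c d) = (2 ^ k)%N /\
    exists q, cubic_disc a b c d = 2 * q.
  split=> //; have : (2 %| cubic_disc a b c d)%Z by rewrite dvdzE h dvdn_exp //; apply: leq_trans k4.
  by move=> /dvdzP[q qE]; exists q; rewrite qE mulrC.
have shift c' d' : 3 * a + 2 * b + c = 2 * c' -> a + b + c + d = 2 * d' -> cubic_zero a b c d.
  move=> h1 h2; apply: cubic_zero_shift; rewrite h1 h2; apply: step'.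
  by rewrite -h -h1 -h2 /cubic_disc; congr absz; ring.
have [p pE] : exists p, b * c - a * d = 2 * p.
  have [p [|pE]] := int_mod2 (b * c - a * d); first by exists p.
  have discE : cubic_disc a b c d = (b * c - a * d) ^+ 2
    + 2 * (- 14 * a ^+ 2 * d ^+ 2 + 10 * a * b * c * d - 2 * a * c ^+ 3 - 2 * b ^+ 3 * d).
    by rewrite /cubic_disc; ring.
  by move: hq; rewrite discE pE; clear; move: (X in _ + 2 * X) => m; lia.
have [a' [aE|aE]] := int_mod2 a; have [b' [bE|bE]] := int_mod2 b;
have [c' [cE|cE]] := int_mod2 c; have [d' [dE|dE]] := int_mod2 d.
all: try by rewrite aE bE; apply: step; rewrite -h aE bE.
all: try by rewrite cE dE; apply: step'; rewrite -h cE dE.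
all: try by exfalso; move: pE; rewrite aE bE cE dE; clear; lia.
all: apply: (shift ((3 * a + 2 * b + c) %/ 2)%Z ((a + b + c + d) %/ 2)%Z); rewrite ?aE ?bE ?cE ?dE; clear; lia.
Qed.

Lemma quartic_zero_swap (a b c d e : int) :
  quartic_zero e d c b a -> quartic_zero a b c d e.
Proof.
case=> x [y [xy h]]; exists y, x; rewrite orbC; split=> //.
by rewrite -h /quartic_form; ring.
Qed.

Lemma quartic_zero_shift (t a b c d e : int) :
  quartic_zero a (b + 4 * t * a) (c + t * b + 2 * t ^+ 2 * a)
    (d + 6 * t * c + 3 * t ^+ 2 * b + 4 * t ^+ 3 * a)
    (e + t * d + 3 * t ^+ 2 * c + t ^+ 3 * b + t ^+ 4 * a) ->
  quartic_zero a b c d e.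
Proof.
case=> x [y [xy h]]; exists (x + t * y), y; split.
  have [y0|] := eqVneq y 0; last by rewrite orbT.
  by move: xy; rewrite y0 eqxx orbF mulr0 addr0 orbF.
by rewrite -h /quartic_form; ring.
Qed.

Lemma equianharmonic_swap (a b c d e : int) :
  equianharmonic a b c d e -> equianharmonic e d c b a.
Proof. by rewrite /equianharmonic mulrAC => ->; ring. Qed.

Lemma quartic_inv_swap (a b c d e : int) :
  quartic_inv e d c b a = quartic_inv a b c d e.
Proof. by rewrite /quartic_inv; ring. Qed.

Lemma equianharmonic_shift (t a b c d e : int) :
  equianharmonic a b c d e ->
  equianharmonic a (b + 4 * t * a) (c + t * b + 2 * t ^+ 2 * a)
    (d + 6 * t * c + 3 * t ^+ 2 * b + 4 * t ^+ 3 * a)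
    (e + t * d + 3 * t ^+ 2 * c + t ^+ 3 * b + t ^+ 4 * a).
Proof.
rewrite /equianharmonic => h.
rewrite [4 * a * (_ + _)]mulrDr mulrDr mulrDr mulrDr h; ring.
Qed.

Lemma quartic_inv_shift (t a b c d e : int) :
  equianharmonic a b c d e ->
  quartic_inv a (b + 4 * t * a) (c + t * b + 2 * t ^+ 2 * a)
    (d + 6 * t * c + 3 * t ^+ 2 * b + 4 * t ^+ 3 * a)
    (e + t * d + 3 * t ^+ 2 * c + t ^+ 3 * b + t ^+ 4 * a)
  = quartic_inv a b c d e.
Proof.
rewrite /equianharmonic => h.
have -> : quartic_inv a (b + 4 * t * a) (c + t * b + 2 * t ^+ 2 * a)
    (d + 6 * t * c + 3 * t ^+ 2 * b + 4 * t ^+ 3 * a)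
    (e + t * d + 3 * t ^+ 2 * c + t ^+ 3 * b + t ^+ 4 * a)
  = quartic_inv a b c d e + (- 2 * t * b - 4 * t ^+ 2 * a)
      * (4 * a * e - (b * d - 3 * c ^+ 2)).
  by rewrite /quartic_inv; ring.
by rewrite h subrr mulr0 addr0.
Qed.

(** At a triple zero of the form modulo 3, a factor 27 of the invariant can be
    removed, either because the form is divisible by 3 or by substituting 3 y
    for y and dividing by 27. *)
Lemma quartic_triple_root (a b c d e q : int) :
  equianharmonic (3 * a) (3 * b) c d e ->
  quartic_inv (3 * a) (3 * b) c d e = 27 * q ->
  exists c', c = 3 * c' /\
  ((exists d' e', d = 3 * d' /\ e = 3 * e') \/
   (exists a' b', a = 9 * a' /\ b = 3 * b')).
Proof.
rewrite /equianharmonic /quartic_inv => rel h.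
have [c' cE] : exists c', c = 3 * c'.
  have [c' [cE|cE|cE]] := int_mod3 c; first by exists c'.
    by exfalso; subst c; clear rel; lia.
  by exfalso; subst c; clear rel; lia.
exists c'; split=> //; subst c.
have {}rel : 4 * a * e = b * d - 9 * c' ^+ 2 by lia.
have {}h : a * d ^+ 2 + 3 * e * b ^+ 2 = 9 * (b * c' * d - 8 * c' ^+ 3 - q) by lia.
move: (b * c' * d - 8 * c' ^+ 3 - q) h => {}q h.
have [d' dE] := int_mod3 d; have [a' aE] := int_mod3 a.
have [b' bE] := int_mod3 b; have [e' eE] := int_mod3 e.
have [[d'E e'E]|de] : (d = 3 * d' /\ e = 3 * e') \/ ~ (d = 3 * d' /\ e = 3 * e').
  by lia.
  by left; exists d', e'.
right.
have a3 : a = 3 * a'.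
  case: aE dE => [//||] aE [] dE; exfalso; move: rel h de; rewrite aE dE.
  - by case: eE => eE; rewrite eE; clear; lia.
  - by clear; lia.
  - by clear; lia.
  - by case: eE => eE; rewrite eE; clear; lia.
  - by clear; lia.
  - by clear; lia.
have b3 : b = 3 * b'.
  case: bE dE => [//||] bE [] dE; exfalso; move: rel h de; rewrite a3 bE dE.
  - by case: eE => eE; rewrite eE; clear; lia.
  - by clear; lia.
  - by clear; lia.
  - by case: eE => eE; rewrite eE; clear; lia.
  - by clear; lia.
  - by clear; lia.
have [a'' a'E] := int_mod3 a'.
have a9 : a' = 3 * a''.
  case: a'E dE => [//||] a'E [] dE; exfalso; move: rel h de; rewrite a3 b3 a'E dE.
  - by case: eE => eE; rewrite eE; clear; lia.
  - by clear; lia.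
  - by clear; lia.
  - by case: eE => eE; rewrite eE; clear; lia.
  - by clear; lia.
  - by clear; lia.
by exists a'', b'; rewrite a3 a9 b3; split=> //; ring.
Qed.

Lemma mul_zr_inj (n x y : int) : n != 0 -> n * x = n * y -> x = y.
Proof. by move=> n0 /(mulfI n0). Qed.

Definition descends_to (q a b c d e : int) : Prop :=
  exists a' b' c' d' e', [/\ equianharmonic a' b' c' d' e',
    quartic_inv a' b' c' d' e' = q &
    quartic_zero a' b' c' d' e' -> quartic_zero a b c d e].

Lemma quartic_descent_left (a b c d e q : int) :
  equianharmonic (3 * a) (3 * b) c d e ->
  quartic_inv (3 * a) (3 * b) c d e = 27 * q ->
  descends_to q (3 * a) (3 * b) c d e.
Proof.
move=> rel h; have [c' [cE [[d' [e' [dE eE]]]|[a' [b' [aE bE]]]]]] :=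
  quartic_triple_root rel h.
  exists a, b, c', d', e'; split.
  - apply: (@mul_zr_inj 9) => //; move: rel; rewrite /equianharmonic cE dE eE; clear; lia.
  - apply: (@mul_zr_inj 27) => //; rewrite -h cE dE eE /quartic_inv; ring.
  case=> x [y [xy xyE]]; exists x, y; split=> //.
  by rewrite -[RHS](mulr0 3) -xyE cE dE eE /quartic_form; ring.
exists a', b', c', d, (3 * e); split.
- apply: (@mul_zr_inj 9) => //; move: rel; rewrite /equianharmonic cE aE bE; clear; lia.
- by apply: (@mul_zr_inj 27) => //; rewrite -h cE aE bE /quartic_inv; ring.
case=> x [y [xy xyE]]; exists x, (3 * y); split; first by rewrite mulf_eq0.
by rewrite -[RHS](mulr0 27) -xyE cE aE bE /quartic_form; ring.
Qed.

Lemma quartic_descent_right (a b c d e q : int) :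
  equianharmonic a b c (3 * d) (3 * e) ->
  quartic_inv a b c (3 * d) (3 * e) = 27 * q ->
  descends_to q a b c (3 * d) (3 * e).
Proof.
move=> /equianharmonic_swap rel; rewrite -quartic_inv_swap => h.
have [a1 [b1 [c1 [d1 [e1 [rel1 h1 z1]]]]]] := quartic_descent_left rel h.
exists a1, b1, c1, d1, e1; split=> // /z1; exact: quartic_zero_swap.
Qed.

(** Modulo 3 the form is x^3 (a x + b y) + y^3 (d x + e y) with a e = b d, that
    is a linear form times the cube of a linear form; a shift moves its triple
    zero to a coordinate point. *)
Lemma quartic_descent (a b c d e q : int) :
  equianharmonic a b c d e -> quartic_inv a b c d e = 27 * q ->
  descends_to q a b c d e.
Proof.
move=> rel h.
have shift t d' e' : d + 6 * t * c + 3 * t ^+ 2 * b + 4 * t ^+ 3 * a = 3 * d' ->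
    e + t * d + 3 * t ^+ 2 * c + t ^+ 3 * b + t ^+ 4 * a = 3 * e' ->
    descends_to q a b c d e.
  move=> dE eE; have := quartic_inv_shift t rel; have := equianharmonic_shift t rel.
  rewrite h dE eE => rel' /(quartic_descent_right rel').
  move=> [a1 [b1 [c1 [d1 [e1 [rel1 h1 z1]]]]]]; exists a1, b1, c1, d1, e1; split=> // /z1.
  rewrite -dE -eE; exact: quartic_zero_shift.
have det : exists m, a * e - b * d = 3 * m.
  by exists (- c ^+ 2 - a * e); move: rel; rewrite /equianharmonic; clear; lia.
have [m mE] := det.
have [a' aE] := int_mod3 a; have [b' bE] := int_mod3 b.
have [d' dE] := int_mod3 d; have [e' eE] := int_mod3 e.
have [[a3 b3]|ab] : (a = 3 * a' /\ b = 3 * b') \/ ~ (a = 3 * a' /\ b = 3 * b') by lia.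
  by rewrite a3 b3; apply: quartic_descent_left; rewrite -a3 -b3.
have [[d3 e3]|de] : (d = 3 * d' /\ e = 3 * e') \/ ~ (d = 3 * d' /\ e = 3 * e') by lia.
  by rewrite d3 e3; apply: quartic_descent_right; rewrite -d3 -e3.
have [sgn|sgn] : (exists u v, d = a + 3 * u /\ e = b + 3 * v) \/
    (exists u v, d = - a + 3 * u /\ e = - b + 3 * v).
  case: aE bE dE eE => aE [] bE [] dE [] eE; move: mE ab de; rewrite aE bE dE eE;
    clear; move=> mE ab de; try (exfalso; lia).
    all: try (left; exists (d' - a'), (e' - b'); lia).
    all: try (right; exists (d' + a'), (e' + b'); lia).
  have [u [v [dE' eE']]] := sgn.
  by apply: (shift (-1) (- 2 * c + b - a + u) (v + c - u)); rewrite ?eE' dE'; ring.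
have [u [v [dE' eE']]] := sgn.
by apply: (shift 1 (2 * c + b + a + u) (v + c + u)); rewrite ?eE' dE'; ring.
Qed.

Lemma abs_pow3_dvd (j : int) (k : nat) : (2 < k)%N -> absz j = (3 ^ k)%N ->
  exists2 q, j = 27 * q & absz q = (3 ^ (k - 3))%N.
Proof.
move=> k3 h; have : (27 %| j)%Z by rewrite dvdzE h -[absz 27]/(3 ^ 3)%N dvdn_exp2l.
move=> /dvdzP[q qE]; exists q; first by rewrite qE mulrC.
apply/eqP; rewrite -(@eqn_pmul2r (3 ^ 3)) // -expnD subnK // -h qE abszM.
by rewrite -[absz 27]/(3 ^ 3)%N.
Qed.

(** Each descent lowers the exponent by 3, down to 0 or 1, where the invariant
    is at most 3 in absolute value. *)
Lemma quartic_pow3_zero_aux (k : nat) (a b c d e : int) : (k %% 3 != 2)%N ->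
  equianharmonic a b c d e -> absz (quartic_inv a b c d e) = (3 ^ k)%N ->
  quartic_zero a b c d e.
Proof.
elim/ltn_ind: k a b c d e => k IH a b c d e k2 rel h.
have [k3|k3] := leqP k 2.
  apply: quartic_small => //; first by rewrite -absz_eq0 h expn_eq0.
  by rewrite -abszE h; case: k k2 {IH h} k3 => [|[|[|]]].
have [q qE qk] := abs_pow3_dvd k3 h.
have [a1 [b1 [c1 [d1 [e1 [rel1 h1 z1]]]]]] := quartic_descent rel qE.
apply: z1; apply: (IH (k - 3)%N) => //; try (by clear -k3 k2; lia).
by rewrite h1.
Qed.

(** The Hessian of f, integrally rescaled, is again equianharmonic with
    invariant - j^2: if the exponent of 3 in j is 2 modulo 3, that of the
    Hessian is 1 modulo 3. Its zeros are the antipodes of those of f when the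
    latter are the vertices of a regular tetrahedron. *)
Lemma hessian_inv (F : fieldType) (a b g d e : F) :
  a != 0 -> a * e = b * d - 3 * g ^+ 2 ->
  quartic_inv (b ^+ 2 - 16 * a * g) (4 * b * g - 16 * a * d)
    (8 * g ^+ 2 - 2 * b * d) (4 * g * d - b * e) (d ^+ 2 - g * e)
  = - quartic_inv a b (2 * g) (4 * d) e ^+ 2.
Proof.
move=> a0 rel; have -> : e = (b * d - 3 * g ^+ 2) / a by rewrite -rel mulrC mulKf.
by rewrite /quartic_inv; field.
Qed.

(** Modulo the vanishing invariant I, the value of f at (- f_y, f_x) is
    - 3 H^2 f, where H is the Hessian; so a zero of H leads to a zero of f. *)
Lemma quartic_gradient (a b c d e x y : int) :
  equianharmonic a b c d e ->
  (b ^+ 2 - 8 * a * c) * x ^+ 4 + 4 * (b * c - 2 * a * d) * x ^+ 3 * y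
  + (24 * c ^+ 2 - 6 * b * d) * x ^+ 2 * y ^+ 2 + 4 * (c * d - 2 * b * e) * x * y ^+ 3
  + (d ^+ 2 - 8 * c * e) * y ^+ 4 = 0 ->
  quartic_form a b c d e
    (- (b * x ^+ 3 + 6 * c * x ^+ 2 * y + 3 * d * x * y ^+ 2 + 4 * e * y ^+ 3))
    (4 * a * x ^+ 3 + 3 * b * x ^+ 2 * y + 6 * c * x * y ^+ 2 + d * y ^+ 3) = 0.
Proof.
move=> rel h.
set H := (X in X = 0) in h.
pose r := 4 * a * e - b * d + 3 * c ^+ 2.
have r0 : r = 0 by rewrite /r rel; ring.
pose H' := H - 4 * r * x ^+ 2 * y ^+ 2.
have -> : quartic_form a b c d e
    (- (b * x ^+ 3 + 6 * c * x ^+ 2 * y + 3 * d * x * y ^+ 2 + 4 * e * y ^+ 3))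
    (4 * a * x ^+ 3 + 3 * b * x ^+ 2 * y + 6 * c * x * y ^+ 2 + d * y ^+ 3)
  = - 3 * H' ^+ 2 * quartic_form a b c d e x y + 64 * r * quartic_form a b c d e x y ^+ 3.
  by rewrite /H' /H /r /quartic_form; ring.
by rewrite /H' h r0; ring.
Qed.

(** If the gradient vanishes at (x, y), Euler's identity shows that (x, y)
    itself is a zero. *)
Lemma quartic_gradient_zero (a b c d e x y : int) :
  equianharmonic a b c d e -> (x != 0) || (y != 0) ->
  (b ^+ 2 - 8 * a * c) * x ^+ 4 + 4 * (b * c - 2 * a * d) * x ^+ 3 * y
  + (24 * c ^+ 2 - 6 * b * d) * x ^+ 2 * y ^+ 2 + 4 * (c * d - 2 * b * e) * x * y ^+ 3
  + (d ^+ 2 - 8 * c * e) * y ^+ 4 = 0 -> quartic_zero a b c d e.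
Proof.
move=> rel xy h; have := quartic_gradient rel h.
set fy := b * x ^+ 3 + _ + _ + _; set fx := 4 * a * x ^+ 3 + _ + _ + _ => f0.
have [/eqP|g0] := boolP ((- fy != 0) || (fx != 0)); last first.
  exists x, y; split=> //; apply: (@mul_zr_inj 4) => //.
  move: g0; rewrite negb_or !negbK oppr_eq0 => /andP[/eqP fy0 /eqP fx0].
  have -> : 4 * quartic_form a b c d e x y = x * fx + y * fy.
    by rewrite /fx /fy /quartic_form; ring.
  by rewrite fx0 fy0 !mulr0.
by move=> /eqP g0; exists (- fy), fx.
Qed.

Lemma quartic_hessian_odd (a b g d e : int) (k : nat) :
  equianharmonic a b (2 * g) (4 * d) e ->
  absz (quartic_inv a b (2 * g) (4 * d) e) = (3 ^ k)%N -> (k %% 3 = 2)%N ->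
  quartic_zero a b (2 * g) (4 * d) e.
Proof.
move=> rel h k2.
have [a0|a0] := eqVneq a 0.
  by exists 1, 0; split=> //; rewrite a0 /quartic_form; ring.
have {}rel' : a * e = b * d - 3 * g ^+ 2.
  by move: rel; rewrite /equianharmonic; clear; lia.
have invE : quartic_inv (b ^+ 2 - 16 * a * g) (4 * b * g - 16 * a * d)
    (8 * g ^+ 2 - 2 * b * d) (4 * g * d - b * e) (d ^+ 2 - g * e)
  = - quartic_inv a b (2 * g) (4 * d) e ^+ 2.
  apply: (@intr_inj rat).
  have := @hessian_inv rat a%:~R b%:~R g%:~R d%:~R e%:~R.
  rewrite intr_eq0 => /(_ a0) h1.
  have h2 : a%:~R * e%:~R = b%:~R * d%:~R - 3 * g%:~R ^+ 2 :> rat.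
    by rewrite -rmorphM rel' /=; ring.
  have h3 := h1 h2.
  rewrite (_ : (quartic_inv _ _ _ _ _)%:~R = quartic_inv
    (b%:~R ^+ 2 - 16 * a%:~R * g%:~R) (4 * b%:~R * g%:~R - 16 * a%:~R * d%:~R)
    (8 * g%:~R ^+ 2 - 2 * b%:~R * d%:~R) (4 * g%:~R * d%:~R - b%:~R * e%:~R)
    (d%:~R ^+ 2 - g%:~R * e%:~R)); last by rewrite /quartic_inv; ring.
  by rewrite h3 /quartic_inv; ring.
have [|||x [y [xy xyE]]] := @quartic_pow3_zero_aux (k + k) (b ^+ 2 - 16 * a * g)
    (4 * b * g - 16 * a * d) (8 * g ^+ 2 - 2 * b * d) (4 * g * d - b * e) (d ^+ 2 - g * e).
- by clear -k2; lia.
- rewrite /equianharmonic; apply/eqP; rewrite -subr_eq0; apply/eqP.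
  have -> : 4 * (b ^+ 2 - 16 * a * g) * (d ^+ 2 - g * e)
     - ((4 * b * g - 16 * a * d) * (4 * g * d - b * e) - 3 * (8 * g ^+ 2 - 2 * b * d) ^+ 2)
    = (a * e - (b * d - 3 * g ^+ 2)) * (64 * g ^+ 2 - 16 * b * d).
    by ring.
  by rewrite rel' subrr mul0r.
- by rewrite invE abszN abszX h -expnM muln2 addnn.
apply: (@quartic_gradient_zero _ _ _ _ _ (2 * x) y) => //.
  by rewrite mulf_eq0.
by rewrite -[RHS](mulr0 16) -xyE /quartic_form; ring.
Qed.

(** As b is odd, the relation I = 0 forces c to be even and the next coefficient
    to be divisible by 4, which is what makes the rescaled Hessian integral. *)
Lemma quartic_pow3_zero_odd (k : nat) (a b c d e : int) :
  (k %% 3 = 2)%N -> equianharmonic a (2 * b + 1) c (2 * d) e ->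
  absz (quartic_inv a (2 * b + 1) c (2 * d) e) = (3 ^ k)%N ->
  quartic_zero a (2 * b + 1) c (2 * d) e.
Proof.
move=> k2 rel h.
have [g cE] : exists g, c = 2 * g.
  have [g [cE|cE]] := int_mod2 c; first by exists g.
  by exfalso; move: rel; rewrite /equianharmonic cE; clear; lia.
have [d' dE] : exists d', 2 * d = 4 * d'.
  have [d' [dE|dE]] := int_mod2 d; first by exists d'; rewrite dE; ring.
  by exfalso; move: rel; rewrite /equianharmonic cE dE; clear; lia.
move: rel h; rewrite cE dE => rel h; exact: quartic_hessian_odd rel h k2.
Qed.

(** When the exponent is 2 modulo 3, the invariant being odd makes b or d odd,
    and a swap or a shift makes b odd and d even. *)
Lemma quartic_pow3_zero (k : nat) (a b c d e : int) :
  equianharmonic a b c d e -> absz (quartic_inv a b c d e) = (3 ^ k)%N ->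
  quartic_zero a b c d e.
Proof.
have [k2|k2] := eqVneq (k %% 3)%N 2; last exact: quartic_pow3_zero_aux.
move=> rel h; have oddb := quartic_pow3_zero_odd k2.
have jodd : exists m, quartic_inv a b c d e = 2 * m + 1.
  have [m [mE|mE]] := int_mod2 (quartic_inv a b c d e); last by exists m.
  have : odd (absz (quartic_inv a b c d e)) by rewrite h oddX orbT.
  by rewrite mE abszM oddM.
have [b' [bE|bE]] := int_mod2 b; have [d' [dE|dE]] := int_mod2 d.
- exfalso; have [m] := jodd; rewrite /quartic_inv bE dE; clear; lia.
- apply: quartic_zero_swap; move: (equianharmonic_swap rel) h.
  by rewrite -quartic_inv_swap bE dE; exact: oddb.
- by move: rel h; rewrite bE dE; exact: oddb.
apply: (@quartic_zero_shift 1); move: (equianharmonic_shift 1 rel) h.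
rewrite -(quartic_inv_shift 1 rel).
have -> : b + 4 * 1 * a = 2 * (b' + 2 * a) + 1 by rewrite bE; ring.
have -> : d + 6 * 1 * c + 3 * 1 ^+ 2 * b + 4 * 1 ^+ 3 * a
  = 2 * (d' + 3 * c + 3 * b' + 2 + 2 * a) by rewrite bE dE; ring.
exact: oddb.
Qed.

(** * Jacobi's identity and the tau function modulo 2 and 3 *)

Section QBinomial.
Variables (R : comNzRingType) (q : R).

(** Gaussian binomial coefficients. *)
Fixpoint qbin (n k : nat) : R :=
  match n, k with
  | _, 0 => 1
  | 0, _.+1 => 0
  | n'.+1, k'.+1 => qbin n' k' + q ^+ k'.+1 * qbin n' k'.+1
  end.

Definition qfact (n : nat) : R := \prod_(1 <= m < n.+1) (1 - q ^+ m).

Lemma qbin0 n : qbin n 0 = 1. Proof. by case: n. Qed.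

Lemma qbinS n k : qbin n.+1 k.+1 = qbin n k + q ^+ k.+1 * qbin n k.+1.
Proof. by []. Qed.

Lemma qbin_small n k : (n < k)%N -> qbin n k = 0.
Proof.
elim: n k => [|n IH] [|k] //= nk; rewrite !IH ?mulr0 ?addr0 //; exact: ltnW.
Qed.

Lemma qfactS n : qfact n.+1 = qfact n * (1 - q ^+ n.+1).
Proof. by rewrite /qfact big_nat_recr. Qed.

Lemma qfact0 : qfact 0 = 1. Proof. by rewrite /qfact big_geq. Qed.

Lemma qbin_fact k m : qbin (k + m) k * qfact k * qfact m = qfact (k + m).
Proof.
move: {-1}(k + m)%N (erefl (k + m)%N) => n; elim: n k m => [|n IH] k m.
  by move/eqP; rewrite addn_eq0 => /andP[/eqP -> /eqP ->]; rewrite qfact0 !mulr1.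
case: k => [|k]; first by rewrite add0n => ->; rewrite qbin0 qfact0 !mul1r.
move=> [kmn]; rewrite qbinS !mulrDl; have h1 := IH k m kmn.
case: m kmn h1 => [|m] kmn h1.
  move: h1; rewrite -kmn addn0 => h1.
  by rewrite (qbin_small (ltnSn k)) mulr0 !mul0r addr0 qfactS -[in RHS]h1; ring.
have h2 : qbin n k.+1 * qfact k.+1 * qfact m = qfact n by apply: IH; rewrite addSnnS.
have -> : qbin n k * qfact k.+1 * qfact m.+1 = (1 - q ^+ k.+1) * qfact n.
  by rewrite -h1 qfactS; ring.
have -> : q ^+ k.+1 * qbin n k.+1 * qfact k.+1 * qfact m.+1
   = q ^+ k.+1 * (1 - q ^+ m.+1) * qfact n.
  by rewrite -h2 (qfactS m); ring.
by rewrite qfactS -kmn -addSn exprD; ring.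
Qed.

Lemma qbinomial n (x y : R) :
  \prod_(i < n) (y + x * q ^+ i)
  = \sum_(k < n.+1) q ^+ 'C(k, 2) * qbin n k * x ^+ k * y ^+ (n - k).
Proof.
elim: n x => [|n IH] x.
  by rewrite big_ord0 big_ord1 /= !mulr1.
rewrite big_ord_recl /= mulr1.
under eq_bigr => i _ do rewrite /bump add1n exprS mulrA.
rewrite IH mulrDl addrC [RHS]big_ord_recl /= expr0 !mul1r subn0.
have -> : y * \sum_(k < n.+1) q ^+ 'C(k, 2) * qbin n k * (x * q) ^+ k * y ^+ (n - k)
  = y ^+ n.+1 + \sum_(k < n.+1) q ^+ 'C(k.+1, 2) * (q ^+ k.+1 * qbin n k.+1)
      * x ^+ k.+1 * y ^+ (n - k).
  rewrite big_ord_recl big_ord_recr /= (qbin_small (ltnSn n)) !(mulr0, mul0r) addr0.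
  rewrite qbin0 !mul1r subn0 mulrDr -exprS; congr (_ + _).
  rewrite mulr_sumr; apply: eq_bigr => k _; rewrite /bump add1n.
  rewrite -(subnSK (ltn_ord k)) exprMn (exprS y); ring.
rewrite addrCA; congr (_ + _); rewrite mulr_sumr -big_split /=.
apply: eq_bigr => k _; rewrite /bump add1n subSS binS bin1 addnC exprD exprMn.
by rewrite (exprS x); ring.
Qed.

End QBinomial.
Arguments qbin R q n k : simpl never.

Section JacobiTau.
Local Notation q := ('X : {poly int}).
Local Notation P := (qfact q).

Lemma bin2_double n : (2 * 'C(n, 2) + n = n * n)%N.
Proof. by elim: n => // n IH; rewrite binS bin1; lia. Qed.

Lemma bin2_add a b : ('C(a + b, 2) = 'C(a, 2) + 'C(b, 2) + a * b)%N.
Proof. by have := bin2_double a; have := bin2_double b; have := bin2_double (a + b); lia. Qed.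

Lemma qfact_coef0 n : (P n)`_0 = 1.
Proof.
elim: n => [|n IH]; first by rewrite qfact0 coef1.
by rewrite qfactS coef0M IH coefB coef1 coefXn mul1r subr0.
Qed.

Lemma qfact_neq0 n : P n != 0.
Proof. by apply/eqP => h; have := qfact_coef0 n; rewrite h coef0. Qed.

Lemma qbin_sym k m : qbin q (k + m) k = qbin q (k + m) m.
Proof.
apply: (mulIf (mulf_neq0 (qfact_neq0 k) (qfact_neq0 m))).
by rewrite mulrA qbin_fact (mulrC (P k)) mulrA addnC qbin_fact.
Qed.

Lemma prod_below N : \prod_(0 <= i < N) (q ^+ i - q ^+ N) = q ^+ 'C(N, 2) * P N.
Proof.
have -> : q ^+ 'C(N, 2) = \prod_(0 <= i < N) q ^+ i.
  by rewrite -bin2_sum -expr_sum big_mkord.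
rewrite /qfact big_add1 /= [X in _ = _ * X]big_nat_rev /= add0n -big_split /=.
apply: eq_big_nat => i /andP[_ iN]; rewrite subnSK //.
by rewrite mulrBr mulr1 -exprD subnKC // ltnW.
Qed.

Lemma prod_above N :
  \prod_(N.+1 <= i < (2 * N).+1) (q ^+ i - q ^+ N) = (-1) ^+ N * q ^+ (N * N) * P N.
Proof.
rewrite -{1}[N.+1]add0n big_addn (_ : ((2 * N).+1 - N.+1)%N = N); last by lia.
have -> : (-1) ^+ N * q ^+ (N * N) = \prod_(0 <= i < N) (- q ^+ N).
  by rewrite prodr_const_nat subn0 [RHS]exprNn exprM.
rewrite /qfact big_add1 /= -big_split /=; apply: eq_bigr => i _.
by rewrite (_ : (i + N.+1 = N + i.+1)%N) 1?exprD; [ring | lia].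
Qed.

(** In the q-binomial expansion of the product of X q^i - q^N over i < 2 N + 1,
    the factor at i = N is q^N (X - 1). Dividing by X - 1 and setting X = 1,
    that is differentiating at X = 1, gives q-factorials on one side; on the
    other side the terms k = N - n and k = N + 1 + n combine to the coefficient
    2 n + 1. *)
Lemma jacobi_finite N :
  P N ^+ 2 = \sum_(n < N.+1)
     ((-1) ^+ n * (2 * n + 1)%:R) *: q ^+ 'C(n.+1, 2) * qbin q (2 * N).+1 (N - n).
Proof.
pose M := (2 * N).+1.
pose c k := q ^+ 'C(k, 2) * qbin q M k * (- q ^+ N) ^+ (M - k).
pose F i : {poly {poly int}} := 'X * (q ^+ i)%:P - (q ^+ N)%:P.
pose g := (\prod_(0 <= i < N) F i) * (q ^+ N)%:P * (\prod_(N.+1 <= i < M) F i).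
have qbinP k : qbin (q%:P : {poly {poly int}}) M k = (qbin q M k)%:P.
  elim: (M) k => [|m IH] [|k] //; rewrite !qbinS !IH.
  by rewrite rmorphD rmorphM rmorphXn.
have gE : ('X - 1) * g = \sum_(k < M.+1) (c k)%:P * 'X^k.
  have -> : ('X - 1) * g = \prod_(i < M) (- (q ^+ N)%:P + 'X * q%:P ^+ i).
    transitivity (\prod_(0 <= i < M) F i).
      rewrite (@big_cat_nat _ _ _ N) ?leq0n //=; last by rewrite /M; lia.
      rewrite [X in _ = _ * X]big_ltn; last by rewrite /M; lia.
      have -> : F N = ('X - 1) * (q ^+ N)%:P by rewrite /F; ring.
      by rewrite /g; ring.
    by rewrite big_mkord; apply: eq_bigr => i _; rewrite /F rmorphXn addrC.
  rewrite qbinomial; apply: eq_bigr => k _; rewrite qbinP /c.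
  by rewrite !rmorphM !rmorphXn /= rmorphN rmorphXn; ring.
have g1 : g.[1] = \sum_(k < M.+1) c k *+ k.
  have -> : g.[1] = (('X - 1) * g)^`().[1].
    by rewrite derivM -[1]polyC1 derivXsubC !hornerE subrr mul0r addr0.
  rewrite gE raddf_sum /= horner_sum; apply: eq_bigr => k _.
  by rewrite derivM derivC mul0r add0r derivXn hornerM hornerC hornerMn hornerXn expr1n mulr_natr.
have g1' : g.[1] = (-1) ^+ N * q ^+ ('C(N, 2) + N + N * N) * P N ^+ 2.
  rewrite /g !hornerM !horner_prod hornerC.
  under eq_bigr => i _ do rewrite /F hornerD hornerN hornerM hornerX !hornerC mul1r.
  under [X in _ * X]eq_bigr => i _ do
    rewrite /F hornerD hornerN hornerM hornerX !hornerC mul1r.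
  by rewrite prod_below prod_above !exprD; ring.
have qE0 : (-1) ^+ N * q ^+ ('C(N, 2) + N + N * N) != 0 :> {poly int}.
  by rewrite mulf_neq0 ?signr_eq0 // expf_neq0 // polyX_eq0.
apply: (mulfI qE0); rewrite -g1' g1 mulr_sumr.
rewrite -(big_mkord xpredT (fun k => c k *+ k)) (@big_cat_nat _ _ _ N.+1) //=;
  last by rewrite /M; lia.
rewrite [X in X + _]big_nat_rev /= add0n.
have -> : \sum_(N.+1 <= k < M.+1) c k *+ k
    = \sum_(0 <= n < N.+1) c (n + N.+1)%N *+ (n + N.+1).
  rewrite -{1}[N.+1]add0n big_addn (_ : (M.+1 - N.+1)%N = N.+1) //.
  by rewrite /M; lia.
rewrite -big_split /= big_mkord; apply: eq_bigr => -[n /= nN] _.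
rewrite subSS; have [m NE] : exists m, N = (n + m)%N by exists (N - n)%N; rewrite subnKC.
have -> : (N - n)%N = m by rewrite NE addKn.
have e1 : ('C(m, 2) + N * (M - m) = 'C(N, 2) + N + N * N + 'C(n.+1, 2))%N.
  rewrite (_ : (M - m = N + 1 + n)%N); last by rewrite /M; lia.
  by rewrite binS bin1 NE bin2_add; have := bin2_double n; nia.
have e2 : ('C(n + N.+1, 2) + N * m = 'C(N, 2) + N + N * N + 'C(n.+1, 2))%N.
  by rewrite !binS !bin1 addnS binS bin1 !bin2_add; have := bin2_double n; nia.
have ME : M = (m + (n + N.+1))%N by rewrite /M; lia.
have cE k : c k = q ^+ ('C(k, 2) + N * (M - k)) * (-1) ^+ (M - k) * qbin q M k.
  by rewrite /c [X in _ * X]exprNn -exprM exprD; ring.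
have sgnm : (-1) ^+ m = (-1) ^+ N * (-1) ^+ n :> {poly int}.
  by rewrite NE exprD mulrAC -expr2 sqrr_sign mul1r.
rewrite !cE e1 (_ : (M - (n + N.+1))%N = m); last by rewrite ME addnK.
rewrite e2 (_ : (M - m)%N = (N + n).+1); last by rewrite ME addKn addnS addnC.
rewrite (_ : qbin q M (n + N.+1) = qbin q M m); last by rewrite ME [RHS]qbin_sym.
rewrite sgnm (exprS (-1)) (exprD (-1)) (exprD q (_ + _) 'C(n.+1, 2)).
rewrite (_ : (n + N.+1 = m + (2 * n + 1))%N); last by rewrite NE; lia.
rewrite mulrnDr -mul_polyC; move: (qbin q M m) (q ^+ 'C(n.+1, 2)) (q ^+ (_ + _ + _)).
move=> b u v; rewrite -[X in X + _]mulr_natr -[X in _ + (X + _)]mulr_natr.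
rewrite -[X in _ + (_ + X)]mulr_natr rmorphM rmorph_sign rmorph_nat. ring.
Qed.

(** Polynomials stand for power series known up to q^K. *)
Definition eq_upto (R : comNzRingType) (K : nat) (f g : {poly R}) : Prop :=
  forall i, (i < K)%N -> f`_i = g`_i.

Section EqUpto.
Variable R : comNzRingType.
Implicit Types (K : nat) (f g h : {poly R}).

Lemma eq_upto_refl K f : eq_upto K f f. Proof. by []. Qed.

Lemma eq_upto_trans K f g h : eq_upto K f g -> eq_upto K g h -> eq_upto K f h.
Proof. by move=> fg gh i iK; rewrite fg // gh. Qed.

Lemma eq_upto_le K K' f g : (K' <= K)%N -> eq_upto K f g -> eq_upto K' f g.
Proof. by move=> KK' fg i iK; apply: fg; exact: leq_trans KK'. Qed.

Lemma eq_uptoM K f f' g g' :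
  eq_upto K f f' -> eq_upto K g g' -> eq_upto K (f * g) (f' * g').
Proof.
move=> ff gg i iK; rewrite !coefM; apply: eq_bigr => j _.
by rewrite ff ?gg //; apply: leq_ltn_trans iK; rewrite ?leq_subr // -ltnS.
Qed.

Lemma eq_uptoX K f g n : eq_upto K f g -> eq_upto K (f ^+ n) (g ^+ n).
Proof. by move=> fg; elim: n => // n IH; rewrite !exprS; apply: eq_uptoM. Qed.

Lemma eq_upto_lreg K f g : f`_0 = 1 -> eq_upto K (f * g) 0 -> eq_upto K g 0.
Proof.
move=> f0 fg; elim/ltn_ind => i IH iK; have := fg i iK.
rewrite coefM big_ord_recl /= f0 mul1r subn0 big1 ?addr0 // => j _.
have ij : (i - bump 0 j < i)%N by have := ltn_ord j; rewrite /bump /=; lia.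
by rewrite IH ?coef0 ?mulr0 // (ltn_trans ij iK).
Qed.

End EqUpto.

Lemma map_eq_upto (R S : comNzRingType) (phi : {rmorphism R -> S}) K (f g : {poly R}) :
  eq_upto K f g -> eq_upto K (map_poly phi f) (map_poly phi g).
Proof. by move=> fg i iK; rewrite !coef_map fg. Qed.

Lemma qfact_stable n k : eq_upto n.+1 (P (n + k)) (P n).
Proof.
elim: k => [|k IH]; first by rewrite addn0.
rewrite addnS qfactS => i iN; rewrite mulrBr mulr1 coefB coefMXn.
by rewrite ifT ?subr0; [exact: IH | lia].
Qed.

Lemma qbin_fact_upto N n : (n <= N)%N ->
  eq_upto (N - n).+1 (qbin q (2 * N).+1 (N - n) * P N) 1.
Proof.
move=> nN; pose k := (N - n)%N; pose m := (N + n).+1.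
have ME : (2 * N).+1 = (k + m)%N by rewrite /k /m; lia.
have NE : N = (k + n)%N by rewrite /k subnK.
have h1 : eq_upto k.+1 (qbin q (k + m) k * P k) 1.
  apply: (@eq_upto_le _ m.+1); first by rewrite /k /m; lia.
  have : eq_upto m.+1 (P m * (qbin q (k + m) k * P k - 1)) 0.
    move=> i im; rewrite mulrBr mulr1 coefB mulrC qbin_fact addnC qfact_stable //.
    by rewrite subrr coef0.
  move=> /(eq_upto_lreg (qfact_coef0 m)) h i im; apply/eqP.
  by rewrite -subr_eq0 -coefB h // coef0.
rewrite -/k ME; apply: eq_upto_trans h1; apply: eq_uptoM => //.
by rewrite {1}NE; exact: qfact_stable.
Qed.

(** In the finite identity, the product of the Gaussian coefficient and P is 1
    up to terms that do not contribute to exponents at most N. *)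
Theorem jacobi_cube N :
  eq_upto N.+1 (P N ^+ 3)
    (\sum_(n < N.+1) ((-1) ^+ n * (2 * n + 1)%:R) *: 'X^('C(n.+1, 2))).
Proof.
move=> i iN; rewrite exprSr jacobi_finite mulr_suml !coef_sum.
apply: eq_bigr => -[n /= nN] _; rewrite -!scalerAl -mulrA !coefZ coefXnM coefXn.
congr (_ * _); case: ltnP => [iT|Ti]; first by rewrite ltn_eqF.
have nT : (n <= 'C(n.+1, 2))%N by rewrite binS bin1 leq_addl.
rewrite qbin_fact_upto //; last by move: (binomial _ _) nT Ti => T nT Ti; lia.
by rewrite coef1 subn_eq0 eqn_leq Ti andbT.
Qed.

Lemma polyFp_Frobenius p (f : {poly 'F_p}) : prime p -> f ^+ p = f \Po 'X^p.
Proof.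
move=> pp; have ch : p \in [pchar {poly 'F_p}] by rewrite pchar_poly; apply: pchar_Fp.
elim/poly_ind: f => [|f c IH]; first by rewrite comp_poly0 expr0n; case: p pp {ch}.
rewrite comp_polyD comp_polyM comp_polyX comp_polyC -IH.
rewrite -(pFrobenius_autE ch) rmorphD rmorphM /= !pFrobenius_autE -polyC_exp.
congr (_ + _%:P).
by have := expf_card c; rewrite card_Fp.
Qed.

Definition jacobi_sum (N : nat) : {poly int} :=
  \sum_(n < N.+1) ((-1) ^+ n * (2 * n + 1)%:R) *: 'X^('C(n.+1, 2)).

Lemma tauE n : tau n = ('X * P n ^+ 24)`_n.
Proof. by rewrite /tau prodrXl. Qed.

Lemma tau_map (R : comNzRingType) n :
  (tau n)%:~R = ('X * map_poly (intr : int -> R) (P n) ^+ 24)`_n.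
Proof. by rewrite tauE -coef_map rmorphM rmorphXn /= map_polyX. Qed.

Lemma bin2_odd_square n : (8 * 'C(n.+1, 2) + 1 = (2 * n + 1) ^ 2)%N.
Proof. by have := bin2_double n; rewrite binS bin1; lia. Qed.

(** Modulo 2, q P^24 = q (P^3)^8 is the sum of q^(8 T + 1) over the triangular
    numbers T, and 8 T + 1 runs through the odd squares. *)
Lemma tau_mod2 l : prime l -> (tau l)%:~R = 0 :> 'F_2.
Proof.
move=> pl; rewrite tau_map; set Pb := map_poly _ _.
have hJ : eq_upto l.+1 ('X * (Pb ^+ 3) ^+ 8) ('X * map_poly intr (jacobi_sum l) ^+ 8).
  apply: eq_uptoM => //; apply: eq_uptoX.
  by rewrite -rmorphXn; apply: map_eq_upto; exact: jacobi_cube.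
rewrite (exprM Pb 3 8) hJ // coefXM; case: ifP => // _.
set J := map_poly _ _.
have -> : J ^+ 8 = J \Po 'X^2 \Po 'X^2 \Po 'X^2.
  by rewrite -!polyFp_Frobenius // -!exprM.
rewrite !coef_comp_poly_Xn //; do 3!case: ifP => // ?.
rewrite coef_map /jacobi_sum coef_sum big1 ?rmorph0 // => n _; rewrite coefZ coefXn.
case: eqP => [hT|_]; last by rewrite mulr0.
have lE : l = ((2 * n + 1) ^ 2)%N.
  by rewrite -bin2_odd_square -hT; have := prime_gt0 pl; lia.
suff : ~~ prime l by rewrite pl.
move: (n : nat) lE => k -> {n hT hJ J Pb pl}; apply/negP => /primeP[k1].
by move=> /(_ (2 * k + 1)%N); rewrite -mulnn dvdn_mulr // => /(_ isT) /orP[] /eqP; nia.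
Qed.

(** The coefficient of q^n is sigma(n) for 0 < n <= min(K, N). *)
Definition divisor_sum (K N : nat) : {poly int} :=
  \sum_(1 <= m < N.+1) m%:R *: \sum_(1 <= j < K.+1) 'X^(m * j).

Lemma geometric_upto K m : (0 < m)%N ->
  eq_upto K ((1 - q ^+ m) * \sum_(1 <= j < K.+1) 'X^(m * j)) (q ^+ m).
Proof.
move=> m0; have -> : (1 - q ^+ m) * \sum_(1 <= j < K.+1) 'X^(m * j)
   = q ^+ m - q ^+ (m * K.+1).
  elim: K => [|K IH]; first by rewrite big_geq // mulr0 muln1 subrr.
  by rewrite big_nat_recr //= mulrDr IH [(m * K.+2)%N]mulnS exprD; ring.
move=> i iK; rewrite coefB [X in _ - X]coefXn ltn_eqF ?subr0 //.
by apply: leq_trans iK _; nia.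
Qed.

(** This is the logarithmic derivative of Euler's product. *)
Lemma euler_log_deriv K N :
  eq_upto K (P N * divisor_sum K N) (- ('X * (P N)^`())).
Proof.
elim: N => [|N IH].
  by rewrite /divisor_sum big_geq // qfact0 derivC !mulr0 oppr0.
rewrite /divisor_sum big_nat_recr //= -/(divisor_sum K N) qfactS.
have -> : P N * (1 - q ^+ N.+1) * (divisor_sum K N
    + N.+1%:R *: \sum_(1 <= j < K.+1) 'X^(N.+1 * j))
  = (1 - q ^+ N.+1) * (P N * divisor_sum K N) + N.+1%:R *: (P N *
      ((1 - q ^+ N.+1) * \sum_(1 <= j < K.+1) 'X^(N.+1 * j))).
  by rewrite -!mul_polyC; ring.
have h1 : eq_upto K ((1 - q ^+ N.+1) * (P N * divisor_sum K N))
    ((1 - q ^+ N.+1) * - ('X * (P N)^`())) by apply: eq_uptoM.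
have h2 : eq_upto K (P N * ((1 - q ^+ N.+1) * \sum_(1 <= j < K.+1) 'X^(N.+1 * j)))
    (P N * q ^+ N.+1) by apply: eq_uptoM => //; apply: geometric_upto.
have <- : (1 - q ^+ N.+1) * - ('X * (P N)^`()) + N.+1%:R *: (P N * q ^+ N.+1)
  = - ('X * (P N * (1 - q ^+ N.+1))^`()).
  rewrite derivM derivB -[1]polyC1 derivC derivXn sub0r /= -mul_polyC rmorph_nat.
  by rewrite exprS; ring.
by move=> i iK; rewrite !coefD !coefZ h1 // h2.
Qed.

Lemma divisor_sum_prime l : prime l -> (divisor_sum l.+1 l)`_l = 1 + l%:R.
Proof.
move=> pl; have l1 := prime_gt1 pl; rewrite /divisor_sum coef_sum.
have inner m : (m%:R *: \sum_(1 <= j < l.+2) 'X^(m * j) : {poly int})`_l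
   = m%:R * \sum_(1 <= j < l.+2) (l == m * j)%N%:R.
  by rewrite coefZ coef_sum; congr (_ * _); apply: eq_bigr => j _; rewrite coefXn.
under eq_bigr => m _ do rewrite inner.
have only j0 m : (0 < j0 < l.+2)%N -> l = (m * j0)%N ->
    \sum_(1 <= j < l.+2) (l == m * j)%N%:R = 1 :> int.
  move=> j0l lE; rewrite (bigD1_seq j0) ?mem_index_iota ?iota_uniq //=.
  rewrite -lE eqxx big1 ?addr0 // => j jj0; rewrite lE eqn_pmul2l 1?eq_sym ?(negbTE jj0) //.
  by rewrite lt0n; apply/eqP => m0; move: l1; rewrite lE m0.
rewrite big_nat_recr ?prime_gt0 //= big_ltn // (only l) ?mul1n ?ltnS ?leqnSn ?prime_gt0 //.
rewrite (only 1%N) ?muln1 // !mulr1 big_nat_cond big1 ?addr0 // => m.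
rewrite andbT => /andP[m2 ml]; rewrite big1 ?mulr0 // => j _.
case: eqP => // lE; have /primeP[_ /(_ m)] := pl.
by rewrite {1}lE dvdn_mulr // => /(_ isT) /orP[] /eqP; lia.
Qed.

Definition sum_squares (n : nat) : nat := \sum_(i < n.+1) i ^ 2.

Lemma sum_squaresE n : (3 * sum_squares n = (2 * n + 1) * 'C(n.+1, 2))%N.
Proof.
elim: n => [|n IH]; first by rewrite /sum_squares big_ord1.
rewrite /sum_squares big_ord_recr /= mulnDr -/(sum_squares n) IH.
by have := bin2_double n.+1; rewrite (binS n.+1) bin1; move: 'C(n.+1, 2) => t; nia.
Qed.

(** By the logarithmic derivative of P the left-hand side is - q (P^3)' / 3, and
    P^3 is Jacobi's series; (2 n + 1) n (n + 1) / 6 is a sum of squares. *)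
Lemma cube_sigma l :
  eq_upto l.+1 (P l ^+ 3 * divisor_sum l.+1 l)
    (- \sum_(n < l.+1) ((-1) ^+ n * (sum_squares n)%:R) *: 'X^('C(n.+1, 2))).
Proof.
move=> i il; apply: (@mulfI _ (3 : int)) => //.
have -> : 3 * (P l ^+ 3 * divisor_sum l.+1 l)`_i
   = (3%:P * P l ^+ 2 * (P l * divisor_sum l.+1 l))`_i.
  by rewrite -coefCM; congr (coefp i _); rewrite !exprS; ring.
have h := @eq_uptoM _ l.+1 (3%:P * P l ^+ 2) _ _ _ (@eq_upto_refl _ _ _) (@euler_log_deriv l.+1 l).
rewrite h // (_ : 3%:P * P l ^+ 2 * - ('X * (P l)^`()) = - ('X * (P l ^+ 3)^`())); last first.
  by rewrite deriv_exp /= polyC_natr; ring.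
rewrite coefN coefN mulrN; congr (- _).
have -> : ('X * (P l ^+ 3)^`())`_i = (P l ^+ 3)`_i *+ i.
  by rewrite coefXM coef_deriv; case: (i).
rewrite jacobi_cube // !coef_sum -sumrMnl mulr_sumr; apply: eq_bigr => n _.
rewrite !coefZ !coefXn; case: eqP => [->|_]; last by rewrite !(mulr0, mul0rn).
have := sum_squaresE n; move: (sum_squares n) (binomial _ _) => s t st.
have stR : (2 * n + 1)%:R * t%:R = 3 * s%:R :> int by rewrite -!natrM st.
by rewrite !mulr1 -[LHS]mulr_natr -[LHS]mulrA stR; ring.
Qed.

Lemma coef_cube_F3 (f : {poly 'F_3}) i : ~~ (3 %| i)%N -> (f ^+ 3)`_i = 0.
Proof. by move=> i3; rewrite polyFp_Frobenius // coef_comp_poly_Xn // (negPf i3). Qed.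

Lemma sum_triples (V : zmodType) (K : nat) (F : nat -> V) :
  \sum_(n < 3 * K) F n = \sum_(k < K) (F (3 * k)%N + F (3 * k + 1)%N + F (3 * k + 2)%N).
Proof.
elim: K => [|K IH]; first by rewrite !big_ord0.
rewrite [RHS]big_ord_recr /= -IH -!(big_mkord xpredT F) (_ : (3 * K.+1 = (3 * K).+3)%N); last by lia.
by rewrite !big_nat_recr //= addn1 addn2 !addrA.
Qed.

(** A triangular number T_n is 1 modulo 3 only for n = 3 k + 1, and then
    T_n = 9 T_k + 1. *)
Lemma jacobi_mod3 l i : (i < l.+1)%N -> (i %% 3 = 1)%N ->
  (map_poly (intr : int -> 'F_3) (- \sum_(n < l.+1)
     ((-1) ^+ n * (sum_squares n)%:R) *: 'X^('C(n.+1, 2))))`_i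
  = ('X * map_poly (intr : int -> 'F_3) (jacobi_sum l) ^+ 9)`_i.
Proof.
move=> il i1.
have -> : ('X * map_poly (intr : int -> 'F_3) (jacobi_sum l) ^+ 9)`_i
   = \sum_(k < l.+1) ((-1) ^+ k * (2 * k + 1)%:R) *+ (i == 9 * 'C(k.+1, 2) + 1)%N.
  rewrite coefXM ifF; last by case: (i) i1.
  set J := map_poly _ _.
  have -> : J ^+ 9 = J \Po 'X^3 \Po 'X^3 by rewrite -!polyFp_Frobenius // -!exprM.
  rewrite !coef_comp_poly_Xn //.
  have [h3|h3] := boolP (3 %| i.-1)%N; last first.
    by rewrite big1 // => k _; rewrite (_ : (_ == _) = false) //; move: h3; lia.
  have [h9|h9] := boolP (3 %| i.-1 %/ 3)%N; last first.
    by rewrite big1 // => k _; rewrite (_ : (_ == _) = false) //; move: h9; lia.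
  rewrite coef_map /= /jacobi_sum coef_sum rmorph_sum; apply: eq_bigr => k _.
  rewrite /= coefZ coefXn rmorphM rmorphM rmorph_sign !rmorph_nat mulr_natr; congr (_ *+ _).
  by congr nat_of_bool; move: i1 h3 h9; move: (binomial _ _) => t; lia.
rewrite coef_map /= coefN coef_sum rmorphN rmorph_sum /=.
pose F n : 'F_3 := ((-1) ^+ n * (sum_squares n)%:R) *+ (i == 'C(n.+1, 2))%N.
transitivity (- \sum_(n < l.+1) F n).
  congr (- _); apply: eq_bigr => n _; rewrite coefZ coefXn /F.
  by rewrite rmorphM rmorphM rmorph_sign !rmorph_nat mulr_natr.
transitivity (- \sum_(n < 3 * l.+1) F n).
  congr (- _); rewrite -!(big_mkord xpredT F) (@big_cat_nat _ _ _ l.+1 0 (3 * l.+1)) //=; last by lia.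
  rewrite [X in _ = _ + X]big_nat_cond [X in _ = _ + X]big1 ?addr0 // => n.
  rewrite andbT => /andP[ln _]; rewrite /F (_ : (_ == _) = false) //.
  by rewrite binS bin1; move: (binomial _ _) => t; lia.
rewrite sum_triples -sumrN; apply: eq_bigr => k _.
(* T_(3k) and T_(3k+2) are multiples of 3, and T_(3k+1) = 9 T_k + 1. *)
have T1 : ('C((3 * k + 1).+1, 2) = 9 * 'C(k.+1, 2) + 1)%N.
  by have := bin2_double k.+1; have := bin2_double (3 * k + 1).+1; nia.
have -> : F (3 * k)%N = 0.
  rewrite /F (_ : (_ == _) = false) //; have := bin2_double (3 * k).+1.
  by move: (binomial _ _) => t; nia.
have -> : F (3 * k + 2)%N = 0.
  rewrite /F (_ : (_ == _) = false) //; have := bin2_double (3 * k + 2).+1.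
  by move: (binomial _ _) => t; nia.
rewrite add0r addr0 /F T1 -mulNrn; congr (_ *+ _).
rewrite -signr_odd oddD oddM /= -(signr_odd _ k) addbT signrN mulNr opprK; congr (_ * _).
have sE : sum_squares (3 * k + 1) = ((2 * k + 1) * (9 * 'C(k.+1, 2) + 1))%N.
  by have := sum_squaresE (3 * k + 1); rewrite T1; nia.
rewrite sE mulnDr muln1 natrD mulnA natrM natrM -[9%N]/(3 * 3)%N natrM.
by rewrite (pchar_Fp_0 (isT : prime 3)) !(mul0r, mulr0) add0r.
Qed.

(** Modulo 3 the cube of Euler's product is a series in q^3, so the identity
    P^3 * sum sigma(n) q^n = - sum (-1)^n (1^2 + ... + n^2) q^(n(n+1)/2) can be
    restricted to exponents congruent to 1 modulo 3; by Jacobi's identity the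
    right-hand side then becomes q P^27. *)
Lemma tau_eq_sigma_mod3 l : (l %% 3 = 1)%N ->
  (tau l)%:~R = ((divisor_sum l.+1 l)`_l)%:~R :> 'F_3.
Proof.
move=> l1; pose r := map_poly (intr : int -> 'F_3); pose A := r (P l) ^+ 3.
pose D := r (divisor_sum l.+1 l) - 'X * A ^+ 8.
suff D0 i : (i < l.+1)%N -> (i %% 3 = 1)%N -> D`_i = 0.
  have := D0 l (ltnSn l) l1; rewrite /D coefB => /eqP; rewrite subr_eq0 => /eqP.
  rewrite coef_map /= => ->; rewrite tau_map /A -exprM //.
have A0 : A`_0 = 1.
  by rewrite /A !exprS expr0 mulr1 !coef0M coef_map /= qfact_coef0 !mulr1.
have AD j : (j < l.+1)%N -> (j %% 3 = 1)%N -> (A * D)`_j = 0.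
  move=> il i1; rewrite /D mulrBr coefB.
  have -> : A * r (divisor_sum l.+1 l) = r (P l ^+ 3 * divisor_sum l.+1 l).
    by rewrite /A /r rmorphM rmorphXn.
  rewrite (map_eq_upto _ (@cube_sigma l)) // jacobi_mod3 //.
  have -> : A * ('X * A ^+ 8) = 'X * A ^+ 9 by rewrite [A ^+ 9]exprS; ring.
  apply/eqP; rewrite subr_eq0; apply/eqP; symmetry.
  have h : eq_upto l.+1 A (r (jacobi_sum l)).
    by rewrite /A -rmorphXn; apply: map_eq_upto; exact: jacobi_cube.
  by rewrite (eq_uptoM (@eq_upto_refl _ l.+1 'X) (eq_uptoX 9 h)).
elim/ltn_ind: i => i IH il i1; have := AD i il i1.
rewrite coefM big_ord_recl /= A0 mul1r subn0 big1 ?addr0 // => j _.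
have [j3|j3] := boolP (3 %| bump 0 j)%N; last by rewrite /A coef_cube_F3 ?mul0r.
have ji : (bump 0 j <= i)%N by rewrite /bump add1n.
have j0 : (0 < bump 0 j)%N by rewrite /bump add1n.
move: (bump 0 j) j3 ji j0 => t t3 ti t0.
have /dvdnP[u uE] := t3; have iu : (i = (i - t) + u * 3)%N by rewrite -uE subnK.
have h1 : (i - t < i)%N by rewrite ltn_subrL t0 (leq_trans t0 ti).
have h2 : ((i - t) %% 3 = 1)%N by move: i1; rewrite {1}iu addnC modnMDl.
by rewrite (IH _ h1) ?mulr0 // (ltn_trans h1 il).
Qed.

(** For l congruent to 2 modulo 3 both sides vanish, since q P^24 is q times a
    series in q^3. *)
Theorem tau_mod3 l : prime l -> l != 3%N -> (tau l)%:~R = 1 + l%:R :> 'F_3.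
Proof.
move=> pl l3; have [l1|l1] := eqVneq (l %% 3)%N 1%N.
  by rewrite tau_eq_sigma_mod3 // divisor_sum_prime // rmorphD rmorph1 rmorph_nat.
have l0 : ~~ (3 %| l)%N by rewrite dvdn_prime2 // eq_sym.
rewrite tau_map coefXM; case: ifP => [|_]; first by move: (prime_gt0 pl); case: (l).
rewrite (exprM _ 8 3) coef_cube_F3; last by move: l1 l0 (prime_gt0 pl); lia.
rewrite -[1]/(1%:R) -natrD; have [k ->] : exists k, (1 + l = 3 * k)%N.
  by exists ((1 + l) %/ 3)%N; move: l1 l0; lia.
by rewrite natrM pchar_Fp_0 // mul0r.
Qed.

Theorem tau3_mod3 : (tau 3)%:~R = 0 :> 'F_3.
Proof. by rewrite tau_map coefXM /= (exprM _ 8 3) coef_cube_F3. Qed.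

End JacobiTau.

(** * Rational numbers integral at a prime *)

Lemma pintegral_frac (l : nat) (m d : int) :
  coprime l `|d|%N -> pintegral l (m%:~R / d%:~R).
Proof.
have [->|d0] := eqVneq d 0; first by rewrite invr0 mulr0 /pintegral coprimen1.
rewrite /pintegral; set x : rat := _ / _; apply: coprime_dvdr.
have e : numq x * d = m * denq x.
  apply: (@intr_inj rat); rewrite !rmorphM /= numqE /x.
  by rewrite mulrAC divfK ?intr_eq0.
have : (`|denq x| %| `|numq x| * `|d|)%N by rewrite -abszM e abszM dvdn_mull.
by rewrite Gauss_dvdr // coprime_sym coprime_num_den.
Qed.

(** A named predicate, to which the subring structure can be attached. *)
Definition lint_pred (l : nat) : pred rat := fun x => pintegral l x.
Definition lint (l : nat) := [qualify a x : rat | lint_pred l x].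

Lemma lint_subring (l : nat) : subring_closed (lint_pred l).
Proof.
have fracE (x : rat) : x = (numq x)%:~R / (denq x)%:~R by rewrite divq_num_den.
have d0 (x : rat) : (denq x)%:~R != 0 :> rat by rewrite intr_eq0 denq_neq0.
split=> [|x y xl yl|x y xl yl].
- by apply: pintegral_int; rewrite rpred1.
- have -> : x - y = (numq x * denq y - numq y * denq x)%:~R / (denq x * denq y)%:~R.
    rewrite {1}(fracE x) {1}(fracE y) rmorphB !rmorphM /=; field.
    by rewrite !d0.
  by apply: pintegral_frac; rewrite abszM coprimeMr; apply/andP.
have -> : x * y = (numq x * numq y)%:~R / (denq x * denq y)%:~R.
  rewrite {1}(fracE x) {1}(fracE y) !rmorphM /=; field.
  by rewrite !d0.
by apply: pintegral_frac; rewrite abszM coprimeMr; apply/andP.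
Qed.
HB.instance Definition _ (l : nat) :=
  GRing.isSubringClosed.Build rat (lint_pred l) (lint_subring l).

Section Local.
Variables (l : nat) (l_pr : prime l).
Local Notation L := (l%:R : rat).

Lemma lint_int (n : int) : n%:~R \is a lint l.
Proof. by apply: pintegral_int; rewrite intr_int. Qed.

Lemma lprime_neq0 : L != 0.
Proof. by rewrite pnatr_eq0 -lt0n prime_gt0. Qed.

Lemma lint_invl : L^-1 \isn't a lint l.
Proof.
apply/negP => h; have e : numq L^-1 * l%:Z = denq L^-1.
  apply: (@intr_inj rat); rewrite rmorphM /= numqE -[(l%:Z)%:~R]/L.
  by rewrite -mulrA mulrC -mulrA mulfV ?mulr1 // lprime_neq0.
move: h; rewrite -[_ \is a _]/(coprime l `|denq L^-1|%N) -e abszM.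
by rewrite coprimeMr andbC /coprime gcdnn; case: eqP l_pr => // ->.
Qed.

Lemma lint_dichotomy (x : rat) :
  x != 0 -> x / L \is a lint l \/ x^-1 \is a lint l.
Proof.
move=> x0; have xE : x = (numq x)%:~R / (denq x)%:~R by rewrite divq_num_den.
have [lx|lx] := boolP (l %| `|numq x|)%N.
  left; have /dvdzP[k kE] : (l %| numq x)%Z by [].
  have -> : x / L = k%:~R / (denq x)%:~R.
    rewrite {1}xE kE rmorphM /= -[(l%:Z)%:~R]/L; field.
    by rewrite lprime_neq0 intr_eq0 denq_neq0.
  apply: pintegral_frac; apply: coprime_dvdl lx _; exact: coprime_num_den.
right; rewrite xE invf_div; apply: pintegral_frac.
by rewrite prime_coprime.
Qed.

Lemma lint_not_div (x : rat) : x / L \is a lint l -> x^-1 \is a lint l -> x = 0.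
Proof.
have [-> //|x0] := eqVneq x 0; move=> h1 h2; have := rpredM h1 h2.
by rewrite mulrAC mulfV // mul1r (negPf lint_invl).
Qed.

Lemma lint_div (x : rat) : x / L \is a lint l -> x \is a lint l.
Proof.
move=> h; rewrite -(divfK lprime_neq0 x) rpredM //; exact: (lint_int l%:Z).
Qed.

Lemma lint_approx (r : rat) :
  r \is a lint l -> exists r0 : int, (r0%:~R - r) / L \is a lint l.
Proof.
move=> rl; have rE : r = (numq r)%:~R / (denq r)%:~R by rewrite divq_num_den.
have [[u v] /= uv] : exists uv : int * int, uv.1 * denq r + uv.2 * l%:Z = 1.
  by apply/coprimezP; rewrite /coprimez -[_ == _]/(coprime `|denq r|%N l) coprime_sym.
exists (numq r * u).
have -> : ((numq r * u)%:~R - r) / L = (- (numq r * v))%:~R / (denq r)%:~R.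
  have uvR : u%:~R * (denq r)%:~R = 1 - v%:~R * L :> rat.
    apply: (canRL (addrK _)); have := congr1 (fun n : int => n%:~R : rat) uv.
    by rewrite rmorphD !rmorphM.
  have d0 : (denq r)%:~R != 0 :> rat by rewrite intr_eq0 denq_neq0.
  rewrite {2}rE; apply: (mulIf d0); apply: (mulIf lprime_neq0).
  rewrite mulrAC divfK ?lprime_neq0 // divfK // mulrBl divfK //.
  rewrite !rmorphM rmorphN rmorphM /= -mulrA uvR; ring.
by apply: pintegral_frac.
Qed.

(** The rational root theorem, localized at l. *)
Lemma lint_root (G : {poly rat}) (r : rat) :
  G \is a polyOver (lint l) -> (1 < size G)%N -> (lead_coef G)^-1 \is a lint l ->
  G.[r] \is a lint l -> r \is a lint l.
Proof.
move=> GL sG leadG Gr; apply/idPn => rl.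
have r0 : r != 0 by apply: contraNneq rl => ->; rewrite rpred0.
have rV0 : r^-1 != 0 by rewrite invr_eq0.
have [sl|] := lint_dichotomy rV0.
  have lead0 : lead_coef G != 0 by rewrite lead_coef_eq0 -size_poly_gt0 ltnW.
  suff : lead_coef G / L \is a lint l.
    by move=> /lint_not_div/(_ leadG)/eqP; apply/negP.
  have [n sE] : exists n, size G = n.+2 by case: (size G) sG => [|[|n]] // _; exists n.
  have -> : lead_coef G / L = G.[r] * r^-1 ^+ n * (r^-1 / L)
     - \sum_(i < n.+1) G`_i * r^-1 ^+ (n - i) * (r^-1 / L).
    rewrite horner_coef sE big_ord_recr /= lead_coefE sE /= mulrDl mulrDl.
    rewrite -!mulr_suml addrAC !mulr_suml -sumrB big1 ?add0r => [|i _].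
      by rewrite exprVn exprS; field; rewrite r0 lprime_neq0 expf_neq0.
    have -> : r^-1 ^+ n = r^-1 ^+ (n - i) * r^-1 ^+ i.
      by rewrite -exprD subnK // -ltnS.
    have -> : G`_i * r ^+ i * (r^-1 ^+ (n - i) * r^-1 ^+ i)
       = G`_i * r^-1 ^+ (n - i) * (r * r^-1) ^+ i by rewrite exprMn; ring.
    by rewrite mulfV // expr1n mulr1 subrr.
  have rV : r^-1 \is a lint l by apply: lint_div.
  apply: rpredB; first by rewrite rpredM // rpredM // rpredX.
  apply: rpred_sum => i _; rewrite rpredM // rpredM ?rpredX //.
  exact: (polyOverP GL).
by rewrite invrK (negPf rl).
Qed.

End Local.

Lemma int_of_lint (x : rat) : (forall l, prime l -> x \is a lint l) -> x \is a Num.int.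
Proof.
move=> xl; suff d1 : denq x = 1 by rewrite -[x]divq_num_den d1 divr1 intr_int.
have [|d1] := leqP `|denq x| 1; first by case: (denq x) (denq_gt0 x) => // -[|[]].
have := xl _ (pdiv_prime d1); rewrite -[_ \is a _]/(coprime _ _).
by rewrite prime_coprime ?pdiv_prime // pdiv_dvd.
Qed.

(** * From local models to a global one *)

(** For G of degree n, the division by c^n keeps the leading coefficient. *)
Definition rescale (n : nat) (c r : rat) (G : {poly rat}) : {poly rat} :=
  c ^- n *: (G \Po (c *: 'X + r%:P)).

Lemma rescale_comp n a b c r G :
  rescale n a b (rescale n c r G) = rescale n (c * a) (c * b + r) G.
Proof.
rewrite /rescale comp_polyZ scalerA -invfM -exprMn (mulrC a); congr (_ *: _).
rewrite -comp_polyA comp_polyD comp_polyZ comp_polyX comp_polyC.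
rewrite -!mul_polyC polyCD !polyCM. congr (_ \Po _); ring.
Qed.

Lemma rescale0_coef n c G i : (rescale n c 0 G)`_i = c ^- n * (G`_i * c ^+ i).
Proof.
rewrite /rescale addr0 coefZ; congr (_ * _).
rewrite comp_polyE coef_sum.
under eq_bigr => j _ do rewrite exprZn !coefZ coefXn.
have [iG|iG] := ltnP i (size G); last first.
  rewrite [in RHS]nth_default // mul0r big1 // => j _.
  by rewrite (gtn_eqF (leq_trans (ltn_ord j) iG)) !mulr0.
rewrite (bigD1 (Ordinal iG)) //= eqxx mulr1 big1 ?addr0 // => j ji.
by rewrite eq_sym (negPf (ji : (j != i :> nat))) !mulr0.
Qed.

Lemma size_rescale n (c r : rat) (G : {poly rat}) : c != 0 -> size (rescale n c r G) = size G.
Proof.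
move=> c0; rewrite /rescale size_scale ?invr_eq0 ?expf_neq0 // size_comp_poly2 //.
by rewrite size_addl size_scale // size_polyX // size_polyC; case: eqP.
Qed.

Lemma lead_coef_rescale n (c r : rat) (G : {poly rat}) : c != 0 -> size G = n.+1 ->
  lead_coef (rescale n c r G) = lead_coef G.
Proof.
move=> c0 sG; have sL : size (c *: 'X + r%:P) = 2.
  by rewrite size_addl size_scale // size_polyX // size_polyC; case: eqP.
rewrite /rescale lead_coefZ lead_coef_comp ?sL // lead_coefDl; last first.
  by rewrite size_scale // size_polyX size_polyC; case: eqP.
by rewrite lead_coefZ lead_coefX mulr1 sG /= mulrCA mulVf ?mulr1 // expf_neq0.
Qed.

Lemma rescale_root n (c r : rat) (G : {poly rat}) (x : rat) : c != 0 ->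
  root (rescale n c r G) x = root G (c * x + r).
Proof.
move=> c0; rewrite /root hornerZ horner_comp !hornerE.
by rewrite mulf_eq0 invr_eq0 expf_eq0 (negPf c0) andbF.
Qed.

(** Let c and r give a model whose invariant is a unit at l. Since the invariant
    of G is divisible by l, so is c; hence r is l-integral, scaling by l around
    r is already integral at l, and r may be replaced by an integer congruent to
    it modulo l, which preserves integrality at the other primes. *)
Lemma rescale_step (l n m : nat) (G : {poly rat}) (D : {poly rat} -> rat) (z : int) :
  prime l -> (0 < n)%N -> size G = n.+1 ->
  G \is a polyOver Num.int -> (lead_coef G)^-1 \is a lint l ->
  (forall c r, c != 0 -> D (rescale n c r G) = c ^- m * D G) ->
  D G = z%:~R -> z != 0 -> (l %| z)%Z ->
  (exists c r, [/\ c != 0, rescale n c r G \is a polyOver (lint l) &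
                   (D (rescale n c r G))^-1 \is a lint l]) ->
  exists r, rescale n l%:R r G \is a polyOver Num.int.
Proof.
move=> pl n0 sG Gint lead scaleD Dz z0 lz [c [r [c0 Hl Hu]]].
have l0 := lprime_neq0 pl; set H := rescale n c r G in Hl Hu *.
have Gl l' : G \is a polyOver (lint l').
  by apply/polyOverP => i; apply: pintegral_int; exact: (polyOverP Gint).
have cl : c / l%:R \is a lint l.
  have [//|cV] := lint_dichotomy pl c0; exfalso.
  have DH : D H / l%:R \is a lint l.
    rewrite scaleD // -exprVn -mulrA rpredM ?rpredX // Dz.
    have /dvdzP[k ->] := lz; rewrite rmorphM /= -[(l%:Z)%:~R]/(l%:R) mulfK //.
    exact: lint_int.
  have /eqP := lint_not_div pl DH Hu.
  by rewrite scaleD // Dz mulf_eq0 invr_eq0 expf_eq0 (negPf c0) andbF intr_eq0 (negPf z0).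
have rl : r \is a lint l.
  apply: (lint_root pl (Gl l) _ lead); first by rewrite sG.
  have -> : G.[r] = c ^+ n * H.[0].
    by rewrite /H hornerZ horner_comp !hornerE /= mulfV ?mul1r // expf_neq0.
  by rewrite rpredM ?rpredX ?(lint_div pl cl) // rpred_horner // rpred0.
have [r0 r0E] := lint_approx pl rl; exists r0%:~R.
have lrG : rescale n l%:R r G \is a polyOver (lint l).
  have -> : rescale n l%:R r G = rescale n (l%:R / c) 0 H.
    by rewrite /H rescale_comp mulr0 add0r mulrC divfK.
  apply/polyOverP => i; rewrite rescale0_coef -exprVn invf_div.
  have [iG|iG] := leqP i n; last first.
    by rewrite nth_default ?mul0r ?mulr0 ?rpred0 // size_rescale // sG.
  have -> : (c / l%:R) ^+ n = (c / l%:R) ^+ (n - i) * (c / l%:R) ^+ i.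
    by rewrite -exprD subnK.
  rewrite mulrACA -exprMn (_ : c / l%:R * (l%:R / c) = 1) ?expr1n ?mulr1; last first.
    by field; rewrite c0 l0.
  by rewrite rpredM ?rpredX // (polyOverP Hl).
apply/polyOverP => i; apply: int_of_lint => l' pl'.
have [->|ll'] := eqVneq l' l.
  have -> : rescale n l%:R r0%:~R G
     = rescale n 1 ((r0%:~R - r) / l%:R) (rescale n l%:R r G).
    by rewrite rescale_comp mulr1 mulrC divfK // subrK.
  move: i; apply/polyOverP; rewrite /rescale expr1n invr1 scale1r scale1r.
  by rewrite polyOver_comp // rpredD ?polyOverX // polyOverC.
move: i; apply/polyOverP; rewrite polyOverZ //.
  rewrite -exprVn rpredX // (_ : l%:R^-1 = 1%:~R / (l%:Z)%:~R); last by rewrite mul1r.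
  by apply: pintegral_frac; rewrite prime_coprime // dvdn_prime2.
apply: polyOver_comp; first exact: Gl.
apply: rpredD; last by rewrite polyOverC lint_int.
by apply: polyOverZ; [exact: (lint_int l' l%:Z) | exact: polyOverX].
Qed.

(** An integral model whose invariant is minimal in absolute value cannot be
    improved at any prime other than p, so its invariant has no such prime
    factor. *)
Theorem global_model (p e n m : nat) (F : {poly rat}) (D : {poly rat} -> rat) :
  prime p -> (0 < n)%N -> (0 < m)%N -> size F = n.+1 -> lead_coef F = (p ^ e)%:R ->
  D F != 0 ->
  (forall (c r : rat) (G : {poly rat}), c != 0 -> size G = n.+1 -> D (rescale n c r G) = c ^- m * D G) ->
  (forall G : {poly rat}, size G = n.+1 -> G \is a polyOver Num.int -> D G \is a Num.int) ->
  (forall l, prime l -> l != p ->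
    exists c r, [/\ c != 0, rescale n c r F \is a polyOver (lint l) &
                    (D (rescale n c r F))^-1 \is a lint l]) ->
  exists c r z k, [/\ c != 0, rescale n c r F \is a polyOver Num.int,
    D (rescale n c r F) = z%:~R & absz z = (p ^ k)%N].
Proof.
move=> pp n0 m0 sF leadF DF scaleD intD locF.
have descent N : forall (c r : rat) (z : int), c != 0 -> rescale n c r F \is a polyOver Num.int ->
    D (rescale n c r F) = z%:~R -> (absz z < N)%N ->
    exists c r z k, [/\ c != 0, rescale n c r F \is a polyOver Num.int,
      D (rescale n c r F) = z%:~R & absz z = (p ^ k)%N].
  elim: N => // N IH c r z c0 Gint Dz zN; set G := rescale n c r F in Gint Dz.
  have sG : size G = n.+1 by rewrite size_rescale.
  have z0 : z != 0.
    by move: DF; apply: contraNneq => z0; move: Dz; rewrite scaleD // z0 => /eqP;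
      rewrite mulf_eq0 invr_eq0 expf_eq0 (negPf c0) andbF.
  have z0' : (0 < absz z)%N by rewrite absz_gt0.
  have [zp|/pdiv_prime] := leqP (absz z)`_p^' 1.
    exists c, r, z, (logn p (absz z)); split=> //.
    rewrite -{1}(@partnC p (absz z)) // p_part (_ : (_`_p^' = 1)%N) ?muln1 //.
    by apply/eqP; rewrite eqn_leq zp part_gt0.
  set l := pdiv _ => pl; have lpart : (l %| (absz z)`_p^')%N by exact: pdiv_dvd.
  have lp : l != p.
    by have := pnat_dvd lpart (part_pnat _ _); rewrite pnatE // !inE.
  have lz : (l %| z)%Z by rewrite dvdzE; apply: dvdn_trans lpart (dvdn_part _ _).
  have leadG : (lead_coef G)^-1 \is a lint l.
    rewrite lead_coef_rescale // leadF -[(_ ^ _)%:R]/(((p ^ e)%N : int)%:~R).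
    rewrite -[_^-1]mul1r -[1]/(1%:~R); apply: pintegral_frac.
    by rewrite coprimeXr // prime_coprime // dvdn_prime2.
  have locG : exists c r, [/\ c != 0, rescale n c r G \is a polyOver (lint l) &
                   (D (rescale n c r G))^-1 \is a lint l].
    have [c1 [r1 [c10 h1 h2]]] := locF l pl lp.
    have e1 : rescale n (c1 / c) ((r1 - r) / c) G = rescale n c1 r1 F.
      by rewrite rescale_comp !(mulrC c) !divfK // subrK.
    by exists (c1 / c), ((r1 - r) / c); rewrite e1 mulf_neq0 ?invr_eq0.
  have scaleG a b : a != 0 -> D (rescale n a b G) = a ^- m * D G.
    by move=> a0; apply: scaleD.
  have [r1 h1] := rescale_step pl n0 sG Gint leadG scaleG Dz z0 lz locG.
  have l0 := lprime_neq0 pl.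
  have [z1 z1E] : exists z1 : int, D (rescale n l%:R r1 G) = z1%:~R.
    by apply/intrP; apply: intD => //; rewrite size_rescale.
  have zz1 : z = z1 * (l ^ m)%N.
    apply: (@intr_inj rat); rewrite rmorphM /= -z1E scaleG // Dz.
    by rewrite -[((l ^ m)%N : int)%:~R]/((l ^ m)%:R) natrX mulrAC mulVf ?mul1r // expf_neq0.
  move: h1 z1E; rewrite rescale_comp => h1 z1E.
  apply: (IH _ _ _ _ h1 z1E); first by rewrite mulf_neq0.
  have z10 : (0 < absz z1)%N by rewrite absz_gt0; apply: contraNneq z0 => z10; rewrite zz1 z10 mul0r.
  apply: leq_trans (_ : (absz z1 < absz z)%N) _ => //.
  by rewrite zz1 abszM ltn_Pmulr // -{1}(expn0 l) ltn_exp2l // prime_gt1.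
pose M : int := \prod_(i < n.+1) denq F`_i.
have M0 : M%:~R != 0 :> rat.
  by rewrite intr_eq0; apply/prodf_neq0 => i _; exact: denq_neq0.
have Mint i : (i <= n)%N -> F`_i * M%:~R \is a Num.int.
  rewrite -ltnS => iN; rewrite /M (bigD1 (Ordinal iN)) //= rmorphM /= mulrA.
  by rewrite -numqE rpredM // intr_int.
have F0int : rescale n (M%:~R^-1) 0 F \is a polyOver Num.int.
  apply/polyOverP => i; rewrite rescale0_coef.
  have [iN|iN] := leqP i n; last first.
    by rewrite nth_default ?mul0r ?mulr0 ?rpred0 // sF.
  have -> : M%:~R^-1 ^- n * (F`_i * M%:~R^-1 ^+ i) = F`_i * M%:~R ^+ (n - i).
    rewrite -exprVn invrK -{1}(subnK iN) exprD mulrC -mulrA; congr (_ * _).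
    by rewrite mulrCA -exprMn mulVf // expr1n mulr1.
  have [nE|] := eqVneq i n.
    by rewrite nE subnn mulr1 -[n]/(n.+1.-1) -sF -lead_coefE leadF natr_int.
  move=> iN'; have -> : (n - i = (n - i).-1.+1)%N by rewrite prednK // subn_gt0 ltn_neqAle iN'.
  by rewrite exprS mulrA rpredM ?Mint // rpredX // intr_int.
have MV0 : M%:~R^-1 != 0 :> rat by rewrite invr_eq0.
have [z zE] : exists z : int, D (rescale n M%:~R^-1 0 F) = z%:~R.
  by apply/intrP; apply: intD => //; rewrite size_rescale.
exact: (descent _ _ _ _ MV0 F0int zE (ltnSn _)).
Qed.

(** * Reduction modulo a prime *)

Definition lrat (l : nat) := {x : rat | x \in lint_pred l}.
HB.instance Definition _ (l : nat) := [isSub of lrat l for @sval rat _].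
HB.instance Definition _ (l : nat) := [Choice of lrat l by <:].
HB.instance Definition _ (l : nat) := [SubChoice_isSubComNzRing of lrat l by <:].

Section Reduction.
Variables (l : nat) (l_pr : prime l).

Lemma intr_Fp_eq0 (n : int) : (n%:~R == 0 :> 'F_l) = (l %| `|n|)%N.
Proof.
have h k : (k%:R == 0 :> 'F_l) = (l %| k)%N by rewrite (dvdn_pcharf (pchar_Fp l_pr)).
by case: n => n; rewrite ?NegzE ?rmorphN ?oppr_eq0 ?abszN; exact: h.
Qed.

Lemma intr_Fp_neq0 (n : int) : coprime l `|n|%N -> n%:~R != 0 :> 'F_l.
Proof. by rewrite intr_Fp_eq0 prime_coprime. Qed.

Lemma ratr_frac (m d : int) : coprime l `|d|%N ->
  ratr (m%:~R / d%:~R) = m%:~R / d%:~R :> 'F_l.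
Proof.
move=> ld; have d0 : d != 0.
  by apply: contraTneq ld => ->; rewrite /coprime absz0 gcdn0; case: l l_pr => [|[]].
have x_int := pintegral_frac m ld; set x : rat := _ / _ in x_int *.
have e : numq x * d = m * denq x.
  by apply: (@intr_inj rat); rewrite !rmorphM /= numqE /x mulrAC divfK ?intr_eq0.
rewrite /ratr; apply/eqP; rewrite eqr_div ?intr_Fp_neq0 //.
by rewrite -!rmorphM e.
Qed.

Definition red (x : lrat l) : 'F_l := ratr (val x).

Let valE (x : lrat l) : val x = (numq (val x))%:~R / (denq (val x))%:~R.
Proof. by rewrite divq_num_den. Qed.
Let den_coprime (x : lrat l) : coprime l `|denq (val x)|%N.
Proof. exact: (valP x). Qed.
Let den_neq0 (x : rat) : (denq x)%:~R != 0 :> rat.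
Proof. by rewrite intr_eq0 denq_neq0. Qed.

Lemma red_zmod : zmod_morphism red.
Proof.
move=> x y; rewrite /red rmorphB /=.
have -> : val x - val y = (numq (val x) * denq (val y) - numq (val y) * denq (val x))%:~R
    / (denq (val x) * denq (val y))%:~R.
  rewrite {1}(valE x) {1}(valE y) rmorphB !rmorphM /=; field.
  by rewrite !den_neq0.
rewrite ratr_frac ?abszM ?coprimeMr ?den_coprime // /ratr rmorphB !rmorphM /=.
by rewrite -[in RHS]mulNr addf_div ?intr_Fp_neq0 ?den_coprime ?mulNr.
Qed.

Lemma red_monoid : monoid_morphism red.
Proof.
split=> [|x y]; rewrite /red ?rmorph1 ?rmorphM /=.
  by rewrite -[1]divr1 -[1]/(1%:~R) ratr_frac ?coprimen1 // divr1.
have -> : val x * val y = (numq (val x) * numq (val y))%:~R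
    / (denq (val x) * denq (val y))%:~R.
  rewrite {1}(valE x) {1}(valE y) !rmorphM /=; field.
  by rewrite !den_neq0.
by rewrite ratr_frac ?abszM ?coprimeMr ?den_coprime // /ratr !rmorphM /= mulf_div.
Qed.

End Reduction.

Section RedMorphism.
Variables (l : nat) (l_pr : prime l).

(** The proof of primality is an argument because the structure of ring morphism
    depends on it. *)
Definition redm & prime l := @red l.
HB.instance Definition _ := GRing.isZmodMorphism.Build (lrat l) 'F_l (redm l_pr) (red_zmod l_pr).
HB.instance Definition _ := GRing.isMonoidMorphism.Build (lrat l) 'F_l (redm l_pr) (red_monoid l_pr).

Lemma redm_eq0 (x : lrat l) : redm l_pr x != 0 -> (val x)^-1 \is a lint l.
Proof.
move=> h; have x0 : val x != 0.
  by apply: contraNneq h => x0; rewrite (_ : x = 0) ?rmorph0 //; apply: val_inj; rewrite x0.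
have [xl|//] := lint_dichotomy l_pr x0.
pose y : lrat l := Sub (val x / l%:R) xl.
have xE : x = y * l%:R.
  by apply: val_inj; rewrite rmorphM rmorph_nat; apply/esym/divfK/lprime_neq0.
by move: h; rewrite xE rmorphM rmorph_nat pchar_Fp_0 // mulr0 eqxx.
Qed.
End RedMorphism.

(** * Cubic and quartic division polynomials *)

Section Polys.
Variable R : comNzRingType.

Definition cubic_poly (a b c d : R) : {poly R} :=
  a%:P * 'X^3 + b%:P * 'X^2 + c%:P * 'X + d%:P.
Definition quartic_poly (a b c d e : R) : {poly R} :=
  a%:P * 'X^4 + b%:P * 'X^3 + c%:P * 'X^2 + d%:P * 'X + e%:P.

Lemma cubic_poly_coef a b c d i :
  (cubic_poly a b c d)`_i = nth 0 [:: d; c; b; a] i.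
Proof.
rewrite /cubic_poly !coefD !coefCM !coefXn coefX coefC.
by case: i => [|[|[|[|i]]]] /=; rewrite ?nth_nil !(mulr0, mulr1, addr0, add0r).
Qed.

Lemma quartic_poly_coef a b c d e i :
  (quartic_poly a b c d e)`_i = nth 0 [:: e; d; c; b; a] i.
Proof.
rewrite /quartic_poly !coefD !coefCM !coefXn coefX coefC.
by case: i => [|[|[|[|[|i]]]]] /=; rewrite ?nth_nil !(mulr0, mulr1, addr0, add0r).
Qed.

Lemma cubic_poly_eta (G : {poly R}) : (size G <= 4)%N ->
  G = cubic_poly G`_3 G`_2 G`_1 G`_0.
Proof.
move=> sG; apply/polyP => i; rewrite cubic_poly_coef.
by case: i => [|[|[|[|i]]]] //=; rewrite nth_nil nth_default // (leq_trans sG).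
Qed.

Lemma quartic_poly_eta (G : {poly R}) : (size G <= 5)%N ->
  G = quartic_poly G`_4 G`_3 G`_2 G`_1 G`_0.
Proof.
move=> sG; apply/polyP => i; rewrite quartic_poly_coef.
by case: i => [|[|[|[|[|i]]]]] //=; rewrite nth_nil nth_default // (leq_trans sG).
Qed.

Lemma size_cubic_poly a b c d : a != 0 -> size (cubic_poly a b c d) = 4.
Proof.
move=> a0; apply/eqP; rewrite eqn_leq; apply/andP; split.
  by apply/leq_sizeP => -[|[|[|[|i]]]] // _; rewrite cubic_poly_coef /= nth_nil.
by rewrite ltnNge; apply: contra a0 => /leq_sizeP/(_ 3%N (leqnn _)); rewrite cubic_poly_coef /= => ->.
Qed.

Lemma size_quartic_poly a b c d e : a != 0 -> size (quartic_poly a b c d e) = 5.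
Proof.
move=> a0; apply/eqP; rewrite eqn_leq; apply/andP; split.
  by apply/leq_sizeP => -[|[|[|[|[|i]]]]] // _; rewrite quartic_poly_coef /= nth_nil.
by rewrite ltnNge; apply: contra a0 => /leq_sizeP/(_ 4%N (leqnn _)); rewrite quartic_poly_coef /= => ->.
Qed.

Lemma horner_cubic_poly a b c d x :
  (cubic_poly a b c d).[x] = a * x ^+ 3 + b * x ^+ 2 + c * x + d.
Proof. by rewrite /cubic_poly !hornerE. Qed.

Lemma horner_quartic_poly a b c d e x :
  (quartic_poly a b c d e).[x] = a * x ^+ 4 + b * x ^+ 3 + c * x ^+ 2 + d * x + e.
Proof. by rewrite /quartic_poly !hornerE. Qed.

(** The classical invariants I and J of the quartic form with the coefficients
    of G. *)
Definition quartic_I (G : {poly R}) : R :=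
  12 * G`_4 * G`_0 - 3 * G`_3 * G`_1 + G`_2 ^+ 2.
Definition quartic_J (G : {poly R}) : R :=
  72 * G`_4 * G`_2 * G`_0 + 9 * G`_3 * G`_2 * G`_1 - 27 * G`_4 * G`_1 ^+ 2
  - 27 * G`_0 * G`_3 ^+ 2 - 2 * G`_2 ^+ 3.
Definition poly_disc3 (G : {poly R}) : R := cubic_disc G`_3 G`_2 G`_1 G`_0.
End Polys.

Lemma map_cubic_poly (R S : comNzRingType) (f : {rmorphism R -> S}) a b c d :
  map_poly f (cubic_poly a b c d) = cubic_poly (f a) (f b) (f c) (f d).
Proof.
by apply/polyP => i; rewrite coef_map !cubic_poly_coef; case: i => [|[|[|[|i]]]] //=; rewrite !nth_nil rmorph0.
Qed.

Lemma map_quartic_poly (R S : comNzRingType) (f : {rmorphism R -> S}) a b c d e :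
  map_poly f (quartic_poly a b c d e) = quartic_poly (f a) (f b) (f c) (f d) (f e).
Proof.
by apply/polyP => i; rewrite coef_map !quartic_poly_coef; case: i => [|[|[|[|[|i]]]]] //=; rewrite !nth_nil rmorph0.
Qed.

Lemma rescale_cubic (l r a b c d : rat) : l != 0 ->
  rescale 3 l r (cubic_poly a b c d) = cubic_poly a ((3 * a * r + b) / l)
    ((3 * a * r ^+ 2 + 2 * b * r + c) / l ^+ 2)
    ((a * r ^+ 3 + b * r ^+ 2 + c * r + d) / l ^+ 3).
Proof.
move=> l0; rewrite /rescale; have -> : (cubic_poly a b c d \Po (l *: 'X + r%:P)) = l ^+ 3 *:
  cubic_poly a ((3 * a * r + b) / l) ((3 * a * r ^+ 2 + 2 * b * r + c) / l ^+ 2)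
    ((a * r ^+ 3 + b * r ^+ 2 + c * r + d) / l ^+ 3) :> {poly rat}.
  rewrite [cubic_poly a b c d \Po _](_ : _ = cubic_poly (a * l ^+ 3) ((3 * a * r + b) * l ^+ 2)
    ((3 * a * r ^+ 2 + 2 * b * r + c) * l) (a * r ^+ 3 + b * r ^+ 2 + c * r + d)).
    apply/polyP => i; rewrite coefZ !cubic_poly_coef.
    by case: i => [|[|[|[|i]]]] /=; rewrite ?nth_nil ?mulr0 //; field.
  rewrite /cubic_poly !comp_polyD !comp_polyM !comp_polyC !comp_polyX -mul_polyC.
  by ring.
by rewrite scalerA mulVf ?scale1r // expf_neq0.
Qed.

Lemma rescale_quartic (l r a b c d e : rat) : l != 0 ->
  rescale 4 l r (quartic_poly a b c d e) = quartic_poly a ((4 * a * r + b) / l)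
    ((6 * a * r ^+ 2 + 3 * b * r + c) / l ^+ 2)
    ((4 * a * r ^+ 3 + 3 * b * r ^+ 2 + 2 * c * r + d) / l ^+ 3)
    ((a * r ^+ 4 + b * r ^+ 3 + c * r ^+ 2 + d * r + e) / l ^+ 4).
Proof.
move=> l0; rewrite /rescale.
have -> : (quartic_poly a b c d e \Po (l *: 'X + r%:P)) = l ^+ 4 *:
  quartic_poly a ((4 * a * r + b) / l) ((6 * a * r ^+ 2 + 3 * b * r + c) / l ^+ 2)
    ((4 * a * r ^+ 3 + 3 * b * r ^+ 2 + 2 * c * r + d) / l ^+ 3)
    ((a * r ^+ 4 + b * r ^+ 3 + c * r ^+ 2 + d * r + e) / l ^+ 4) :> {poly rat}.
  rewrite [quartic_poly a b c d e \Po _](_ : _ = quartic_poly (a * l ^+ 4)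
    ((4 * a * r + b) * l ^+ 3) ((6 * a * r ^+ 2 + 3 * b * r + c) * l ^+ 2)
    ((4 * a * r ^+ 3 + 3 * b * r ^+ 2 + 2 * c * r + d) * l)
    (a * r ^+ 4 + b * r ^+ 3 + c * r ^+ 2 + d * r + e)).
    apply/polyP => i; rewrite coefZ !quartic_poly_coef.
    by case: i => [|[|[|[|[|i]]]]] /=; rewrite ?nth_nil ?mulr0 //; field.
  rewrite /quartic_poly !comp_polyD !comp_polyM !comp_polyC !comp_polyX -mul_polyC.
  by ring.
by rewrite scalerA mulVf ?scale1r // expf_neq0.
Qed.

Lemma poly_disc3_rescale (l r : rat) (G : {poly rat}) : l != 0 -> size G = 4 ->
  poly_disc3 (rescale 3 l r G) = l ^- 6 * poly_disc3 G.
Proof.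
move=> l0 sG; rewrite (@cubic_poly_eta _ G) ?sG // rescale_cubic //.
rewrite /poly_disc3 !cubic_poly_coef /= /cubic_disc.
by move: G`_3 G`_2 G`_1 G`_0 => a b c d; field.
Qed.

Lemma quartic_I_rescale (l r : rat) (G : {poly rat}) : l != 0 -> size G = 5 ->
  quartic_I (rescale 4 l r G) = l ^- 4 * quartic_I G.
Proof.
move=> l0 sG; rewrite (@quartic_poly_eta _ G) ?sG // rescale_quartic //.
rewrite /quartic_I !quartic_poly_coef /=.
by move: G`_4 G`_3 G`_2 G`_1 G`_0 => a b c d e; field.
Qed.

Lemma quartic_J_rescale (l r : rat) (G : {poly rat}) : l != 0 -> size G = 5 ->
  quartic_J (rescale 4 l r G) = l ^- 6 * quartic_J G.
Proof.
move=> l0 sG; rewrite (@quartic_poly_eta _ G) ?sG // rescale_quartic //.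
rewrite /quartic_J !quartic_poly_coef /=.
by move: G`_4 G`_3 G`_2 G`_1 G`_0 => a b c d e; field.
Qed.

Lemma poly_disc3_map (R S : comNzRingType) (f : {rmorphism R -> S}) (G : {poly R}) :
  poly_disc3 (map_poly f G) = f (poly_disc3 G).
Proof.
rewrite /poly_disc3 !coef_map /=; move: G`_3 G`_2 G`_1 G`_0 => a b c d.
by rewrite /cubic_disc; ring.
Qed.

Lemma quartic_J_map (R S : comNzRingType) (f : {rmorphism R -> S}) (G : {poly R}) :
  quartic_J (map_poly f G) = f (quartic_J G).
Proof.
rewrite /quartic_J !coef_map /=; move: G`_4 G`_3 G`_2 G`_1 G`_0 => a b c d e; ring.
Qed.

Lemma quartic_I_map (R S : comNzRingType) (f : {rmorphism R -> S}) (G : {poly R}) :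
  quartic_I (map_poly f G) = f (quartic_I G).
Proof.
rewrite /quartic_I !coef_map /=; move: G`_4 G`_3 G`_2 G`_1 G`_0 => a b c d e; ring.
Qed.

Lemma int_poly (G : {poly rat}) : G \is a polyOver Num.int ->
  exists H : {poly int}, G = map_poly intr H.
Proof.
move=> /polyOverP Gint; exists (map_poly Num.floor G).
apply/polyP => i; rewrite coef_map /= coef_map_id0 ?floor0 //.
by rewrite floorK.
Qed.

Section BInvariants.
Variables (R : comNzRingType) (W : weierstrass R).
Definition b2 : R := wa1 W ^+ 2 + 4 * wa2 W.
Definition b4 : R := 2 * wa4 W + wa1 W * wa3 W.
Definition b6 : R := wa3 W ^+ 2 + 4 * wa6 W.
Definition b8 : R := wa1 W ^+ 2 * wa6 W + 4 * wa2 W * wa6 W - wa1 W * wa3 W * wa4 W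
            + wa2 W * wa3 W ^+ 2 - wa4 W ^+ 2.
Definition wdisc : R := - b2 ^+ 2 * b8 - 8 * b4 ^+ 3 - 27 * b6 ^+ 2 + 9 * b2 * b4 * b6.

(** Its roots are the abscissas of the points of order 2. *)
Definition two_poly : {poly R} := cubic_poly 4 b2 (2 * b4) b6.
(** Its roots are the abscissas of the points of order 3. *)
Definition three_poly : {poly R} := quartic_poly 3 b2 (3 * b4) (3 * b6) b8.

Lemma b8_rel : 4 * b8 = b2 * b6 - b4 ^+ 2.
Proof. by rewrite /b8 /b2 /b4 /b6; ring. Qed.

Lemma two_poly_disc : poly_disc3 two_poly = 16 * wdisc.
Proof.
rewrite /poly_disc3 !cubic_poly_coef /= /cubic_disc /wdisc.
have := b8_rel; move: b2 b4 b6 b8 => x y z t rel.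
have -> : 16 * (- x ^+ 2 * t - 8 * y ^+ 3 - 27 * z ^+ 2 + 9 * x * y * z)
  = - 4 * x ^+ 2 * (4 * t) + 16 * (- 8 * y ^+ 3 - 27 * z ^+ 2 + 9 * x * y * z) by ring.
by rewrite rel; ring.
Qed.

Lemma three_poly_I : quartic_I three_poly = 0.
Proof.
rewrite /quartic_I !quartic_poly_coef /=.
have := b8_rel; move: b2 b4 b6 b8 => x y z t rel.
have -> : 12 * 3 * t = 9 * (4 * t) by ring.
by rewrite rel; ring.
Qed.

Lemma three_poly_J : quartic_J three_poly = 27 * wdisc.
Proof.
rewrite /quartic_J !quartic_poly_coef /= /wdisc.
have := b8_rel; move: b2 b4 b6 b8 => x y z t rel.
have -> : 72 * 3 * (3 * y) * t = 162 * y * (4 * t) by ring.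
by rewrite rel; ring.
Qed.
End BInvariants.

Section Maps.
Variables (R S : comNzRingType) (f : {rmorphism R -> S}) (W : weierstrass R).
Lemma wdisc_map : wdisc (map_weierstrass f W) = f (wdisc W).
Proof. by rewrite /wdisc /b2 /b4 /b6 /b8 /=; ring. Qed.
Lemma two_poly_map : two_poly (map_weierstrass f W) = map_poly f (two_poly W).
Proof.
by rewrite map_cubic_poly /two_poly /b2 /b4 /b6 /=; congr cubic_poly; ring.
Qed.
Lemma three_poly_map : three_poly (map_weierstrass f W) = map_poly f (three_poly W).
Proof.
by rewrite map_quartic_poly /three_poly /b2 /b4 /b6 /b8 /=; congr quartic_poly; ring.
Qed.
End Maps.

Lemma two_poly_change (E : weierstrass rat) (u r s t : rat) : u != 0 ->
  two_poly (change_model E u r s t) = rescale 3 (u ^+ 2) r (two_poly E).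
Proof.
move=> u0; rewrite rescale_cubic ?expf_neq0 // /two_poly /b2 /b4 /b6 /=.
by congr cubic_poly; field.
Qed.

Lemma three_poly_change (E : weierstrass rat) (u r s t : rat) : u != 0 ->
  three_poly (change_model E u r s t) = rescale 4 (u ^+ 2) r (three_poly E).
Proof.
move=> u0; rewrite rescale_quartic ?expf_neq0 // /three_poly /b2 /b4 /b6 /b8 /=.
by congr quartic_poly; field.
Qed.

(** The minimal model has l-integral coefficients, so it lifts to the ring of
    l-integral rationals, on which reduction is a ring morphism. *)
Lemma good_model (E : weierstrass rat) (l : nat) (l_pr : prime l) :
  good_reduction l E -> exists (u r s t : rat) (W : weierstrass (lrat l)),
  [/\ u != 0, map_weierstrass val W = change_model E u r s t,
      reduction l E = map_weierstrass (redm l_pr) W &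
      redm l_pr (wdisc W) != 0].
Proof.
rewrite /good_reduction /reduction; set M := minimal_model l E.
have [[[u [r [s [t [u0 ME]]]]] /and5P[h1 h2 h3 h4 h6]] _] : is_minimal_model l E M.
  exact: projT2 (cid (minimal_model_exists l E)).
move=> good.
pose W : weierstrass (lrat l) := Weierstrass (Sub (wa1 M) h1) (Sub (wa2 M) h2)
  (Sub (wa3 M) h3) (Sub (wa4 M) h4) (Sub (wa6 M) h6).
have WM : map_weierstrass val W = M by rewrite /W /map_weierstrass /=; case: (M).
have red : map_weierstrass (ratr : rat -> 'F_l) M = map_weierstrass (redm l_pr) W.
  by rewrite -WM.
exists u, r, s, t, W; split=> //; first by rewrite WM.
by rewrite -wdisc_map -red.
Qed.

(** * Rational abscissas of points of order 2 and 3 *)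

Lemma lint_natV (l p e : nat) : prime l -> prime p -> l != p ->
  ((p ^ e)%:R : rat)^-1 \is a lint l.
Proof.
move=> pl pp lp; rewrite -[_^-1]mul1r.
apply: (@pintegral_frac l 1 ((p ^ e)%N : int)).
by rewrite coprimeXr // prime_coprime // dvdn_prime2.
Qed.

(** A zero of the homogenized form gives a root, since the leading coefficient
    excludes the zero at infinity. *)
Lemma cubic_pow2_root (H : {poly int}) (k : nat) :
  (size H <= 4)%N -> H`_3 = 4 -> absz (cubic_disc H`_3 H`_2 H`_1 H`_0) = (2 ^ k)%N ->
  exists z : rat, root (map_poly intr H) z.
Proof.
move=> sH H3 /cubic_pow2_zero[x [y [xy xyE]]].
have y0 : y != 0.
  apply: contraTneq xy => y0; move: xyE; rewrite y0 H3.
  rewrite (_ : cubic_form _ _ _ _ _ _ = 4 * x ^+ 3); last by rewrite /cubic_form; ring.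
  by move/eqP; rewrite mulf_eq0 expf_eq0 /= => /eqP ->; rewrite eqxx.
have y0R : y%:~R != 0 :> rat by rewrite intr_eq0.
exists (x%:~R / y%:~R).
rewrite {1}(cubic_poly_eta sH) map_cubic_poly /root horner_cubic_poly.
have := congr1 (fun n : int => n%:~R / y%:~R ^+ 3 : rat) xyE; rewrite mul0r => e.
by apply/eqP; rewrite -[RHS]e /cubic_form /=; field.
Qed.

Lemma quartic_pow3_root (H : {poly int}) (k : nat) :
  (size H <= 5)%N -> H`_4 = 3 -> quartic_I H = 0 -> absz (quartic_J H) = (3 ^ k)%N ->
  exists z : rat, root (map_poly intr H) z.
Proof.
move=> sH H4 HI HJ.
have [c' cE] : exists c', H`_2 = 3 * c'.
  have h2 : (3 %| H`_2 ^+ 2)%Z.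
    apply/dvdzP; exists (H`_3 * H`_1 - 4 * H`_4 * H`_0); move: HI; rewrite /quartic_I.
    by move: H`_4 H`_3 H`_2 H`_1 H`_0; clear => *; lia.
  have /dvdzP[c' ->] : (3 %| H`_2)%Z.
    by move: h2; rewrite !dvdzE abszX Euclid_dvdX // => /andP[].
  by exists c'; rewrite mulrC.
have rel : equianharmonic H`_4 H`_3 c' H`_1 H`_0.
  move: HI; rewrite /quartic_I /equianharmonic cE.
  by move: H`_4 H`_3 H`_1 H`_0; clear => *; lia.
have JE : quartic_J H = 27 * quartic_inv H`_4 H`_3 c' H`_1 H`_0.
  rewrite /quartic_J cE; move: rel; rewrite /equianharmonic /quartic_inv.
  move: H`_4 H`_3 H`_1 H`_0; clear => a b d e rel.
  have -> : 72 * a * (3 * c') * e = 54 * c' * (4 * a * e) by ring.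
  by rewrite rel; ring.
have [i _ ji] : exists2 i, (i <= k)%N & absz (quartic_inv H`_4 H`_3 c' H`_1 H`_0) = (3 ^ i)%N.
  by apply/dvdn_pfactor => //; rewrite -HJ JE abszM dvdn_mull.
have [x [y [xy xyE]]] := quartic_pow3_zero rel ji.
have y0 : y != 0.
  apply: contraTneq xy => y0; move: xyE; rewrite y0 H4.
  rewrite (_ : quartic_form _ _ _ _ _ _ _ = 3 * x ^+ 4); last by rewrite /quartic_form; ring.
  by move/eqP; rewrite mulf_eq0 expf_eq0 /= => /eqP ->; rewrite eqxx.
have y0R : y%:~R != 0 :> rat by rewrite intr_eq0.
exists (x%:~R / y%:~R).
rewrite {1}(quartic_poly_eta sH) map_quartic_poly /root horner_quartic_poly cE.
have := congr1 (fun n : int => n%:~R / y%:~R ^+ 4 : rat) xyE; rewrite mul0r => e.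
by apply/eqP; rewrite -[RHS]e /quartic_form /=; field.
Qed.

(** The discriminant of the 2-division polynomial is 16 times that of the curve,
    so in a good model it is a unit at every prime other than 2. *)
Lemma two_poly_rational_root (E : weierstrass rat) : nonsingular E ->
  (forall l, prime l -> l != 2%N -> good_reduction l E) ->
  exists x, root (two_poly E) x.
Proof.
move=> nsE good.
have sF (W : weierstrass rat) : size (two_poly W) = 4 by apply: size_cubic_poly.
have leadF : lead_coef (two_poly E) = (2 ^ 2)%:R.
  by rewrite lead_coefE sF cubic_poly_coef.
have [|||c [r [z [k [c0 Gint Dz zk]]]]] := @global_model 2 2 3 6 (two_poly E) (@poly_disc3 rat)
    isT isT isT (sF E) leadF _ poly_disc3_rescale.
- by rewrite two_poly_disc mulf_neq0.
- by move=> G _ /int_poly[H ->]; rewrite poly_disc3_map intr_int.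
- move=> l pl l2; have [u [r [s [t [W [u0 WE _ Wd]]]]]] := good_model pl (good l pl l2).
  exists (u ^+ 2), r; rewrite expf_neq0 // -(two_poly_change _ _ s t) // -WE two_poly_map.
  split=> //; first by apply/polyOverP => i; rewrite coef_map; exact: valP.
  rewrite -two_poly_map two_poly_disc wdisc_map invfM rpredM ?(redm_eq0 Wd) //.
  exact: (@lint_natV l 2 4).
have [H HE] := int_poly Gint; have sG : size (rescale 3 c r (two_poly E)) = 4.
  by rewrite size_rescale.
have H3 : H`_3 = 4.
  apply: (@intr_inj rat); rewrite -[LHS](coef_map intr) -HE /=.
  by have := @lead_coef_rescale 3 c r (two_poly E) c0 (sF E); rewrite lead_coefE sG leadF.
have Hd : absz (cubic_disc H`_3 H`_2 H`_1 H`_0) = (2 ^ k)%N.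
  rewrite -zk; congr absz; apply: (@intr_inj rat); rewrite -Dz HE poly_disc3_map.
  by [].
have sH : (size H <= 4)%N.
  by rewrite -(size_map_inj_poly (@intr_inj rat) (rmorph0 _)) -HE sG.
have [z' z'E] := cubic_pow2_root sH H3 Hd.
by exists (c * z' + r); rewrite -(rescale_root 3) // HE.
Qed.

(** For the 3-division polynomial I = 0, and J is 27 times the discriminant of
    the curve. *)
Lemma three_poly_rational_root (E : weierstrass rat) : nonsingular E ->
  (forall l, prime l -> l != 3%N -> good_reduction l E) ->
  exists x, root (three_poly E) x.
Proof.
move=> nsE good.
have sF (W : weierstrass rat) : size (three_poly W) = 5 by apply: size_quartic_poly.
have leadF : lead_coef (three_poly E) = (3 ^ 1)%:R.
  by rewrite lead_coefE sF quartic_poly_coef.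
have [|||c [r [z [k [c0 Gint Dz zk]]]]] := @global_model 3 1 4 6 (three_poly E) (@quartic_J rat)
    isT isT isT (sF E) leadF _ quartic_J_rescale.
- by rewrite three_poly_J mulf_neq0.
- by move=> G _ /int_poly[H ->]; rewrite quartic_J_map intr_int.
- move=> l pl l3; have [u [r [s [t [W [u0 WE _ Wd]]]]]] := good_model pl (good l pl l3).
  exists (u ^+ 2), r; rewrite expf_neq0 // -(three_poly_change _ _ s t) // -WE three_poly_map.
  split=> //; first by apply/polyOverP => i; rewrite coef_map; exact: valP.
  rewrite -three_poly_map three_poly_J wdisc_map invfM rpredM ?(redm_eq0 Wd) //.
  exact: (@lint_natV l 3 3).
have [H HE] := int_poly Gint; have sG : size (rescale 4 c r (three_poly E)) = 5.
  by rewrite size_rescale.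
have H4 : H`_4 = 3.
  apply: (@intr_inj rat); rewrite -[LHS](coef_map intr) -HE /=.
  by have := @lead_coef_rescale 4 c r (three_poly E) c0 (sF E); rewrite lead_coefE sG leadF.
have HI : quartic_I H = 0.
  apply: (@intr_inj rat); have := @quartic_I_rescale c r (three_poly E) c0 (sF E).
  by rewrite three_poly_I mulr0 HE quartic_I_map.
have HJ : absz (quartic_J H) = (3 ^ k)%N.
  by rewrite -zk; congr absz; apply: (@intr_inj rat); rewrite -Dz HE quartic_J_map.
have sH : (size H <= 5)%N.
  by rewrite -(size_map_inj_poly (@intr_inj rat) (rmorph0 _)) -HE sG.
have [z' z'E] := quartic_pow3_root sH H4 HI HJ.
by exists (c * z' + r); rewrite -(rescale_root 4 _ _ _ c0) HE.
Qed.

(** * Counting points over finite fields *)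

(** The map generates a p-group acting on A without fixed points. *)
Lemma card_free_orbits (T : finType) (A : {set T}) (f : T -> T) (p : nat) : prime p ->
  {in A, forall x, f x \in A} -> {in A, forall x, iter p f x = x} ->
  {in A, forall x, f x != x} -> (p %| #|A|)%N.
Proof.
move=> pp fA fp fx; pose g x := if x \in A then f x else x.
have gA x : x \in A -> g x = f x by rewrite /g => ->.
have iterA n x : x \in A -> iter n f x \in A by move=> xA; elim: n => //= n; apply: fA.
have giter n x : x \in A -> iter n g x = iter n f x.
  by move=> xA; elim: n => //= n ->; rewrite gA // iterA.
have gid n x : x \notin A -> iter n g x = x.
  by move=> xA; elim: n => //= n ->; rewrite /g (negPf xA).
have gp x : iter p g x = x.
  by have [xA|xA] := boolP (x \in A); [rewrite giter // fp | rewrite gid].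
have ginj : injective g.
  by apply: (can_inj (g := iter p.-1 g)) => x; rewrite -iterSr prednK ?prime_gt0.
pose s := perm ginj.
have sp : (s ^+ p = 1)%g.
  by apply/permP => x; rewrite permX perm1 (eq_iter (permE ginj)) gp.
have pG : (p.-group <[s]>)%g.
  by rewrite /pgroup; apply: (@pnat_dvd _ p); rewrite ?pnat_id // order_dvdn sp.
have acts : [acts <[s]>, on A | 'P]%g.
  rewrite cycle_subG; apply/astabsP => x /=; rewrite apermE permE /g.
  by case: (boolP (x \in A)) => [/fA|/negPf].
have := pgroup_fix_mod pG acts.
rewrite (_ : 'Fix_(A | 'P)(<[s]>)%g = set0) ?cards0 ?mod0n; first by move/eqP.
apply/setP => x; rewrite in_setI in_set0; apply/negP => /andP[xA /afixP h].
have := h s (cycle_id s); rewrite /= apermE permE gA // => /eqP.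
by apply/negP; exact: fx.
Qed.

Section Counting.
Variable F : finFieldType.
Hypothesis two_neq0 : (2 : F) != 0.

(** The Weierstrass equation takes this form, with g the 2-division polynomial,
    when the square in y is completed. *)
Definition sqset (g : F -> F) : {set F * F} := [set P | P.2 ^+ 2 == g P.1].
Definition sqcurve (g : F -> F) : {set option (F * F)} :=
  [set P | if P is Some (x, v) then v ^+ 2 == g x else true].

Lemma card_option_set (T : finType) (A : {set option T}) (B : {set T}) :
  None \in A -> (forall x, (Some x \in A) = (x \in B)) -> #|A| = #|B|.+1.
Proof.
move=> NA AB; have -> : A = None |: (Some @: B).
  apply/setP => -[x|]; rewrite !inE ?NA //=.
  by rewrite AB mem_imset // => y z [].
rewrite cardsU1 card_imset; last by move=> y z [].
by case: imsetP => // -[].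
Qed.

Lemma card_sqcurve g : #|sqcurve g| = #|sqset g|.+1.
Proof. by apply: card_option_set; rewrite ?inE // => -[x v]; rewrite !inE. Qed.

Lemma card_sqset_shift (g : F -> F) (x0 : F) :
  #|sqset (fun x => g (x + x0))| = #|sqset g|.
Proof.
rewrite -(@card_imset _ _ (fun P : F * F => (P.1 - x0, P.2)) (mem (sqset g))).
  apply: eq_card => -[x v]; rewrite !inE /=; apply/idP/imsetP => [h|[[y w]]].
    by exists (x + x0, v); rewrite ?inE //= addrK.
  by rewrite inE /= => h [-> ->]; rewrite subrK.
by move=> [x v] [y w] /= [/(addIr _) -> ->].
Qed.

Lemma card_sqset_ext (g h : F -> F) : g =1 h -> #|sqset g| = #|sqset h|.
Proof. by move=> gh; apply: eq_card => P; rewrite !inE gh. Qed.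

(** Adding the point (0, 0) of order 2 is an involution without fixed points. *)
Lemma sqcurve_even (b c : F) : c != 0 -> b ^+ 2 - 16 * c != 0 ->
  (2 %| #|sqcurve (fun x => (x * (4 * x ^+ 2 + b * x + c))%R)|)%N.
Proof.
move=> c0 d0; set g := fun x => _.
have four0 : (4 : F) != 0 by rewrite (_ : 4 = 2 * 2) ?mulf_neq0 // -natrM.
pose f (P : option (F * F)) : option (F * F) :=
  if P is Some (x, v) then
    if x == 0 then None else Some (c / (4 * x), - c * v / (4 * x ^+ 2))
  else Some (0, 0).
apply: (@card_free_orbits _ _ f) => //.
- move=> [[x v]|]; rewrite !inE /f /=; last by rewrite /g mul0r expr0n.
  move=> /eqP vg; have [//|x0] := eqVneq x 0; apply/eqP.
  rewrite !exprMn vg /g; field; by rewrite four0 x0.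
- move=> [[x v]|]; rewrite !inE /f /=; last by rewrite eqxx.
  move=> /eqP vg; have [x0|x0] := eqVneq x 0.
    by move/eqP: vg; rewrite x0 /g mul0r sqrf_eq0 => /eqP ->.
  rewrite mulf_eq0 invr_eq0 mulf_eq0 (negPf c0) (negPf four0) (negPf x0) /=.
  by congr (Some (_, _)); field; rewrite x0 four0 c0.
move=> [[x v]|]; rewrite !inE /f //=.
move=> /eqP vg; have [//|x0] := eqVneq x 0; apply/eqP => -[h1 h2].
have cE : c = 4 * x ^+ 2.
  by rewrite expr2 mulrA -[X in _ * X]h1 mulrCA mulfV ?mulr1 // mulf_neq0.
have x20 : x ^+ 2 != 0 by rewrite expf_neq0.
have v0 : v = 0.
  move: h2; rewrite cE mulNr mulNr mulrAC mulfV ?mul1r ?mulf_neq0 //.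
  move=> /eqP; rewrite eq_sym -addr_eq0 -mulr2n -mulr_natl mulf_eq0 (negPf two_neq0).
  by move/eqP.
move: vg; rewrite v0 expr0n /= /g => /esym/eqP; rewrite mulf_eq0 (negPf x0) /= => /eqP h.
have bE : b = - 8 * x.
  apply: (mulIf x0); apply/eqP; rewrite -subr_eq0 -[X in _ == X]h cE; apply/eqP; ring.
by move: d0; rewrite bE cE => /eqP; apply; ring.
Qed.

(** With y = v - (k x + n), the equation reads A + B + C = - 2 k x and
    A B C = - 2 n m x^3 for A = y, B = - (v + k x + n), C = 2 n; adding the flex
    (0, - n) permutes A, B, C cyclically in projective coordinates. *)
Lemma sqcurve_mod3 (m k n : F) : m != 0 -> n != 0 ->
  (forall x, m * x ^+ 3 + (k * x + n) ^+ 2 = 0 ->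
             3 * m * x ^+ 2 + 2 * k * (k * x + n) != 0) ->
  (3 %| #|sqcurve (fun x => (m * x ^+ 3 + (k * x + n) ^+ 2)%R)|)%N.
Proof.
move=> m0 n0 nondeg; set g := fun x => _.
have nn : 2 * n != 0 by rewrite mulf_neq0.
have nV : - n != n by rewrite eq_sym -addr_eq0 -mulr2n -mulr_natl.
pose f (P : option (F * F)) : option (F * F) :=
  if P is Some (x, v) then
    if x == 0 then if v == n then None else Some (0, n)
    else let y := v - (k * x + n) in let x' := 2 * n * x / y in
      Some (x', - (2 * n * (v + k * x + n)) / y + k * x' + n)
  else Some (0, - n).
have on0 v : Some (0, v) \in sqcurve g -> v = n \/ v = - n.
  rewrite inE /g expr0n /= !mulr0 !add0r => /eqP h.
  by move/eqP: h; rewrite eqf_sqr => /orP[/eqP|/eqP]; [left | right].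
have yB x v : x != 0 -> Some (x, v) \in sqcurve g ->
    (v - (k * x + n)) * (v + k * x + n) = m * x ^+ 3.
  by move=> x0; rewrite inE => /eqP; rewrite /g => h; rewrite -addrA -subr_sqr h addrK.
have y0 x v : x != 0 -> Some (x, v) \in sqcurve g ->
    (v - (k * x + n) != 0) && (v + k * x + n != 0).
  by move=> x0 /(yB _ _ x0) h; rewrite -negb_or -mulf_eq0 h mulf_neq0 // expf_neq0.
have fA P : P \in sqcurve g -> f P \in sqcurve g.
  case: P => [[x v]|] PA; last by rewrite inE /f /g /= expr0n /= !mulr0 !add0r sqrrN.
  rewrite /f; have [_|x0] := eqVneq x 0.
    by case: eqP => _; rewrite inE // /g expr0n /= !mulr0 !add0r.
  have /andP[h1 h2] := y0 x v x0 PA; have h3 := yB x v x0 PA.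
  rewrite inE /g /=; set y := v - _ in h1 h3 *; apply/eqP.
  have -> : m * (2 * n * x / y) ^+ 3 = (2 * n) ^+ 3 * (v + k * x + n) / y ^+ 2.
    have -> : m * (2 * n * x / y) ^+ 3 = (m * x ^+ 3) * (2 * n) ^+ 3 / y ^+ 3 by field.
    by rewrite -h3; field.
  by rewrite /y; field.
have fN : f None = Some (0, - n) by [].
have fNn : f (Some (0, - n)) = Some (0, n) by rewrite /f eqxx (negPf nV).
have fn : f (Some (0, n)) = None by rewrite /f !eqxx.
pose pt y x := Some (x, y + (k * x + n)).
(* The parameters (y, b) of a point with x <> 0 are the coordinates A, B. *)
have step y x b : x != 0 -> y != 0 -> y + b + 2 * k * x + 2 * n = 0 ->
    f (pt y x) = pt (2 * n * b / y) (2 * n * x / y) /\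
    2 * n * b / y + 2 * n * (2 * n) / y + 2 * k * (2 * n * x / y) + 2 * n = 0.
  move=> x0 y0' e; split.
    rewrite /f /pt (negPf x0) addrK; congr (Some (_, _)).
    have -> : y + (k * x + n) + k * x + n = - b.
      by apply/eqP; rewrite -subr_eq0 opprK -[X in _ == X]e; apply/eqP; ring.
    by rewrite mulrN opprK addrA.
  have -> : 2 * n * b / y + 2 * n * (2 * n) / y + 2 * k * (2 * n * x / y) + 2 * n
    = 2 * n / y * (y + b + 2 * k * x + 2 * n) by field.
  by rewrite e mulr0.
have ptP x v : x != 0 -> Some (x, v) \in sqcurve g -> exists y b,
    [/\ Some (x, v) = pt y x, y != 0, b != 0, y * b = - (m * x ^+ 3) &
        y + b + 2 * k * x + 2 * n = 0].
  move=> x0 PA; exists (v - (k * x + n)), (- (v + k * x + n)).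
  have /andP[h1 h2] := y0 x v x0 PA; rewrite oppr_eq0 mulrN (yB x v x0 PA).
  by split=> //; [rewrite /pt subrK | ring].
apply: (@card_free_orbits _ _ f) => //.
- move=> P PA; rewrite !iterS /=; case: P PA => [[x v]|] PA; last by rewrite fN fNn fn.
  have [x0|x0] := eqVneq x 0.
    by rewrite x0 in PA *; have [->|->] := on0 v PA; rewrite ?fn ?fN ?fNn ?fn ?fN.
  have [y [b [-> y0' b0 _ e]]] := ptP x v x0 PA.
  have [-> e1] := step y x b x0 y0' e.
  have x1 : 2 * n * x / y != 0 by rewrite !mulf_neq0 ?invr_eq0.
  have y1 : 2 * n * b / y != 0 by rewrite !mulf_neq0 ?invr_eq0.
  have [-> e2] := step _ _ _ x1 y1 e1.
  have x2 : 2 * n * (2 * n * x / y) / (2 * n * b / y) != 0.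
    by rewrite !mulf_neq0 ?invr_eq0 // !mulf_neq0 ?invr_eq0.
  have y2 : 2 * n * (2 * n * (2 * n) / y) / (2 * n * b / y) != 0.
    by rewrite !mulf_neq0 ?invr_eq0 // !mulf_neq0 ?invr_eq0.
  have [-> _] := step _ _ _ x2 y2 e2.
  by congr pt; field; rewrite ?y0' ?b0 ?n0 ?two_neq0.
move=> P PA; case: P PA => [[x v]|] PA; last by rewrite fN.
have [x0|x0] := eqVneq x 0.
  rewrite x0 in PA *; have [->|->] := on0 v PA; rewrite ?fn ?fNn //.
  by apply/eqP => -[/esym/eqP]; rewrite (negPf nV).
have [y [b [-> y0' b0 yb e]]] := ptP x v x0 PA.
have [-> _] := step y x b x0 y0' e; apply/eqP => -[e1 e2].
have yE : y = 2 * n.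
  by apply: (mulIf x0); rewrite -{1}e1 mulrC divfK.
have bE : b = 2 * n.
  move: e2; rewrite e1 => /addIr; rewrite yE mulrAC mulfV // mul1r; exact.
rewrite yE bE in e yb.
have kx : k * x = - (3 * n).
  apply: (mulfI two_neq0); apply/eqP; rewrite -subr_eq0 -[X in _ == X]e; apply/eqP; ring.
have mx : m * x ^+ 3 = - (4 * n ^+ 2).
  by apply: oppr_inj; rewrite -yb; ring.
have h : m * x ^+ 3 + (k * x + n) ^+ 2 = 0 by rewrite mx kx; ring.
have := nondeg x h; apply/negP; rewrite negbK -(mulIr_eq0 _ (mulIf x0)); apply/eqP.
have -> : (3 * m * x ^+ 2 + 2 * k * (k * x + n)) * x
  = 3 * (m * x ^+ 3) + 2 * (k * x) * (k * x + n) by ring.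
by rewrite mx kx; ring.
Qed.

Definition nsqrt (c : F) : nat := #|[set v | v ^+ 2 == c]|.

Lemma card_sqset g : #|sqset g| = \sum_x nsqrt (g x).
Proof.
rewrite -sum1_card; under [RHS]eq_bigr => x _ do rewrite /nsqrt -sum1_card.
rewrite pair_big_dep /=; apply: eq_bigl => -[x v]; by rewrite !inE.
Qed.

Lemma nsqrt_le2 c : (nsqrt c <= 2)%N.
Proof.
rewrite /nsqrt; have [->|[w]] := set_0Vmem [set v | v ^+ 2 == c]; first by rewrite cards0.
rewrite inE => /eqP <-; apply: leq_trans (_ : #|[set w; - w]| <= 2)%N; last first.
  by rewrite cards2; case: (_ != _).
by apply: subset_leq_card; apply/subsetP => v; rewrite !inE eqf_sqr.
Qed.

Lemma nsqrt0 : nsqrt 0 = 1%N.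
Proof.
rewrite /nsqrt (_ : [set v | _] = [set 0]) ?cards1 //.
by apply/setP => v; rewrite !inE sqrf_eq0.
Qed.

Lemma sum_nsqrt : (\sum_c nsqrt c = #|F|)%N.
Proof.
have := card_sqset id; rewrite /= => <-; rewrite -(@card_imset _ _ (fun v : F => (v ^+ 2, v)) F).
  apply: eq_card => -[x v]; rewrite !inE /=; apply/eqP/imsetP => [<-|[w _ [-> ->]] //].
  by exists v.
by move=> v w [].
Qed.

(** At most two square roots exist in all, for each c; the sum over c being
    twice the number of elements of the field, there are always two. *)
Lemma nsqrt_twist (s c : F) : s != 0 -> (forall w, w ^+ 2 != s) ->
  (nsqrt c + nsqrt (s * c)%R = 2)%N.
Proof.
move=> s0 nsq.
have le2 d : (nsqrt d + nsqrt (s * d)%R <= 2 ?= iff (nsqrt d + nsqrt (s * d)%R == 2))%N.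
  split=> //; have [->|d0] := eqVneq d 0; first by rewrite mulr0 nsqrt0.
  have [h|] := eqVneq (nsqrt d) 0%N; first by rewrite h nsqrt_le2.
  rewrite /nsqrt cards_eq0 => /set0Pn[w]; rewrite inE => /eqP wd.
  rewrite (_ : [set v | v ^+ 2 == s * d] = set0) ?cards0 ?addn0; first exact: nsqrt_le2.
  apply/setP => u; rewrite !inE; apply/negP => /eqP us.
  have /eqP := nsq (u / w); apply; rewrite exprMn exprVn us wd mulfK //.
have e : (\sum_d nsqrt (s * d)%R = #|F|)%N.
  by rewrite -sum_nsqrt [RHS](reindex_inj (mulfI s0)).
have [_] := @leqif_sum _ xpredT _ _ _ (fun d _ => le2 d).
rewrite big_split /= sum_nsqrt e sum_nat_const addnn -muln2 eqxx.
by move=> /esym/forallP/(_ c)/eqP.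
Qed.

Lemma card_sqset_twist (s : F) g : s != 0 -> (forall w, w ^+ 2 != s) ->
  (#|sqset g| + #|sqset (fun x => (s * g x)%R)| = 2 * #|F|)%N.
Proof.
move=> s0 nsq; rewrite !card_sqset -big_split /= mulnC -sum_nat_const.
by apply: eq_bigr => x _; exact: nsqrt_twist.
Qed.

End Counting.

Lemma cubic_double_root_disc (R : comNzRingType) (a b c d x : R) :
  a * x ^+ 3 + b * x ^+ 2 + c * x + d = 0 -> 3 * a * x ^+ 2 + 2 * b * x + c = 0 ->
  cubic_disc a b c d = 0.
Proof.
move=> h1 h2; have cE : c = - (3 * a * x ^+ 2 + 2 * b * x).
  by apply/eqP; rewrite -addr_eq0 -[X in _ == X]h2; apply/eqP; ring.
have dE : d = - (a * x ^+ 3 + b * x ^+ 2 + c * x).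
  by apply/eqP; rewrite -addr_eq0 -[X in _ == X]h1; apply/eqP; ring.
by rewrite dE cE /cubic_disc; ring.
Qed.

(** Moving x to 0 would make b6 = b8 = 0, hence b4 = 0 and the discriminant 0. *)
Lemma three_poly_two_poly_neq0 (K : fieldType) (W : weierstrass K) (x : K) :
  wdisc W != 0 -> root (three_poly W) x -> (two_poly W).[x] != 0.
Proof.
move=> dW /rootP h3; apply/eqP => h2; pose V := change_model W 1 x 0 0.
have [V6 V8] : b6 V = 0 /\ b8 V = 0.
  by split; [rewrite -h2 horner_cubic_poly | rewrite -h3 horner_quartic_poly];
    rewrite /V /b2 /b4 /b6 /b8 /=; field; rewrite oner_neq0.
have V4 : b4 V = 0.
  by have := b8_rel V; rewrite V6 V8 !mulr0 sub0r => /eqP; rewrite eq_sym oppr_eq0 sqrf_eq0 => /eqP.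
have dV : wdisc V = wdisc W.
  by rewrite /V /wdisc /b2 /b4 /b6 /b8 /=; field; rewrite oner_neq0.
by move: dW; rewrite -dV /wdisc V6 V8 V4 (_ : _ + _ = 0) ?eqxx //; ring.
Qed.

Section CurveCount.
Variables (F : finFieldType) (W : weierstrass F).
Hypotheses (two_neq0 : (2 : F) != 0) (W_ns : wdisc W != 0).

Lemma pow2_neq0 k : ((2 ^ k)%:R : F) != 0.
Proof. by rewrite natrX expf_neq0. Qed.

Lemma two_poly_no_double_root x : (two_poly W).[x] = 0 ->
  12 * x ^+ 2 + 2 * b2 W * x + 2 * b4 W != 0.
Proof.
rewrite horner_cubic_poly => h; apply/eqP => h'.
have : poly_disc3 (two_poly W) = 0.
  rewrite /poly_disc3 !cubic_poly_coef /=; apply: (cubic_double_root_disc (x := x)) => //.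
  by rewrite -[RHS]h'; ring.
rewrite two_poly_disc => /eqP; rewrite mulf_eq0 (negPf W_ns) orbF.
by rewrite (negPf (pow2_neq0 4)).
Qed.

(** Completing the square: v = 2 y + a1 x + a3. *)
Lemma card_on_curve : #|[set P | on_curve W P]| = #|sqcurve (fun x => (two_poly W).[x])|.
Proof.
rewrite card_sqcurve (@card_option_set _ _ [set P | on_affine W P]); last first.
- by move=> P; rewrite !inE.
- by rewrite inE.
congr _.+1; pose f (P : F * F) := (P.1, 2 * P.2 + wa1 W * P.1 + wa3 W).
rewrite -(@card_imset _ _ f); last first.
  by move=> [x y] [x' y'] [-> /addIr/addIr/(mulfI two_neq0) ->].
have affE x y : on_affine W (x, y) =
    ((2 * y + wa1 W * x + wa3 W) ^+ 2 == (two_poly W).[x]).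
  rewrite /on_affine -subr_eq0 -[RHS]subr_eq0 horner_cubic_poly.
  rewrite (_ : (2 * y + wa1 W * x + wa3 W) ^+ 2 - _ = 4 * (y ^+ 2 + wa1 W * x * y + wa3 W * y
     - (x ^+ 3 + wa2 W * x ^+ 2 + wa4 W * x + wa6 W))); last by rewrite /b2 /b4 /b6; ring.
  by rewrite mulf_eq0 (negPf (pow2_neq0 2)).
apply: eq_card => -[x v]; rewrite [RHS]inE /=; apply/imsetP/idP => [[[x' y] /=]|h].
  by rewrite inE affE => h [-> ->].
exists (x, (v - wa1 W * x - wa3 W) / 2); last first.
  by rewrite /f /=; congr pair; field.
rewrite inE affE (_ : 2 * _ + _ + _ = v); last by field.
by [].
Qed.

Lemma card_on_curve_shift x0 : #|[set P | on_curve W P]|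
  = #|sqcurve (fun x => (two_poly W).[x + x0])|.
Proof.
rewrite card_on_curve !card_sqcurve.
by rewrite -(card_sqset_shift (fun x => (two_poly W).[x]) x0).
Qed.

Lemma two_poly_shift x x0 : (two_poly W).[x + x0]
  = 4 * x ^+ 3 + (12 * x0 + b2 W) * x ^+ 2 + (12 * x0 ^+ 2 + 2 * b2 W * x0 + 2 * b4 W) * x
    + (two_poly W).[x0].
Proof. by rewrite !horner_cubic_poly; ring. Qed.

Lemma card_even x0 : root (two_poly W) x0 -> (2 %| #|[set P | on_curve W P]|)%N.
Proof.
move=> /rootP r0; rewrite (card_on_curve_shift x0).
pose b := 12 * x0 + b2 W; pose c := 12 * x0 ^+ 2 + 2 * b2 W * x0 + 2 * b4 W.
have gE x : (two_poly W).[x + x0] = x * (4 * x ^+ 2 + b * x + c).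
  by rewrite two_poly_shift r0 /b /c; ring.
have -> : #|sqcurve (fun x => (two_poly W).[x + x0])|
   = #|sqcurve (fun x => x * (4 * x ^+ 2 + b * x + c))|.
  by rewrite !card_sqcurve; congr _.+1; apply: card_sqset_ext.
apply: sqcurve_even => //; first exact: two_poly_no_double_root.
apply/eqP => d0; have eight0 : (8 : F) != 0 := pow2_neq0 3.
have four0 : (4 : F) != 0 := pow2_neq0 2.
pose x := - b / 8.
have qx : 4 * x ^+ 2 + b * x + c = 0.
  have -> : 4 * x ^+ 2 + b * x + c = - (b ^+ 2 - 16 * c) / 16.
    by rewrite /x; field; rewrite ?(pow2_neq0 4) ?eight0.
  by rewrite d0 oppr0 mul0r.
have := @two_poly_no_double_root (x + x0); rewrite gE qx mulr0 => /(_ erefl)/eqP; apply.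
have -> : 12 * (x + x0) ^+ 2 + 2 * b2 W * (x + x0) + 2 * b4 W
  = (4 * x ^+ 2 + b * x + c) + x * (8 * x + b) by rewrite /b /c; ring.
by rewrite qx /x mulrCA mulfV // mulr1 addNr mulr0 addr0.
Qed.

(** This follows from the identity 4 psi = (12 x + b2) phi - (phi' / 2)^2 for
    the 2- and 3-division polynomials phi and psi. *)
Lemma three_poly_two_poly x0 : root (three_poly W) x0 ->
  (12 * x0 + b2 W) * (two_poly W).[x0] = (b4 W + b2 W * x0 + 6 * x0 ^+ 2) ^+ 2.
Proof.
move=> /rootP r0; apply/eqP; rewrite -subr_eq0.
rewrite -(mulr0 4) -r0 horner_cubic_poly horner_quartic_poly; apply/eqP.
have := b8_rel W; move: (b8 W) (b2 W) (b4 W) (b6 W) => t x y z rel.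
have -> : 4 * (3 * x0 ^+ 4 + x * x0 ^+ 3 + 3 * y * x0 ^+ 2 + 3 * z * x0 + t)
  = 4 * (3 * x0 ^+ 4 + x * x0 ^+ 3 + 3 * y * x0 ^+ 2 + 3 * z * x0) + (x * z - y ^+ 2).
  by rewrite -rel; ring.
by ring.
Qed.

(** If x0 is the abscissa of a point of order 3 and t the value of the
    2-division polynomial there, the curve is v^2 = 4 x^3 + (B x + t)^2 / t
    after moving x0 to 0. When t is a square, this has the shape treated in
    [sqcurve_mod3]. *)
Lemma card_mod3_square x0 w : root (three_poly W) x0 -> (two_poly W).[x0] = w ^+ 2 ->
  (3 %| #|[set P | on_curve W P]|)%N.
Proof.
move=> r0 tw; have t0 := three_poly_two_poly_neq0 W_ns r0; rewrite (card_on_curve_shift x0).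
have w0 : w != 0 by move: t0; rewrite tw sqrf_eq0.
pose B := b4 W + b2 W * x0 + 6 * x0 ^+ 2.
have gE x : (two_poly W).[x + x0] = 4 * x ^+ 3 + (B / w * x + w) ^+ 2.
  have := three_poly_two_poly r0; rewrite -/B tw => e.
  rewrite two_poly_shift tw (_ : (12 * x0 + b2 W) = B ^+ 2 / w ^+ 2); last first.
    by rewrite -e mulfK // expf_neq0.
  by rewrite /B; field.
have -> : #|sqcurve (fun x => (two_poly W).[x + x0])|
   = #|sqcurve (fun x => 4 * x ^+ 3 + (B / w * x + w) ^+ 2)|.
  by rewrite !card_sqcurve; congr _.+1; apply: card_sqset_ext.
apply: sqcurve_mod3 => //; first exact: (pow2_neq0 2).
move=> x; rewrite -gE => gx; have := two_poly_no_double_root gx; apply: contra => /eqP h.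
have e := three_poly_two_poly r0; rewrite -/B tw in e.
have b2E : b2 W = B ^+ 2 / w ^+ 2 - 12 * x0.
  by rewrite -e mulfK ?expf_neq0 // addrC addKr.
rewrite -[X in _ == X]h (_ : 2 * b4 W = 2 * (B - b2 W * x0 - 6 * x0 ^+ 2)); last by rewrite /B; ring.
by rewrite b2E; apply/eqP; field.
Qed.

(** The quadratic twist by t of the curve has the shape treated in
    [sqcurve_mod3]; the curve and its twist together have 2 (#|F| + 1) points, a
    multiple of 3. *)
Lemma card_mod3_nonsquare x0 : root (three_poly W) x0 ->
  (forall w, w ^+ 2 != (two_poly W).[x0]) -> (#|F| %% 3 = 2)%N ->
  (3 %| #|[set P | on_curve W P]|)%N.
Proof.
move=> r0 nsq F2; have t0 := three_poly_two_poly_neq0 W_ns r0; rewrite (card_on_curve_shift x0).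
set t := (two_poly W).[x0] in nsq t0 *.
pose B := b4 W + b2 W * x0 + 6 * x0 ^+ 2.
have gE x : t * (two_poly W).[x + x0] = 4 * t * x ^+ 3 + (B * x + t) ^+ 2.
  have := three_poly_two_poly r0; rewrite -/B -/t => e.
  rewrite two_poly_shift -/t.
  have -> : t * (4 * x ^+ 3 + (12 * x0 + b2 W) * x ^+ 2
      + (12 * x0 ^+ 2 + 2 * b2 W * x0 + 2 * b4 W) * x + t)
    = 4 * t * x ^+ 3 + ((12 * x0 + b2 W) * t) * x ^+ 2 + 2 * t * B * x + t ^+ 2.
    by rewrite /B; ring.
  by rewrite e; ring.
have := card_sqset_twist (fun x => (two_poly W).[x + x0]) t0 nsq.
have : (3 %| #|sqcurve (fun x => (4 * t * x ^+ 3 + (B * x + t) ^+ 2)%R)|)%N.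
  apply: sqcurve_mod3 => //; first by rewrite mulf_neq0 // (pow2_neq0 2).
  move=> x; rewrite -gE => /eqP; rewrite mulf_eq0 (negPf t0) => /eqP gx.
  have := two_poly_no_double_root gx; apply: contra => /eqP h.
  have e := three_poly_two_poly r0; rewrite -/B -/t in e.
  rewrite -(mulrI_eq0 _ (mulfI t0)); apply/eqP; rewrite -[RHS]h.
  have -> : t * (12 * (x + x0) ^+ 2 + 2 * b2 W * (x + x0) + 2 * b4 W)
    = 12 * t * x ^+ 2 + 2 * ((12 * x0 + b2 W) * t) * x + 2 * t * B by rewrite /B; ring.
  by rewrite e; ring.
rewrite !card_sqcurve (card_sqset_ext (h := fun x => t * (two_poly W).[x + x0])); last first.
  by move=> x; rewrite gE.
by move: #|_| #|_| #|_| F2 => f n m F2 h1 h2; lia.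
Qed.

End CurveCount.

Lemma F2_cases (a : 'F_2) : a = 0 \/ a = 1.
Proof. by case: a => -[|[|//]] h; [left|right]; apply: val_inj. Qed.

(** Completing the square fails in characteristic 2; all coefficients and
    abscissas are enumerated. *)
Lemma card_F2 (W : weierstrass 'F_2) x0 : wdisc W != 0 -> root (three_poly W) x0 ->
  #|[set P | on_curve W P]| = 3.
Proof.
move=> dW r0; rewrite (@card_option_set _ _ [set P | on_affine W P]); last first.
- by move=> P; rewrite !inE.
- by rewrite inE.
have -> : #|[set P | on_affine W P]| = (\sum_(x : 'F_2) \sum_(y : 'F_2) on_affine W (x, y))%N.
  rewrite -sum1_card big_mkcond /=.
  rewrite (eq_bigr (fun P : 'F_2 * 'F_2 => nat_of_bool (on_affine W (P.1, P.2)))).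
    by rewrite -(pair_bigA _ (fun x y => nat_of_bool (on_affine W (x, y)))).
  by move=> [x y] _; rewrite inE; case: on_affine.
congr _.+1; rewrite !big_ord_recl !big_ord0.
move: dW r0; rewrite /root horner_quartic_poly.
case: W => a1 a2 a3 a4 a6.
have [->|->] := F2_cases a1; have [->|->] := F2_cases a2; have [->|->] := F2_cases a3;
have [->|->] := F2_cases a4; have [->|->] := F2_cases a6; have [->|->] := F2_cases x0;
by vm_compute.
Qed.

(** * Points of order 3 and square classes *)

(** In a good model the abscissa is a root of a polynomial with leading
    coefficient 3, a unit at l, so it is l-integral and can be reduced. The
    value of the 2-division polynomial changes by a square factor from E to the
    good model. *)
Lemma three_torsion_local (E : weierstrass rat) (x : rat) (l : nat) (pl : prime l) :
  good_reduction l E -> root (three_poly E) x -> ((3 : rat)^-1 \is a lint l) ->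
  exists (u : rat) (W : weierstrass (lrat l)) (X : lrat l),
  [/\ u != 0, reduction l E = map_weierstrass (redm pl) W, redm pl (wdisc W) != 0,
      root (three_poly (map_weierstrass (redm pl) W)) (redm pl X) &
      (two_poly E).[x] = u ^+ 2 * val ((two_poly W).[X])].
Proof.
move=> good x3 lV3; have [u [r [s [t [W [u0 WE redE Wd]]]]]] := good_model pl good.
have u20 : u ^+ 2 != 0 by rewrite expf_neq0.
pose y := (x - r) / u ^+ 2; have xE : x = u ^+ 2 * y + r by rewrite /y mulrC divfK ?subrK.
have y3 : root (three_poly (map_weierstrass val W)) y.
  by rewrite WE three_poly_change // rescale_root // -xE.
have yl : y \is a lint l.
  apply: (lint_root pl (G := three_poly (map_weierstrass val W))).
  - by rewrite three_poly_map; apply/polyOverP => i; rewrite coef_map; exact: valP.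
  - by rewrite size_quartic_poly.
  - by rewrite lead_coefE size_quartic_poly // quartic_poly_coef.
  - by rewrite (rootP y3) rpred0.
pose X : lrat l := Sub y yl; exists (u ^+ 3), W, X.
have X3 : (three_poly W).[X] = 0.
  apply: val_inj; move/rootP: y3; rewrite three_poly_map (_ : y = val X) //.
  by rewrite horner_map /= => ->.
split=> //; first by rewrite expf_neq0.
  by rewrite three_poly_map /root horner_map /= X3 rmorph0.
have <- : (two_poly (map_weierstrass val W)).[y] = val (two_poly W).[X].
  by rewrite two_poly_map (_ : y = val X) // horner_map.
have e : (u ^+ 2 *: 'X + r%:P).[y] = x by rewrite hornerD hornerZ hornerX hornerC -xE.
rewrite WE two_poly_change // /rescale hornerZ horner_comp e.
by rewrite -!exprM mulVKf // expf_neq0.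
Qed.

Lemma lint_sqr (l : nat) (y : rat) : prime l -> y ^+ 2 \is a lint l -> y \is a lint l.
Proof.
move=> pl y2; apply/idPn => yl.
have y0 : y != 0 by apply: contraNneq yl => ->; rewrite rpred0.
have yV0 : y^-1 != 0 by rewrite invr_eq0.
have [h|] := lint_dichotomy pl yV0; last by rewrite invrK (negPf yl).
have := rpredM (rpredM h (lint_div pl h)) y2.
rewrite (_ : _ * _ = l%:R^-1) ?(negPf (lint_invl pl)) //.
by field; rewrite y0 lprime_neq0.
Qed.

Lemma lint_int_div (l : nat) (T : int) : prime l -> T != 0 ->
  T%:~R / l%:R \is a lint l -> (l %| T)%Z.
Proof.
move=> pl T0 h; rewrite dvdzE; apply/idPn => lT.
have := lint_not_div pl h; rewrite -[_^-1]mul1r => /(_ (@pintegral_frac l 1 T _)).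
by rewrite prime_coprime // => /(_ lT)/eqP; rewrite intr_eq0 (negPf T0).
Qed.

Lemma square_class_step n : (0 < n)%N ->
  [\/ n = 1%N, n = 3%N, (9 %| n)%N | exists l, [/\ prime l, l != 3%N & (l %| n)%N]].
Proof.
move=> n0; have [n3|/pdiv_prime pl] := leqP n`_(3%N)^' 1; last first.
  constructor 4; exists (pdiv n`_(3%N)^'); split=> //.
    by have := pnat_dvd (pdiv_dvd _) (part_pnat (3%N)^' n); rewrite pnatE // !inE.
  exact: dvdn_trans (pdiv_dvd _) (dvdn_part _ _).
have nE : n = (3 ^ logn 3 n)%N.
  rewrite -{1}(@partnC 3%N n) // p_part (_ : (n`_(3%N)^')%N = 1%N) ?muln1 //.
  by apply/eqP; rewrite eqn_leq n3 part_gt0.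
rewrite nE; case: (logn 3 n) => [|[|k]]; [by constructor 1|by constructor 2|constructor 3].
by rewrite -[9%N]/(3 ^ 2)%N dvdn_exp2l.
Qed.

(** Start from an integer in the square class of t. Its valuation is even at
    every prime other than 3, so any such prime occurring in it, and 3 as well,
    can be removed two at a time. *)
Lemma square_class (t : rat) : t != 0 ->
  (forall l, prime l -> l != 3%N -> exists u v : rat,
     [/\ u != 0, t = u ^+ 2 * v, v \is a lint l & v^-1 \is a lint l]) ->
  exists (T : int) (w : rat), [/\ t = T%:~R * w ^+ 2, w != 0 & absz T = 1%N \/ absz T = 3%N].
Proof.
move=> t0 loc.
have descent N : forall (T : int) (w : rat), T != 0 -> w != 0 -> t = T%:~R * w ^+ 2 ->
    (absz T < N)%N -> exists (T : int) (w : rat),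
    [/\ t = T%:~R * w ^+ 2, w != 0 & absz T = 1%N \/ absz T = 3%N].
  elim: N => // N IH T w T0 w0 tE TN.
  have aT0 : (0 < absz T)%N by rewrite absz_gt0.
  have shrink (m : nat) (T' : int) : (1 < m)%N -> T = T' * (m ^ 2)%N ->
      exists (T : int) (w : rat), [/\ t = T%:~R * w ^+ 2, w != 0 & absz T = 1%N \/ absz T = 3%N].
    move=> m1 TE; have T'0 : T' != 0 by apply: contraNneq T0 => T'0; rewrite TE T'0 mul0r.
    apply: (IH T' (m%:R * w) T'0); first by rewrite mulf_neq0 // pnatr_eq0 -lt0n ltnW.
      rewrite tE TE rmorphM /= -[((m ^ 2)%N : int)%:~R]/((m ^ 2)%:R) natrX; ring.
    apply: (@leq_trans (absz T)) => //.
    by rewrite TE abszM ltn_Pmulr ?absz_gt0 // -{1}(exp1n 2) ltn_exp2r.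
  have [h|h|h|[l [pl l3 lT]]] := square_class_step aT0.
  - by exists T, w; split=> //; left.
  - by exists T, w; split=> //; right.
  - have /dvdzP[T' TE] : (9%N %| T)%Z by [].
    exact: (shrink 3 T').
  have [u [v [u0 tu vl vVl]]] := loc l pl l3.
  have l0 := lprime_neq0 pl.
  have TR0 : T%:~R != 0 :> rat by rewrite intr_eq0.
  have v0 : v != 0.
    by move: t0; apply: contraNneq => v0; rewrite tu v0 mulr0.
  pose y := w / u; have vE : v = T%:~R * y ^+ 2.
    apply: (mulfI (expf_neq0 2 u0)); rewrite -tu tE /y; field.
    by [].
  have y0 : y != 0 by rewrite mulf_neq0 ?invr_eq0.
  have yV0 : y^-1 != 0 by rewrite invr_eq0.
  have yVl : y^-1 \is a lint l.
    have [yl|//] := lint_dichotomy pl y0; exfalso.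
    have vd : v / l%:R \is a lint l.
      rewrite vE (_ : _ / _ = T%:~R * y * (y / l%:R)); last by field.
      by rewrite rpredM // rpredM ?lint_int // (lint_div pl).
    by have /eqP := lint_not_div pl vd vVl; rewrite (negPf v0).
  have [yVd|] := lint_dichotomy pl yV0; last first.
    rewrite invrK => yl; exfalso.
    have /dvdzP[T1 T1E] : (l%N %| T)%Z by [].
    have Td : T%:~R / l%:R \is a lint l.
      by rewrite T1E rmorphM /= -[(l%:Z)%:~R]/(l%:R) mulfK // lint_int.
    have TV : (T%:~R)^-1 \is a lint l.
      have -> : (T%:~R)^-1 = v^-1 * y ^+ 2 by rewrite vE; field; rewrite y0 TR0.
      by rewrite rpredM // rpredX.
    by have /eqP := lint_not_div pl Td TV; rewrite (negPf TR0).
  have /dvdzP[T1 T1E] : (l%N %| T)%Z by [].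
  have T10 : T1 != 0 by apply: contraNneq T0 => h; rewrite T1E h mul0r.
  have /dvdzP[T2 T2E] : (l%N %| T1)%Z.
    apply: lint_int_div => //; have -> : T1%:~R / l%:R = v * (y^-1 / l%:R) ^+ 2.
      rewrite vE T1E rmorphM /= -[(l%:Z)%:~R]/(l%:R); field.
      by rewrite y0 l0.
    by rewrite rpredM // rpredX.
  by apply: (shrink l T2); rewrite ?prime_gt1 // T1E T2E -mulrA -PoszM mulnn.
have n0 : numq t != 0 by rewrite numq_eq0.
have d0 : (denq t)%:~R != 0 :> rat by rewrite intr_eq0 denq_neq0.
apply: (descent _ (numq t * denq t) (denq t)%:~R^-1 _ _ _ (ltnSn _)).
- by rewrite mulf_neq0 // denq_neq0.
- by rewrite invr_eq0.
by rewrite -{1}[t]divq_num_den rmorphM /=; field.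
Qed.

(** Odd squares are 1 modulo 4, so T is 1 modulo 4. *)
Lemma unit_square_mod4 (T o e m : int) : T * o ^+ 2 = e ^+ 2 + 4 * m ->
  (exists i, o = 2 * i + 1) -> absz T = 1%N \/ absz T = 3%N -> T = 1 \/ T = - 3.
Proof.
move=> E [i oE] hT; move: E; rewrite oE {o oE} => E.
have : [\/ T = 1, T = - 1, T = 3 | T = - 3].
  by case: T hT {E} => [[|[|[|[|n]]]]|[|[|[|n]]]] [] //; [constructor 1|constructor 3|constructor 2|constructor 4].
have [k [kE|kE]] := int_mod2 e; move: E; rewrite kE => E [] TE; move: E;
  rewrite TE {hT TE kE}; clear; lia.
Qed.

(** A unit at 2 of the form a^2 + 4 z is a square modulo 4, which excludes the
    square classes of -1 and 3. *)
Lemma square_class_at2 (T : int) (y a z : rat) :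
  absz T = 1%N \/ absz T = 3%N -> a \is a lint 2 -> z \is a lint 2 ->
  (T%:~R * y ^+ 2)^-1 \is a lint 2 -> T%:~R * y ^+ 2 \is a lint 2 ->
  T%:~R * y ^+ 2 = a ^+ 2 + 4 * z -> y != 0 -> T = 1 \/ T = - 3.
Proof.
move=> hT al zl vV vl e y0.
have T0 : T%:~R != 0 :> rat by rewrite intr_eq0; case: hT => h; apply/eqP => T0; rewrite T0 in h.
have yVl : y^-1 \is a lint 2.
  apply: lint_sqr => //; have -> : y^-1 ^+ 2 = T%:~R * (T%:~R * y ^+ 2)^-1.
    by field; rewrite y0 T0.
  by rewrite rpredM // lint_int.
have TV : T%:~R^-1 \is a lint 2.
  by rewrite -[_^-1]mul1r; apply: (@pintegral_frac 2 1 T); case: hT => ->.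
have yl : y \is a lint 2.
  apply: lint_sqr => //; have -> : y ^+ 2 = T%:~R^-1 * (T%:~R * y ^+ 2) by rewrite mulKf.
  by rewrite rpredM.
have den_odd (x : rat) : x \is a lint 2 -> exists k, denq x = 2 * k + 1.
  rewrite -[_ \is a _]/(coprime 2 `|denq x|) prime_coprime // dvdn2 negbK => h.
  by have [k [kE|kE]] := int_mod2 (denq x); [move: h; rewrite kE abszM oddM | exists k].
have num_odd : exists k, numq y = 2 * k + 1.
  have [k [kE|kE]] := int_mod2 (numq y); last by exists k.
  have yd : y / 2%:R \is a lint 2.
    have -> : y / 2%:R = k%:~R * (denq y)%:~R^-1.
      by rewrite -{1}[y]divq_num_den kE rmorphM /=; field; rewrite intr_eq0 denq_neq0.
    rewrite rpredM ?lint_int // -[_^-1]mul1r; apply: (@pintegral_frac 2 1 (denq y)).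
    exact: yl.
  by have /eqP := lint_not_div (isT : prime 2) yd yVl; rewrite (negPf y0).
have [k1 e1] := num_odd; have [k2 e2] := den_odd _ yl; have [k3 e3] := den_odd _ al.
have [k4 e4] := den_odd _ zl.
have E : T * (numq y * denq a * denq z) ^+ 2
    = (numq a * denq y * denq z) ^+ 2 + 4 * (numq z * denq z * (denq y * denq a) ^+ 2).
  apply: (@intr_inj rat); rewrite rmorphM rmorphD !rmorphXn rmorphM [in RHS]rmorphM /=.
  rewrite !(rmorphM, rmorphXn) /= !numqE.
  have -> : T%:~R * (y * (denq y)%:~R * (denq a)%:~R * (denq z)%:~R) ^+ 2
    = T%:~R * y ^+ 2 * ((denq y)%:~R * (denq a)%:~R * (denq z)%:~R) ^+ 2 by ring.
  by rewrite e; ring.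
apply: (unit_square_mod4 E _ hT); exists (4 * k1 * k3 * k4 + 2 * (k1 * k3 + k1 * k4 + k3 * k4) + k1 + k3 + k4).
by rewrite e1 e3 e4; ring.
Qed.

(** * Points of small order on the reductions *)

(** The square root is 2 w + 1 for a primitive cube root of unity w. *)
Lemma Fp_sqrt_m3 (l : nat) : prime l -> (l %% 3 = 1)%N ->
  exists d : 'F_l, d ^+ 2 = - 3.
Proof.
move=> pl l3; have c3 : (3 %| #|[set: {unit 'F_l}]|)%N.
  by rewrite card_finField_unit card_Fp // -subn1 -eqn_mod_dvd ?prime_gt0 // l3.
have [x _ ox] := Cauchy (isT : prime 3) c3.
pose w : 'F_l := FinRing.uval x.
have w3 : w ^+ 3 = 1.
  by rewrite /w -FinRing.val_unitX -ox expg_order.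
have w1 : w - 1 != 0.
  rewrite subr_eq0; apply/eqP => w1.
  have x1 : x = 1%g by apply: val_inj.
  by move: ox; rewrite x1 order1.
have : (w - 1) * (w ^+ 2 + w + 1) = 0.
  by have -> : (w - 1) * (w ^+ 2 + w + 1) = w ^+ 3 - 1 by [ring]; rewrite w3 subrr.
move/eqP; rewrite mulf_eq0 (negPf w1) /= => /eqP e.
exists (2 * w + 1); have -> : (2 * w + 1) ^+ 2 = 4 * (w ^+ 2 + w + 1) - 3 by ring.
by rewrite e mulr0 sub0r.
Qed.

Lemma Fp_two_neq0 (l : nat) : prime l -> l != 2%N -> 2 != 0 :> 'F_l.
Proof.
move=> pl l2; rewrite -[2]/(2%:Z%:~R) intr_Fp_eq0 //=.
by rewrite dvdn_prime2.
Qed.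

(** The rational root is integral at l in a good model, where the leading
    coefficient 4 is a unit, and it reduces to the abscissa of a point of order
    2. *)
Lemma two_dvd_card (E : weierstrass rat) (l : nat) : nonsingular E ->
  (forall l, prime l -> l != 2%N -> good_reduction l E) ->
  prime l -> l != 2%N ->
  (2 %| #|[set P | on_curve (reduction l E) P]|)%N.
Proof.
move=> nsE good pl l2; have [x x2] := two_poly_rational_root nsE good.
have [u [r [s [t [W [u0 WE -> Wd]]]]]] := good_model pl (good l pl l2).
have u20 : u ^+ 2 != 0 by rewrite expf_neq0.
pose y := (x - r) / u ^+ 2; have xE : x = u ^+ 2 * y + r by rewrite /y mulrC divfK ?subrK.
have y2 : root (two_poly (map_weierstrass val W)) y.
  by rewrite WE two_poly_change // rescale_root // -xE.
have yl : y \is a lint l.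
  apply: (lint_root pl (G := two_poly (map_weierstrass val W))).
  - by rewrite two_poly_map; apply/polyOverP => i; rewrite coef_map; exact: valP.
  - by rewrite size_cubic_poly.
  - rewrite lead_coefE size_cubic_poly // cubic_poly_coef /=.
    exact: (@lint_natV l 2 2).
  - by rewrite (rootP y2) rpred0.
pose X : lrat l := Sub y yl.
have X2 : (two_poly W).[X] = 0.
  apply: val_inj; move/rootP: y2; rewrite two_poly_map (_ : y = val X) //.
  by rewrite horner_map /= => ->.
apply: (card_even (Fp_two_neq0 pl l2) _ (x0 := redm pl X)).
  by rewrite wdisc_map.
by rewrite two_poly_map /root horner_map /= X2 rmorph0.
Qed.

(** At a prime l other than 3 the value is a square times the value in a good
    model, which is a unit since the reduction is nonsingular. At 2 this unit is
    (a1 X + a3)^2 + 4 (X^3 + a2 X^2 + a4 X + a6), so -1 and 3 are excluded. *)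
Lemma three_torsion_square_class (E : weierstrass rat) (x : rat) :
  (forall l, prime l -> l != 3%N -> good_reduction l E) ->
  root (three_poly E) x ->
  exists (T : int) (w : rat), [/\ (two_poly E).[x] = T%:~R * w ^+ 2, w != 0 &
    T = 1 \/ T = - 3].
Proof.
move=> good x3; set t := (two_poly E).[x].
have local l (pl : prime l) : l != 3%N -> exists (u : rat) (W : weierstrass (lrat l)) (X : lrat l),
    [/\ u != 0, t = u ^+ 2 * val ((two_poly W).[X]), val ((two_poly W).[X]) != 0 &
     (val ((two_poly W).[X]))^-1 \is a lint l].
  move=> l3; have [//|u [W [X [u0 _ Wd W3 tE]]]] := three_torsion_local pl (good l pl l3) x3.
    exact: (@lint_natV l 3 1).
  exists u, W, X; have W2 : redm pl (two_poly W).[X] != 0.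
    rewrite -horner_map -two_poly_map; apply: three_poly_two_poly_neq0 => //.
    by rewrite wdisc_map.
  split=> //; last exact: redm_eq0 W2.
  apply: contraNneq W2 => h; rewrite (_ : _.[X] = 0) ?rmorph0 //; exact: val_inj.
have [u [W [X [u0 tE v0 vV]]]] := local 2%N isT isT.
have t0 : t != 0 by rewrite tE mulf_neq0 // expf_neq0.
have [|T [w [tw w0 hT]]] := square_class t0.
  move=> l pl l3; have [u' [W' [X' [u'0 t'E v'0 v'V]]]] := local l pl l3.
  by exists u', (val ((two_poly W').[X'])); split=> //; exact: valP.
exists T, w; split=> //.
pose y := w / u; have vE : T%:~R * y ^+ 2 = val (two_poly W).[X].
  by apply: (mulfI (expf_neq0 2 u0)); rewrite -tE tw /y; field.
apply: (square_class_at2 hT (y := y) (a := val (wa1 W * X + wa3 W))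
  (z := val (X ^+ 3 + wa2 W * X ^+ 2 + wa4 W * X + wa6 W))); rewrite ?vE //; try exact: valP.
  rewrite horner_cubic_poly /b2 /b4 /b6.
  have -> : 4 * X ^+ 3 + (wa1 W ^+ 2 + 4 * wa2 W) * X ^+ 2
    + 2 * (2 * wa4 W + wa1 W * wa3 W) * X + (wa3 W ^+ 2 + 4 * wa6 W)
    = (wa1 W * X + wa3 W) ^+ 2 + 4 * (X ^+ 3 + wa2 W * X ^+ 2 + wa4 W * X + wa6 W) by ring.
  by rewrite rmorphD rmorphXn rmorphM rmorph_nat.
by rewrite mulf_neq0 ?invr_eq0.
Qed.

(** If l is 1 modulo 3, then -3 is a square modulo l, and so is the value of the
    2-division polynomial at the abscissa of the point of order 3, whichever its
    class is. If l is 2 modulo 3, both cases of the count apply. *)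
Lemma three_dvd_card (E : weierstrass rat) (l : nat) : nonsingular E ->
  (forall l, prime l -> l != 3%N -> good_reduction l E) ->
  prime l -> l != 3%N ->
  (3 %| #|[set P | on_curve (reduction l E) P]|)%N.
Proof.
move=> nsE good pl l3; have [x x3] := three_poly_rational_root nsE good.
have [T [w [tw w0 hT]]] := three_torsion_square_class good x3.
have [//|u [W [X [u0 -> Wd W3 tE]]]] := three_torsion_local pl (good l pl l3) x3.
  exact: (@lint_natV l 3 1).
set V := map_weierstrass _ W.
have Vd : wdisc V != 0 by rewrite wdisc_map.
have [l2|l2] := eqVneq l 2%N.
  by move: pl W X {tE} Wd W3 @V Vd; rewrite l2 => pl W X Wd W3 V Vd; rewrite (card_F2 Vd W3).
have F2 := Fp_two_neq0 pl l2.
have [sq|/existsPn nsq] := boolP [exists z : 'F_l, z ^+ 2 == (two_poly V).[redm pl X]].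
  by case/existsP: sq => z /eqP/esym; apply: card_mod3_square.
have [l1|l1] : (l %% 3 = 1)%N \/ (l %% 3 = 2)%N.
  have : (l %% 3 != 0)%N by rewrite -[_ == _]/(3 %| l)%N dvdn_prime2 // eq_sym.
  by case: (l %% 3)%N (ltn_pmod l (isT : 0 < 3)%N) => [|[|[|]]] // _ _; [left|right].
- exfalso; pose y := w / u; have vE : val (two_poly W).[X] = T%:~R * y ^+ 2.
    by apply: (mulfI (expf_neq0 2 u0)); rewrite -tE tw /y; field.
  have yl : y \is a lint l.
    apply: lint_sqr => //; have -> : y ^+ 2 = T%:~R^-1 * val (two_poly W).[X].
      by rewrite vE mulKf // intr_eq0; case: hT => ->.
    rewrite rpredM ?(valP (two_poly W).[X]) //; case: hT => ->; rewrite ?invr1 ?rpred1 //.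
    by rewrite rmorphN invrN rpredN; exact: (@lint_natV l 3 1).
  pose Y : lrat l := Sub y yl.
  have vF : (two_poly V).[redm pl X] = T%:~R * redm pl Y ^+ 2.
    rewrite two_poly_map horner_map /=.
    have -> : (two_poly W).[X] = T%:~R * Y ^+ 2.
      by apply: val_inj; rewrite vE rmorphM rmorphXn rmorph_int.
    by rewrite rmorphM rmorphXn rmorph_int.
  have [d dE] := Fp_sqrt_m3 pl l1.
  case: hT vF => -> vF.
    by have /eqP := nsq (redm pl Y); rewrite vF mul1r.
  by have /eqP := nsq (d * redm pl Y); rewrite vF exprMn dE rmorphN.
- apply: (card_mod3_nonsquare F2 Vd W3) => //; last by rewrite card_Fp.
Qed.

(** * Conductor and conclusion *)

(** The wild part of the exponent is a sum of nonnegative terms, so the exponent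
    is positive at a prime of bad reduction. *)
Lemma good_of_exponent (E : weierstrass rat) (l : nat) :
  conductor_exponent l E 0%N -> good_reduction l E.
Proof.
rewrite /conductor_exponent; case: ifP => // _; case: ifP => // _ [d].
case=> [m [L [T [v [n [_ _ _ _ ->]]]]]] /eqP; rewrite eq_sym gt_eqF //.
rewrite ltr_wpDr // big_nat sumr_ge0 // => i _.
by rewrite mulr_ge0 ?divr_ge0 ?ler0n.
Qed.

Lemma frob_trace_additive (E : weierstrass rat) (l f : nat) :
  (1 < f)%N -> conductor_exponent l E f -> frob_trace E l = 0.
Proof.
rewrite /conductor_exponent /frob_trace => f1.
case: ifP => [_ f0|_]; first by rewrite f0 in f1.
case: ifP => [_ fE|nm _]; first by rewrite fE in f1.
case: ifP => // /existsP[P /andP[nodeP _]].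
by move/existsPn/(_ P): (negbT nm); rewrite nodeP.
Qed.

Lemma good_outside (E : weierstrass rat) (p e : nat) : prime p ->
  has_conductor E (p ^ e) -> forall l, prime l -> l != p -> good_reduction l E.
Proof.
move=> pp [_ cond] l pl lp; have := cond l pl.
rewrite lognX (logn_prime _ pp) (negPf lp) muln0.
exact (@good_of_exponent E l).
Qed.

Lemma frob_trace_at (E : weierstrass rat) (p e : nat) : prime p -> (1 < e)%N ->
  has_conductor E (p ^ e) -> frob_trace E p = 0.
Proof.
move=> pp e1 [_ cond]; have := cond p pp; rewrite (pfactorK _ pp).
exact (@frob_trace_additive E p e e1).
Qed.

Lemma eqz_mod_Fp (p : nat) (a b : int) : prime p ->
  a%:~R = b%:~R :> 'F_p -> (a = b %[mod p])%Z.
Proof.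
move=> pp ab; apply/eqP; rewrite eqz_mod_dvd dvdzE /= -intr_Fp_eq0 //.
by rewrite rmorphB /= ab subrr.
Qed.

Lemma frob_trace_Fp (E : weierstrass rat) (p l : nat) : prime p ->
  good_reduction l E -> (p %| #|[set P | on_curve (reduction l E) P]|)%N ->
  (frob_trace E l)%:~R = 1 + l%:R :> 'F_p.
Proof.
move=> pp gl; rewrite /frob_trace gl -[X in (X %| _)%N -> _]/p.
set n := #|_| => pn; rewrite rmorphB rmorphD /=.
have /eqP -> : (n : int)%:~R == 0 :> 'F_p by rewrite intr_Fp_eq0.
by rewrite subr0.
Qed.

Theorem mainTheorem3 (p N : nat)
  (hpN : (p = 2%N /\ N = 32%N) \/ (p = 3%N /\ N = 27%N))
  (E : weierstrass rat) (hE : nonsingular E) (hN : has_conductor E N)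
  (l : nat) (hl : prime l) :
  (frob_trace E l = tau l %[mod p])%Z.
Proof.
case: hpN => -[pE NE]; move: hN; rewrite {}pE {}NE {p N} => hN; apply: eqz_mod_Fp => //.
  rewrite tau_mod2 //; have cond : has_conductor E (2 ^ 5) by [].
  have [->|l2] := eqVneq l 2%N; first by rewrite (frob_trace_at (isT : prime 2) _ cond).
  have good := good_outside (isT : prime 2) cond.
  rewrite (frob_trace_Fp _ (good l hl l2)) //; last exact: two_dvd_card.
  have -> : 1 + l%:R = l.+1%:~R :> 'F_2 by rewrite -[l.+1%:~R]/(l.+1%:R) -natr1 addrC.
  apply/eqP; rewrite intr_Fp_eq0 // dvdn2 /= negbK.
  by have [l_eq|] := even_prime hl; [rewrite l_eq in l2|].
have cond : has_conductor E (3 ^ 3) by [].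
have [->|l3] := eqVneq l 3%N.
  by rewrite (frob_trace_at (isT : prime 3) _ cond) // tau3_mod3.
have good := good_outside (isT : prime 3) cond.
rewrite tau_mod3 // (frob_trace_Fp _ (good l hl l3)) //.
exact: three_dvd_card.
Qed.
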